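(* Let $X, X_1, X_2, \ldots$ be iid real random variables with $\mathbb{E}|X|<\infty$ and $\mathbb{E}X<0$, satisfying assumptions (A1), (A2), (A3) listed in the context, where $\alpha>1$ is the tail index in (A1). For $b\ge 0$ and $c\in\mathbb{R}$ let $\mathbb{Q}^{b,c}$ be the law of $\{S_n\}_{n\ge 0}$ with $S_0=0$ induced by the Blanchet-Glynn transition kernel $\mathsf{Q}^{b,c}$ defined in the context, and let $\tau_b=\inf\{n\ge 0: S_n>b\}$. Then: (i) If $\alpha\in(1,3/2)$, there exists some sufficiently large $c$ such that, for all $b\ge 0$, $\mathbb{Q}^{b,c}$ is a direct proposal for exact conditional sampling from $\mathbb{P}(\,\cdot\,|\,\tau_b<\infty)$. (ii) If $\alpha\in(3/2,2)$, then for all $c\in\mathbb{R}$ and all $b\ge 0$, $\mathbb{Q}^{b,c}$ is not a direct proposal for exact conditional sampling from $\mathbb{P}(\,\cdot\,|\,\tau_b<\infty)$.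
   Context: Random walk: under $\mathbb{P}$, $S_0=0$ and $S_n=\sum_{i=1}^n X_i$ with $X_i$ iid copies of $X$; $\mathsf{P}(y,\mathrm{d}z)=\mathbb{P}(S_1\in \mathrm{d}z\,|\,S_0=y)$ is its transition kernel. Standing assumption: $X$ has unbounded right support, i.e. $\mathbb{P}(X>t)>0$ for all $t$. Notation: $x^+=\max\{x,0\}$, $x^-=-\min\{x,0\}$; $f(t)\sim g(t)$ means $f(t)/g(t)\to 1$ as $t\to\infty$. Assumptions: (A1) The right tail is regularly varying with tail index $\alpha>1$: for all $u>0$, $\mathbb{P}(X>ut)\sim u^{-\alpha}\mathbb{P}(X>t)$ as $t\to\infty$. (A2) There exists a function $h$ with $h(t)\to\infty$, $h(t)=o(t)$ and $\int_{h(t)}^\infty \mathbb{P}(X^->s)\,\mathrm{d}s=o\big(t\,\mathbb{P}(X^+>t)\big)$ as $t\to\infty$. (A3) The distribution of $X$ has a continuous density $f$ which is regularly varying with tail index $\alpha+1$, i.e. $f(ut)\sim u^{-(\alpha+1)}f(t)$ as $t\to\infty$ for all $u>0$. Blanchet-Glynn kernel: for $x\in\mathbb{R}$ let $v(x)=\min\{1,\frac{1}{|\mathbb{E}X|}\int_{-x}^\infty \mathbb{P}(X>s)\,\mathrm{d}s\}$ and $w(x)=\mathbb{E}[v(x+X)]$. For $b\ge0$, $c\in\mathbb{R}$, $$\mathsf{Q}^{b,c}(y,\mathrm{d}z)=\mathsf{P}(y,\mathrm{d}z)\,\frac{v(z-b-c)}{w(y-b-c)},$$ which is a probability transition kernel.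 Direct proposal: let $\mathsf{Q}(y,\mathrm{d}z)$ be a transition kernel with $\mathsf{P}(y,\cdot)\ll\mathsf{Q}(y,\cdot)$ for all $y$, and let $\mathbb{Q}$ be the distribution of $\{S_n\}$ on $\mathbb{R}^{\mathbb{N}}$ (started at $S_0=0$) induced by $\mathsf{Q}$. $\mathbb{Q}$ is a direct proposal for exact conditional sampling from $\mathbb{P}(\cdot|\tau_b<\infty)$ iff $\mathbb{Q}(\{S_n\}\in B)\ge\mathbb{P}(\{S_n\}\in B)$ for all events $B\in\mathcal{F}_{\tau_b}$ with $B\subseteq\{\tau_b<\infty\}$, with strict inequality for some such $B$. Here $\mathcal{F}_{\tau_b}$ is the $\sigma$-algebra of the stopping time $\tau_b$ for the natural filtration of $\{S_n\}$. *)

(* Defs.v *)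
From mathcomp Require Import all_boot all_order all_algebra finmap.
From mathcomp Require Import all_classical all_reals all_analysis.
From mathcomp Require Import measurable_realfun.

Set Implicit Arguments.
Unset Strict Implicit.
Unset Printing Implicit Defensive.

Import Order.TTheory GRing.Theory Num.Theory.
Import numFieldNormedType.Exports.

Local Open Scope classical_set_scope.
Local Open Scope ring_scope.

Section increments.
Context {R : realType} {d : measure_display} {T : measurableType d}.
Variable P : probability T R.

(* The laws are compared on measurable sets only: the value of a measure on a
   non-measurable set is meaningless. *)
Definition identically_distributed (X Y : {RV P >-> R}) : Prop :=
  forall A : set R, measurable A -> distribution P X A = distribution P Y A.

Definition independent_family (Xs : nat -> {RV P >-> R}) : Prop :=
  forall (J : {fset nat}) (A : nat -> set R),
    (forall i, measurable (A i)) ->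
    P (\bigcap_(i in [set` J]) Xs i @^-1` A i) =
    (\prod_(i <- J) P (Xs i @^-1` A i))%E.

Definition iid_copies (X : {RV P >-> R}) (Xs : nat -> {RV P >-> R}) : Prop :=
  (forall i, identically_distributed (Xs i) X) /\ independent_family Xs.

(* Real-valued, so that the ratios below make sense. *)
Definition tail_prob (Y : T -> R) (t : R) : R := fine (P [set w | t < Y w]).

End increments.

Section asymptotics.
Context {R : realType}.

Definition asymp_equiv (f g : R -> R) : Prop :=
  f t / g t @[t --> +oo] --> (1 : R).

Definition asymp_littleo (f g : R -> R) : Prop :=
  forall eps : R, 0 < eps -> \forall t \near +oo, `|f t| <= eps * `|g t|.

Definition regularly_varying (f : R -> R) (rho : R) : Prop :=
  forall u : R, 0 < u ->
    asymp_equiv (fun t => f (u * t)) (fun t => u `^ (- rho) * f t).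

End asymptotics.

Section assumptions.
Context {R : realType} {d : measure_display} {T : measurableType d}.
Variables (P : probability T R) (X : {RV P >-> R}).

Definition unbounded_right_support : Prop :=
  forall t : R, (0 < P [set w | (t < X w)%R])%E.

Definition assumption_A1 (alpha : R) : Prop :=
  regularly_varying (tail_prob P X) alpha.

Definition assumption_A2 : Prop :=
  exists h : R -> R,
    [/\ h t @[t --> +oo] --> +oo,
        asymp_littleo h id &
        asymp_littleo
          (fun t => \int[lebesgue_measure]_(s in `[h t, +oo[)
                      tail_prob P (X^\-) s)%R
          (fun t => t * tail_prob P (X^\+) t)].

Definition assumption_A3 (alpha : R) : Prop :=
  exists f : R -> R,
    [/\ continuous f,
        forall x, 0 <= f x,
        forall A : set R, measurable A ->
          distribution P X A = (\int[lebesgue_measure]_(x in A) (f x)%:E)%E &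
        regularly_varying f (alpha + 1)].

End assumptions.

Section kernels.
Context {R : realType} {d : measure_display} {T : measurableType d}.
Variables (P : probability T R) (X : {RV P >-> R}).

Definition walk_kernel (y : R) : probability R R :=
  distribution P (cst y \+ X : {RV P >-> R}).

Definition bg_v (x : R) : R :=
  Num.min 1 (`|fine 'E_P[X]|^-1 *
             (\int[lebesgue_measure]_(s in `[- x, +oo[) tail_prob P X s)%R).

Definition bg_w (x : R) : R := fine ('E_P[fun w => bg_v (x + X w)]).

Definition bg_kernel (b c y : R) (A : set R) : \bar R :=
  (\int[walk_kernel y]_(z in A) (bg_v (z - b - c) / bg_w (y - b - c))%:E)%E.

End kernels.

(* The requirements on a proposal kernel hold for every [b] and [c]:
   [bg_kernel X b c] has total mass one and dominates the kernel of the walk. *)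
Section kernel_properties.
Context {R : realType} {d : measure_display} {T : measurableType d}.
Variables (P : probability T R) (X : {RV P >-> R}).
Hypothesis X_int : P.-integrable setT (EFin \o X).
Hypothesis EX_lt0 : ('E_P[X] < 0)%E.
Hypothesis X_unbounded : unbounded_right_support X.

Let mu : {measure set _ -> \bar R} := @lebesgue_measure R.

Let tail_probE t : (tail_prob P X t)%:E = ccdf X t.
Proof.
have -> : ccdf X t = P [set w | t < X w].
  by rewrite /ccdf /distribution /pushforward; congr (P _);
    apply/seteqP; split=> w /=; rewrite in_itv/= andbT.
rewrite fineK// fin_num_measure//.
have -> : [set w | t < X w] = X @^-1` `]t, +oo[%classic.
  by apply/seteqP; split=> w /=; rewrite in_itv/= andbT.
exact: measurable_funPTI.
Qed.

Let tail_ge0 t : 0 <= tail_prob P X t.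
Proof. by rewrite -lee_fin tail_probE measure_ge0. Qed.

Let tail_gt0 t : 0 < tail_prob P X t.
Proof.
rewrite -lte_fin fineK ?X_unbounded// fin_num_measure//.
have -> : [set w | t < X w] = X @^-1` `]t, +oo[%classic.
  by apply/seteqP; split=> w /=; rewrite in_itv/= andbT.
exact: measurable_funPTI.
Qed.

Let tail_le1 t : tail_prob P X t <= 1.
Proof. by rewrite -lee_fin tail_probE probability_le1. Qed.

Let tail_ninc : nonincreasing_fun (tail_prob P X).
Proof.
by move=> s t st; rewrite -lee_fin !tail_probE; exact: ccdf_nonincreasing.
Qed.

Let tail_measurable (D : set R) :
  measurable D -> measurable_fun D (EFin \o tail_prob P X).
Proof.
move=> mD; apply/measurable_EFinP.
exact: nonincreasing_measurable.
Qed.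

Let itail a := (\int[mu]_(s in `[a, +oo[) (tail_prob P X s)%:E)%E.

Let itail_lty a : (itail a < +oo)%E.
Proof.
pose D : set R := `[- `|a|, 0[%classic; pose E : set R := `[0, +oo[%classic.
have mD : measurable D by exact: measurable_itv.
have mE : measurable E by exact: measurable_itv.
have sub : `[a, +oo[%classic `<=` D `|` E.
  move=> x /=; rewrite /D /E/= !in_itv/= !andbT => ax.
  case: (ltP x 0) => x0; [left|by right].
  by rewrite andbT (le_trans _ ax)// lerNl -normrN ler_norm.
have : (itail a <= \int[mu]_(s in D `|` E) (tail_prob P X s)%:E)%E.
  apply: ge0_subset_integral => //; first exact: measurableU.
    by apply: tail_measurable; exact: measurableU.
  by move=> x _; rewrite lee_fin.
move/le_lt_trans; apply.
rewrite ge0_integral_setU//=; last 3 first.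
- by apply: tail_measurable; exact: measurableU.
- by move=> x _; rewrite lee_fin.
- apply/disj_set2P/seteqP; split=> x //= []; rewrite /D /E/= !in_itv/= andbT.
  by move=> /andP[_ x0]; rewrite leNgt x0.
apply: lte_add_pinfty.
  apply: (@le_lt_trans _ _ (\int[mu]_(s in D) 1)%E).
    apply: ge0_le_integral => //.
    + by move=> x _; rewrite lee_fin.
    + exact: tail_measurable.
    + by move=> x _; rewrite lee_fin.
  rewrite integral_cst//= mul1e /D lebesgue_measure_itv/=.
  by case: ifP => // _; rewrite ltry.
have Xp0 w : 0 <= (X^\+ : {mfun T >-> R}) w by exact: funrpos_ge0.
rewrite (_ : (\int[mu]_(_ in _) _ = 'E_P[X^\+])%E).
  rewrite unlock.
  have := integrable_lty measurableT (integrable_funepos measurableT X_int).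
  by congr (_ < _)%E; apply: eq_integral => w _; rewrite funeposE/= -fine_max.
rewrite (@ge0_expectation_ccdf _ _ _ P (X^\+ : {mfun T >-> R}))//.
apply: eq_integral => s; rewrite inE /E/= in_itv/= andbT => s0.
rewrite tail_probE /ccdf /distribution /pushforward; congr (P _).
apply/seteqP; split=> w /=; rewrite !in_itv/= !andbT /funrpos lt_max.
  by move=> ->.
by move=> /orP[//|]; rewrite ltNge s0.
Qed.

Let itail_gt0 a : (0 < itail a)%E.
Proof.
pose D : set R := `[a, a + 1]%classic.
have mD : measurable D by exact: measurable_itv.
have lo : (\int[mu]_(s in D) (tail_prob P X (a + 1))%:E <=
           \int[mu]_(s in D) (tail_prob P X s)%:E)%E.
  apply: ge0_le_integral => //.
  - by move=> x _; rewrite lee_fin.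
  - exact: tail_measurable.
  - move=> x; rewrite /D/= in_itv/= => /andP[_ xa].
    by rewrite lee_fin tail_ninc.
have hi : (\int[mu]_(s in D) (tail_prob P X s)%:E <= itail a)%E.
  apply: ge0_subset_integral => //; first exact: tail_measurable.
    by move=> x _; rewrite lee_fin.
  by move=> x; rewrite /D/= !in_itv/= andbT => /andP[].
apply: lt_le_trans (le_trans lo hi).
rewrite integral_cst//= /D lebesgue_measure_itv/= lte_fin ltrDl ltr01.
by rewrite -EFinB -EFinM lte_fin addrAC subrr add0r mulr1.
Qed.

Let itail_fin a : itail a \is a fin_num.
Proof. by rewrite ge0_fin_numE// ltW. Qed.

Let mean_gt0 : 0 < `|fine 'E_P[X]|^-1.
Proof.
rewrite invr_gt0 normr_gt0 fine_eq0 ?lt_eqF//.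
by rewrite unlock integrable_fin_num.
Qed.

Lemma bg_v_gt0 x : 0 < bg_v X x.
Proof.
by rewrite lt_min ltr01/= mulr_gt0// fine_gt0// itail_gt0 itail_lty.
Qed.

Lemma bg_v_le1 x : bg_v X x <= 1.
Proof. by rewrite ge_min lexx. Qed.

Lemma bg_v_nondecreasing : nondecreasing_fun (bg_v X).
Proof.
move=> x y xy; rewrite /bg_v le_min !ge_min lexx/= ler_pM2l//.
apply/orP; right; apply: fine_le; rewrite ?itail_fin//.
apply: ge0_subset_integral => //; first exact: tail_measurable.
  by move=> z _; rewrite lee_fin.
move=> z /=; rewrite !in_itv/= !andbT; apply: le_trans.
by rewrite lerN2.
Qed.

Lemma measurable_bg_v : measurable_fun setT (bg_v X).
Proof. exact: nondecreasing_measurable bg_v_nondecreasing. Qed.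

Let pos_integral0 d' (S : measurableType d') (m : {measure set S -> \bar R})
    (A : set S) (f : S -> R) :
  measurable A -> measurable_fun A f -> (forall x, 0 < f x) ->
  (\int[m]_(x in A) (f x)%:E)%E = 0%E -> m A = 0%E.
Proof.
move=> mA mf f0 int0.
have /(ae_eq_integral_abs m mA) : measurable_fun A (EFin \o f).
  exact/measurable_EFinP.
case=> + _; case.
  rewrite -int0; apply: eq_integral => x _ /=.
  by rewrite ger0_norm// ltW.
move=> N [mN N0 AN]; apply/eqP; rewrite eq_le measure_ge0 andbT -N0.
rewrite le_measure ?inE// => x Ax; apply: AN => /= /(_ Ax) [fx0].
by have := f0 x; rewrite fx0 ltxx.
Qed.

Let measurable_bg_v_shift x : measurable_fun setT (fun w => bg_v X (x + X w)).
Proof.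
apply: (measurableT_comp measurable_bg_v).
by apply: measurable_funD => //; exact: measurable_funPT.
Qed.

Let bg_w_integral x :
  (bg_w X x)%:E = (\int[P]_w (bg_v X (x + X w))%:E)%E.
Proof.
rewrite /bg_w unlock fineK// ge0_fin_numE; last first.
  by apply: integral_ge0 => w _; rewrite lee_fin ltW// bg_v_gt0.
apply: (@le_lt_trans _ _ (\int[P]_w 1)%E).
  apply: ge0_le_integral => //.
  - by move=> w _; rewrite lee_fin ltW// bg_v_gt0.
  - exact/measurable_EFinP.
  - by move=> w _; rewrite lee_fin bg_v_le1.
by rewrite integral_cst//= probability_setT mul1e ltry.
Qed.

Lemma bg_w_gt0 x : 0 < bg_w X x.
Proof.
rewrite -lte_fin bg_w_integral lt_def integral_ge0 ?andbT; last first.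
  by move=> w _; rewrite lee_fin ltW// bg_v_gt0.
apply/eqP => w0.
have := pos_integral0 measurableT (measurable_bg_v_shift x)
  (fun w => bg_v_gt0 _) w0.
by rewrite [X in X = _]probability_setT => /eqP; rewrite onee_eq0.
Qed.

Let measurable_density b c y (A : set R) : measurable A ->
  measurable_fun A (fun z => bg_v X (z - b - c) / bg_w X (y - b - c)).
Proof.
move=> mA; apply: measurable_funTS; apply: measurable_funM => //.
apply: (measurableT_comp measurable_bg_v).
by apply: measurable_funB => //; apply: measurable_funB.
Qed.

Let density_gt0 b c y z : 0 < bg_v X (z - b - c) / bg_w X (y - b - c).
Proof. by rewrite divr_gt0 ?bg_v_gt0 ?bg_w_gt0. Qed.

Lemma bg_kernel_setT b c y : bg_kernel X b c y setT = 1%E.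
Proof.
rewrite /bg_kernel /walk_kernel ge0_integral_distribution/=; last 2 first.
- by apply/measurable_EFinP; exact: measurable_density.
- by move=> z; rewrite lee_fin ltW.
under eq_integral do rewrite EFinM.
rewrite ge0_integralZr//; last 3 first.
- apply/measurable_EFinP; apply: (measurableT_comp measurable_bg_v).
  apply: measurable_funB => //; apply: measurable_funB => //.
  by apply: measurable_funD => //; exact: measurable_funPT.
- by move=> w _; rewrite lee_fin ltW// bg_v_gt0.
- by rewrite lee_fin invr_ge0 ltW// bg_w_gt0.
rewrite (_ : (\int[P]_w _)%E = (bg_w X (y - b - c))%:E).
  by rewrite -EFinM divff// gt_eqF// bg_w_gt0.
rewrite bg_w_integral; apply: eq_integral => w _; congr (bg_v _ _)%:E => /=.
by rewrite -!addrA; congr (_ + _); rewrite addrC -addrA.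
Qed.

Lemma bg_kernel_dominates b c y A :
  measurable A -> bg_kernel X b c y A = 0%E -> walk_kernel X y A = 0%E.
Proof.
by move=> mA; apply: pos_integral0 => // ; exact: measurable_density.
Qed.

End kernel_properties.

Section paths.
Variable R : realType.

Definition coordinate_events (k : nat) : set (set (nat -> R)) :=
  preimage_set_system setT (fun s : nat -> R => s k) measurable.

(* R^nat with the product sigma-algebra. *)
Definition path_space := g_sigma_algebraType (\bigcup_k coordinate_events k).

Definition natural_filtration (n : nat) : set (set path_space) :=
  <<s \bigcup_(k in `I_n.+1) coordinate_events k >>.

(* [inf {n | s n > b}], equal to [+oo] when the level [b] is never crossed. *)
Definition hitting_time (b : R) (s : path_space) : \bar R :=
  ereal_inf [set n%:R%:E | n in [set n | b < s n]].

Definition stopped_events (b : R) : set (set path_space) :=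
  [set B | measurable B /\
     forall n : nat, natural_filtration n
       (B `&` [set s | (hitting_time b s <= n%:R%:E)%E])].

(* Law of a Markov chain: [Q (S_0 = x0) = 1] and
   [Q (S_{n+1} \in B | F_n) = K (S_n) B], the conditional probability being
   tested against every event of [F_n]. By induction on [n] this determines all
   finite-dimensional laws, hence [Q]. *)
Definition chain_law (K : R -> set R -> \bar R) (x0 : R)
    (Q : probability path_space R) : Prop :=
  Q [set s : path_space | s 0%N = x0] = 1%E /\
  forall (n : nat) (H : set path_space) (B : set R),
    natural_filtration n H -> measurable B ->
    Q (H `&` [set s : path_space | B (s n.+1)]) =
    (\int[Q]_(s in H) K (s n) B)%E.

(* [P] is the law of the walk and [Q] that of the proposal, both on paths. The
   standing requirement that the transition kernel of [P] be dominated by that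
   of [Q] is not part of this definition: see [bg_kernel_dominates]. *)
Definition direct_proposal (b : R) (P Q : set path_space -> \bar R) : Prop :=
  (forall B, stopped_events b B -> B `<=` [set s | hitting_time b s < +oo]%E ->
     (P B <= Q B)%E) /\
  (exists B, [/\ stopped_events b B,
     B `<=` [set s | hitting_time b s < +oo]%E & (P B < Q B)%E]).

End paths.

Definition walk_path {R : realType} {d : measure_display}
    {T : measurableType d} {P : probability T R} (Xs : nat -> {RV P >-> R})
    (w : T) : path_space R :=
  fun n => \sum_(i < n) Xs i w.

Definition walk_law {R : realType} {d : measure_display}
    {T : measurableType d} {P : probability T R} (Xs : nat -> {RV P >-> R})
    : set (path_space R) -> \bar R :=
  pushforward P (walk_path Xs).

(* Main.v *)
(* Let F be the right tail of X, m = |E X|, and let a be such that the integral of F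
   over [a, +oo[ is m. Tonelli's theorem gives, for t >= a,
     m v(-t) = \int_t^oo F    and    m w(-t) = \int_a^oo F(u) F(t - u) du,
   so that, with N(s) = P(X <= -s) and m = \int_0^oo N - \int_0^oo F,
     m (w - v)(-t) = \sum_(x in {a, 0}) (\int_x^(t/2) F(u) F(t - u) du
                                          - F(t) \int_x^oo F)
                     + \int_0^oo (F(t) - F(t + s)) N(s) ds.
   After division by t F(t)^2 the last term vanishes in the limit, by (A2) and the
   bound t f(t) = O(F(t)) on the density, while each of the two brackets converges
   to the continuation of \int_0^(1/2) (x (1 - x))^(-alpha) dx, which has the sign
   of alpha - 3/2.

   On the events of the first n steps the proposal has the density
     \prod_(i < n) v(S_(i+1) - b - c) / w(S_i - b - c)
   with respect to the walk. If v >= w on ]-oo, -c], it telescopes to at least 1 at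
   the first passage above b. If v < w near -oo, a path which first descends, then
   stays for a long time in a bounded interval on which v / w is bounded away from
   1, and finally jumps over b, has density at most 1/2. *)

Require Import Defs.
From HB Require Import structures.
From mathcomp Require Import all_boot all_order all_algebra finmap.
From mathcomp Require Import all_classical all_reals all_analysis.
From mathcomp Require Import measurable_realfun ring lra.

Set Implicit Arguments.
Unset Strict Implicit.
Unset Printing Implicit Defensive.

Import Order.TTheory GRing.Theory Num.Theory.
Import numFieldNormedType.Exports.

Local Open Scope classical_set_scope.
Local Open Scope ring_scope.

(** * Integrals over intervals *)

(** The limit of a bracket cannot be taken under the integral sign, since x^(-alpha) is not
    integrable at 0. Both integrals are therefore cut at [t * e], and that of F also at [t * N].
    Between the cuts regular variation applies, with monotonicity of F as domination, and the
    divergent term e^(1 - alpha) / (alpha - 1), common to both limits, cancels. Below [t * e] what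
    matters is F (t - u) - F t, at most C u F(t) / t for u > 0 by the density bound; integrated
    against F it costs a multiple of e^(2 - alpha) t F(t)^2. This is where alpha < 2 enters; it also
    makes t^2 F(t) tend to infinity, so that fixed constants are absorbed. The last term in the
    decomposition of w - v is nonnegative: it has the favourable sign for alpha > 3/2, and (A2)
    serves to make it negligible against the negative brackets when alpha < 3/2. On a bounded
    interval far to the left, the positive lower bound for w - v gives a ratio v / w uniformly below
    1, whence geometric decay of the density during a sojourn. *)

Section affine_change.
Variable R : realType.
Notation mu := (@lebesgue_measure R).

Let affine (c e : R) : measurableTypeR R -> measurableTypeR R :=
  fun x => c * x + e.

Let measurable_affine c e : measurable_fun setT (affine c e).
Proof. by apply: measurable_funD => //; exact: measurable_funM. Qed.

Lemma lebesgue_measure_affine c e (A : set R) : c != 0 -> measurable A ->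
  (`|c|%:E * mu ((fun x : R => (c * x + e)%R) @^-1` A) = mu A)%E.
Proof.
move=> c0 mA.
have nc0 : 0 <= `|c| by [].


pose nu0 : {measure set (measurableTypeR R) -> \bar R} :=
  mscale (NngNum nc0) (pushforward mu (affine c e)).
pose nu := nu0 (measurable_affine c e).
have := @lebesgue_measure_unique R nu; rewrite /nu/nu0/= /mscale/= => h.
apply/esym/h => // X [[a b]] _ <-.
rewrite /pushforward/= lebesgue_measure_itv/=.
have [cp|cn|c00] := ltgtP c 0; last by rewrite c00 eqxx in c0.
- have -> : affine c e @^-1` `]a, b] = `[(b - e) / c, (a - e) / c[%classic.
    apply/seteqP; split=> x /=; rewrite !in_itv/= /affine;
    by rewrite ler_ndivrMr// ltr_ndivlMr// lerBrDr ltrBlDr mulrC andbC.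
  rewrite lebesgue_measure_itv/= !lte_fin ltr_ndivrMr// divfK ?lt_eqF//.
  rewrite ltrD2r; case: ifPn => _; last by rewrite mule0.
  rewrite -EFinB -EFinM ltr0_norm//; congr EFin; field.
  by rewrite lt_eqF.
- have -> : affine c e @^-1` `]a, b] = `](a - e) / c, (b - e) / c]%classic.
    apply/seteqP; split=> x /=; rewrite !in_itv/= /affine;
    by rewrite ler_pdivlMr// ltr_pdivrMr// lerBrDr ltrBlDr mulrC.
  rewrite lebesgue_measure_itv/= !lte_fin ltr_pdivrMr// divfK ?gt_eqF//.
  rewrite ltrD2r; case: ifPn => _; last by rewrite mule0.
  rewrite -EFinB -EFinM gtr0_norm//; congr EFin; field.
  by rewrite gt_eqF.
Qed.

Lemma ge0_integral_affine c e (A : set R) (f : R -> R) :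
  c != 0 -> measurable A -> measurable_fun setT f -> (forall x, 0 <= f x) ->
  (`|c|%:E * \int[mu]_(x in (fun x : R => (c * x + e)%R) @^-1` A)
     (f (c * x + e)%R)%:E = \int[mu]_(x in A) (f x)%:E)%E.
Proof.
move=> c0 mA mf f0.
have nc0 : 0 <= `|c| by [].


pose nu0 : {measure set (measurableTypeR R) -> \bar R} :=
  mscale (NngNum nc0) (pushforward mu (affine c e)).
pose nu := nu0 (measurable_affine c e).
transitivity (\int[nu]_(x in A) (f x)%:E)%E.
  rewrite /nu/nu0 ge0_integral_mscale//=; last 2 first.
  - by apply/measurable_EFinP; exact: measurable_funTS.
  - by move=> x _; rewrite lee_fin.
  congr (_ * _)%E; apply/esym.
  rewrite (ge0_integral_pushforward (measurable_affine c e))//=.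
    by apply/measurable_EFinP; exact: measurable_funTS.
  by move=> x _; rewrite lee_fin.
apply: eq_measure_integral => // B mB _.
rewrite /nu/nu0/= /mscale/=; exact: lebesgue_measure_affine.
Qed.

End affine_change.

Section interval_integrals.
Variable R : realType.
Notation mu := (@lebesgue_measure R).
Implicit Types (f g : R -> R) (a b c : R).

Definition rint f a b : R := \int[mu]_(x in `[a, b]) f x.

(** An infinite integral has the value 0 here ([fine] of [+oo]), hence the integrability premises
    when half-line integrals are split or compared. *)
Definition tint f a : R := \int[mu]_(x in `[a, +oo[) f x.

(** Enough for integrability over compact intervals, and stable under products, reflections and
    affine changes of variable; monotone tails have it with no continuity. *)
Definition locally_bounded f : Prop :=
  measurable_fun setT f /\
  forall a b, exists M, forall x, a <= x <= b -> `|f x| <= M.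

Lemma locally_bounded_cst c : locally_bounded (fun=> c).
Proof. by split=> // a b; exists `|c|. Qed.

Lemma locally_boundedD f g : locally_bounded f -> locally_bounded g ->
  locally_bounded (fun x => f x + g x).
Proof.
move=> [mf bf] [mg bg]; split; first exact: measurable_funD.
move=> a b; have [M fM] := bf a b; have [N gN] := bg a b.
exists (M + N) => x xab.
by rewrite (le_trans (ler_normD _ _))// lerD ?fM ?gN.
Qed.

Lemma locally_boundedM f g : locally_bounded f -> locally_bounded g ->
  locally_bounded (fun x => f x * g x).
Proof.
move=> [mf bf] [mg bg]; split; first exact: measurable_funM.
move=> a b; have [M fM] := bf a b; have [N gN] := bg a b.
exists (M * N) => x xab.
by rewrite normrM ler_pM ?fM ?gN.
Qed.

Lemma locally_bounded_nonincreasing f : nonincreasing_fun f -> locally_bounded f.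
Proof.
move=> nf; split; first exact: nonincreasing_measurable.
move=> a b; exists (`|f a| + `|f b|) => x /andP[ax xb].
rewrite ler_norml; apply/andP; split.
  apply: le_trans (nf _ _ xb).
  by rewrite opprD -[leRHS]add0r lerD ?oppr_le0// lerNl -normrN ler_norm.
by apply: le_trans (nf _ _ ax) _; rewrite -[leLHS]addr0 lerD ?ler_norm.
Qed.

Lemma locally_bounded_positive_part : locally_bounded (fun x => Num.max x 0).
Proof.
rewrite (_ : (fun x => _) = (fun x : R => (-1) * - Num.max x 0)).
  apply: locally_boundedM; first exact: locally_bounded_cst.
  apply: locally_bounded_nonincreasing => x y xy.
  by rewrite lerN2 ge_max !le_max xy lexx !orbT.
by apply/funext => x; rewrite mulN1r opprK.
Qed.

Lemma locally_bounded_affine f c e : locally_bounded f ->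
  locally_bounded (fun x => f (c * x + e)).
Proof.
move=> [mf bf]; split.
  by apply: (measurableT_comp mf); apply: measurable_funD => //;
    exact: measurable_funM.
move=> a b.
have [M fM] := bf (Num.min (c * a) (c * b) + e) (Num.max (c * a) (c * b) + e).
exists M => x /andP[ax xb]; apply: fM.
rewrite !lerD2r ge_min le_max.
have [c0|c0] := leP 0 c; first by apply/andP; split;
  apply/orP; [left|right]; exact: ler_wpM2l.
by apply/andP; split; apply/orP; [right|left]; exact: ler_wnM2l (ltW c0) _ _ _.
Qed.

Lemma locally_bounded_integrable f a b : locally_bounded f ->
  mu.-integrable `[a, b] (EFin \o f).
Proof.
move=> [mf bf]; have [M fM] := bf a b.
apply/integrableP; split; first by apply/measurable_EFinP; exact: measurable_funTS.
apply: (@le_lt_trans _ _ (`|M|%:E * mu `[a, b])%E).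
  apply: integral_le_bound => //.
    by apply/measurable_EFinP; exact: measurable_funTS.
  apply: aeW => x /=; rewrite in_itv/= => /fM xM.
  by rewrite lee_fin (le_trans xM)// ler_norm.
rewrite lebesgue_measure_itv/=; case: ifPn => _; last by rewrite mule0.
by rewrite -EFinB -EFinM ltry.
Qed.
Hint Resolve locally_bounded_integrable : core.

Lemma rint_ge0 f a b : (forall x, a <= x <= b -> 0 <= f x) -> 0 <= rint f a b.
Proof. by move=> f0; apply: Rintegral_ge0 => x /=; rewrite in_itv/=; exact: f0. Qed.

Lemma le_rint f g a b : locally_bounded f -> locally_bounded g ->
  (forall x, a <= x <= b -> f x <= g x) -> rint f a b <= rint g a b.
Proof.
by move=> bf bg fg; apply: le_Rintegral; auto => x /=; rewrite in_itv/=; exact: fg.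
Qed.

Lemma eq_rint f g a b :
  (forall x, a <= x <= b -> f x = g x) -> rint f a b = rint g a b.
Proof. by move=> fg; apply: eq_Rintegral => x; rewrite inE/= in_itv/=; exact: fg. Qed.

Lemma rint_cst c a b : a <= b -> rint (fun=> c) a b = c * (b - a).
Proof.
move=> ab; rewrite /rint Rintegral_cst//= lebesgue_measure_itv/= lte_fin.
by move: ab; rewrite le_eqVlt => /predU1P[->|->//]; rewrite ltxx subrr.
Qed.

Lemma rintD f g a b : locally_bounded f -> locally_bounded g ->
  rint (fun x => f x + g x) a b = rint f a b + rint g a b.
Proof. by move=> bf bg; rewrite /rint RintegralD; auto. Qed.

Lemma rintZ c f a b : locally_bounded f ->
  rint (fun x => c * f x) a b = c * rint f a b.
Proof. by move=> bf; rewrite /rint RintegralZl; auto. Qed.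

Lemma rint_split f a b c : locally_bounded f -> a <= c <= b ->
  rint f a b = rint f a c + rint f c b.
Proof.
move=> bf /andP[ac cb]; apply/eqP; rewrite -subr_eq0 opprD addrA subr_eq0.
rewrite /rint (@Rintegral_itvB _ _ _ _ c)//; auto.
rewrite Rintegral_itv_obnd_cbnd//.
apply: integrableS (locally_bounded_integrable c b bf) => //.
by apply: subset_itvr; rewrite bnd_simp.
Qed.

Lemma rint_affine f a b c e : locally_bounded f -> (forall x, 0 <= f x) ->
  0 < c -> c * rint (fun x => f (c * x + e)) a b = rint f (c * a + e) (c * b + e).
Proof.
move=> bf f0 c0; have [mf _] := bf.
have c_neq0 : c != 0 by rewrite gt_eqF.
rewrite /rint /Rintegral -(ge0_integral_affine e c_neq0 (measurable_itv _) mf f0).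
rewrite (_ : (fun x : R => _) @^-1` _ = `[a, b]%classic).
  rewrite fineM// ?gtr0_norm//.
  apply: integrable_fin_num => //.
  exact/locally_bounded_integrable/locally_bounded_affine.
by apply/seteqP; split=> x /=; rewrite !in_itv/= !lerD2r !ler_pM2l.
Qed.

Lemma rint_reflect f a b t : locally_bounded f -> (forall x, 0 <= f x) ->
  rint (fun x => f (t - x)) a b = rint f (t - b) (t - a).
Proof.
move=> bf f0; have [mf _] := bf.
have N1_neq0 : (-1 : R) != 0 by rewrite oppr_eq0 oner_eq0.
rewrite [RHS]/rint /Rintegral -(ge0_integral_affine t N1_neq0 (measurable_itv _) mf f0).
rewrite (_ : (fun x : R => _) @^-1` _ = `[a, b]%classic).
  rewrite normrN normr1 mul1e; congr fine; apply: eq_integral => x _.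
  by rewrite mulN1r addrC.
by apply/seteqP; split=> x /=; rewrite !in_itv/= mulN1r andbC;
 move=> /andP[? ?]; apply/andP; split; lra.
Qed.

Lemma tint_shift f a t : measurable_fun setT f -> (forall x, 0 <= f x) ->
  tint (fun x => f (x - t)) (a + t) = tint f a.
Proof.
move=> mf f0; rewrite /tint /Rintegral.
rewrite -[in RHS](ge0_integral_affine (- t) (oner_neq0 R) (measurable_itv _) mf f0).
rewrite normr1 mul1e (_ : (fun x : R => _) @^-1` _ = `[a + t, +oo[%classic).
  by congr fine; apply: eq_integral => x _; rewrite mul1r.
by apply/seteqP; split=> x /=; rewrite !in_itv/= !andbT mul1r lerBrDr.
Qed.

Lemma tint_ge0 f a : (forall x, a <= x -> 0 <= f x) -> 0 <= tint f a.
Proof. by move=> f0; apply: Rintegral_ge0 => x /=; rewrite in_itv/= andbT; exact: f0. Qed.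

Lemma tint_split f a b : mu.-integrable `[a, +oo[ (EFin \o f) -> a <= b ->
  tint f a = rint f a b + tint f b.
Proof.
move=> fi ab; apply/eqP; rewrite -subr_eq0 opprD addrA subr_eq0.
rewrite /tint /rint Rintegral_itvB// Rintegral_itv_obnd_cbnd//.
by apply: integrableS fi => //; apply: subset_itvr; rewrite bnd_simp.
Qed.

Lemma integrable_tail f a b : mu.-integrable `[a, +oo[ (EFin \o f) -> a <= b ->
  mu.-integrable `[b, +oo[ (EFin \o f).
Proof.
by move=> fi ab; apply: integrableS fi => //; apply: subset_itvr; rewrite bnd_simp.
Qed.

(** Monotone convergence along the intervals [[a, a + i]]: a bound uniform in the right end passes
    to the half-line. *)
Lemma tint_le_bound f a A : measurable_fun setT f ->
  (forall x, a <= x -> 0 <= f x) ->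
  mu.-integrable `[a, +oo[ (EFin \o f) ->
  (forall b, a <= b -> rint f a b <= A) -> tint f a <= A.
Proof.
move=> mf f0 fi fA.
pose F i : set R := `[a, a + i%:R]%classic.
have FE : \bigcup_i F i = `[a, +oo[%classic.
  apply/seteqP; split=> x /=.
    by move=> [i _]; rewrite /F/= !in_itv/= => /andP[->].
  rewrite in_itv/= andbT => ax; have := archi_boundP (_ : 0 <= x - a).
  rewrite subr_ge0 => /(_ ax) xa; exists (Num.bound (x - a)) => //.
  by rewrite /F/= in_itv/= ax/= -lerBlDl ltW.
have Fi i : (\int[mu]_(x in F i) (f x)%:E = (rint f a (a + i%:R))%:E)%E.
  rewrite /rint /Rintegral fineK//; apply: integrable_fin_num => //.
  by apply: integrableS fi => // x; rewrite /F/= !in_itv/= => /andP[->].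
have : (\int[mu]_(x in F i) (f x)%:E @[i --> \oo] -->
        \int[mu]_(x in \bigcup_i F i) (f x)%:E)%E.
  apply: ge0_nondecreasing_set_cvg_integral => //.
  - move=> i j ij; rewrite subsetEset /F => x /=.
    rewrite !in_itv/= => /andP[->]/= /le_trans; apply.
    by rewrite lerD2l ler_nat.
  - by move=> i; exact: measurable_itv.
  - by move=> *; apply/measurable_EFinP; apply: measurable_funTS.
  - by move=> i x; rewrite /F/= in_itv/= => /andP[ax _]; rewrite lee_fin f0.
rewrite FE => cF.
rewrite -lee_fin /tint /Rintegral fineK; last exact: integrable_fin_num.
rewrite -(cvg_lim _ cF)//; apply: lime_le; first by apply/cvg_ex; eexists; exact: cF.
apply: nearW => i; rewrite Fi lee_fin fA//.
by rewrite lerDl ler0n.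
Qed.

End interval_integrals.

Section bounded_convergence.
Variable R : realType.
Implicit Types (f g : R -> R) (a b c : R).

Lemma locally_bounded_scale f c : locally_bounded f ->
  locally_bounded (fun x => f (c * x)).
Proof.
move=> /(locally_bounded_affine c 0); congr locally_bounded.
by apply/funext => x; rewrite addr0.
Qed.

Lemma locally_bounded_reflect f c : locally_bounded f ->
  locally_bounded (fun x => f (c - x)).
Proof.
move=> /(locally_bounded_affine (-1) c); congr locally_bounded.
by apply/funext => x; rewrite mulN1r addrC.
Qed.

Lemma rint_scale f a b c : locally_bounded f -> (forall x, 0 <= f x) ->
  0 < c -> rint f (c * a) (c * b) = c * rint (fun x => f (c * x)) a b.
Proof.
move=> bf f0 c0; have := rint_affine a b 0 bf f0 c0.
rewrite !addr0 => <-; congr (_ * _).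
by apply: eq_rint => x _; rewrite addr0.
Qed.

(** Dominated convergence with a constant bound that need only hold from rank [N] on, which is what
    limits at infinity provide; shifting the sequence by [N] discards the earlier terms. *)
Lemma rint_bounded_cvg (g : nat -> R -> R) (G : R -> R) a b M N :
  (forall n, locally_bounded (g n)) -> measurable_fun `[a, b] G ->
  (forall n x, (N <= n)%N -> a <= x <= b -> 0 <= g n x <= M) ->
  (forall x, a <= x <= b -> g n x @[n --> \oo] --> G x) ->
  rint (g n) a b @[n --> \oo] --> rint G a b.
Proof.
move=> bg mG gM gG.
rewrite -(cvg_shiftn N).
have [//|n|||||i _ c] := @dominated_convergence _ _ _ lebesgue_measure `[a, b] _
    (fun n x => (g (n + N)%N x)%:E) (EFin \o G) (fun=> M%:E).
- apply/measurable_EFinP; apply: measurable_funTS.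
  by have [] := bg (n + N)%N.
- exact/measurable_EFinP.
- apply: aeW => x /=; rewrite in_itv/= => /gG gx.
  by apply: cvg_EFin; [exact: nearW|move: gx; rewrite -(cvg_shiftn N)].
- exact: locally_bounded_integrable (locally_bounded_cst M).
- apply: aeW => x n /=; rewrite in_itv/= => xab.
  have /andP[g0 gM'] := gM (n + N)%N x (leq_addl _ _) xab.
  by rewrite lee_fin ger0_norm.
apply: fine_cvg; rewrite fineK; first exact: c.
exact: integrable_fin_num i.
Qed.

End bounded_convergence.

(** * Scaled integrals of a regularly varying tail *)

Section regular_variation.
Variables (R : realType) (F : R -> R) (alpha : R).
Hypothesis nF : nonincreasing_fun F.
Hypothesis F0 : forall x, 0 < F x.
Hypothesis rvF : regularly_varying F alpha.

Let bF : locally_bounded F := locally_bounded_nonincreasing nF.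
Let F0' x : 0 <= F x := ltW (F0 x).

Lemma regularly_varying_cvg u : 0 < u ->
  F (u * t) / F t @[t --> +oo] --> u `^ (- alpha).
Proof.
move=> u0; have := rvF u0; rewrite /asymp_equiv => h.
have ua : u `^ (- alpha) != 0 by rewrite gt_eqF// powR_gt0.
rewrite -[X in _ --> X]mul1r.
rewrite (_ : (fun t => _) =
    (fun t => F (u * t) / (u `^ (- alpha) * F t) * u `^ (- alpha))).
  by apply: cvgM; [exact: h|exact: cvg_cst].
by apply/funext => t; field; rewrite ua gt_eqF.
Qed.

Lemma regularly_varying_lt u c : 0 < u -> u `^ (- alpha) < c ->
  \forall t \near +oo, F (u * t) < c * F t.
Proof.
move=> u0 uc; near=> t; rewrite -ltr_pdivrMr//.
near: t; exact: cvgr_lt (regularly_varying_cvg u0) _ uc.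
Unshelve. all: by end_near. Qed.

Let powR_measurable (a b : R) (h : R -> R) : measurable_fun setT h ->
  measurable_fun `[a, b] (fun x : R => h x `^ (- alpha)).
Proof.
move=> mh; apply: measurable_funTS; exact: (measurableT_comp (measurable_powR _)).
Qed.

(** Along a sequence u_n going to infinity the integrands F(u_n x) / F(u_n) converge pointwise and,
    F being nonincreasing, are dominated by their value at [p]. Monotonicity thus replaces locally
    uniform convergence. *)
Lemma rint_scaled_cvg p q : 0 < p -> p <= q ->
  rint F (t * p) (t * q) / (t * F t) @[t --> +oo]
    --> rint (fun x => x `^ (- alpha)) p q.
Proof.
move=> p0 pq; apply/cvg_pinftyP => u uoo.
have uF x : 0 < x -> F (u n * x) / F (u n) @[n --> \oo] --> x `^ (- alpha).
  move=> /regularly_varying_cvg /cvg_pinftyP/(_ _ uoo).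
  by under eq_fun do rewrite [x * _]mulrC.
have [N _ NP] : \forall n \near \oo,
    0 < u n /\ F (u n * p) / F (u n) < p `^ (- alpha) + 1.
  near=> n; split; first by near: n; move/cvgryPgt : uoo; exact.
  near: n; apply: cvgr_lt (uF p p0) _ _; lra.
have := @rint_bounded_cvg R (fun n x => (F (u n))^-1 * F (u n * x))
  (fun x => x `^ (- alpha)) p q (p `^ (- alpha) + 1) N.
move=> h; have {}h : rint (fun x => (F (u n))^-1 * F (u n * x)) p q @[n --> \oo]
    --> rint (fun x => x `^ (- alpha)) p q.
  apply: h.
  - move=> n; apply: locally_boundedM; first exact: locally_bounded_cst.
    exact: locally_bounded_scale.
  - exact: powR_measurable.
  - move=> n x /NP[un0 un] /andP[px xq].
    rewrite mulr_ge0 ?invr_ge0//=; apply: le_trans (ltW un).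
    by rewrite mulrC ler_pM2r ?invr_gt0// nF// ler_pM2l.
  - move=> x /andP[px _]; under eq_fun do rewrite [_^-1 * _]mulrC.
    by apply: uF; apply: lt_le_trans px.
apply: cvg_trans h; apply: near_eq_cvg; exists N => // n /NP[un0 _].
rewrite rint_scale// rintZ; last exact: locally_bounded_scale.
by rewrite invfM mulrACA divff ?gt_eqF// mul1r mulrC.
Unshelve. all: by end_near. Qed.

(** The same domination, with one factor at each end: F(u_n x) is largest at [p] and F(u_n (1 - x))
    at [q]. Hence the range bounded away from 0 and 1. *)
Lemma rint_convolution_scaled_cvg p q : 0 < p -> p <= q -> q < 1 ->
  rint (fun u => F u * F (t - u)) (t * p) (t * q) / (t * F t ^+ 2) @[t --> +oo]
    --> rint (fun x => (x * (1 - x)) `^ (- alpha)) p q.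
Proof.
move=> p0 pq q1; apply/cvg_pinftyP => u uoo.
have uF x : 0 < x -> F (u n * x) / F (u n) @[n --> \oo] --> x `^ (- alpha).
  move=> /regularly_varying_cvg /cvg_pinftyP/(_ _ uoo).
  by under eq_fun do rewrite [x * _]mulrC.
have q10 : 0 < 1 - q by rewrite subr_gt0.
have [N _ NP] : \forall n \near \oo,
    [/\ 0 < u n, F (u n * p) / F (u n) < p `^ (- alpha) + 1 &
    F (u n * (1 - q)) / F (u n) < (1 - q) `^ (- alpha) + 1].
  near=> n; split; first by near: n; move/cvgryPgt : uoo; exact.
    near: n; apply: cvgr_lt (uF p p0) _ _; lra.
  near: n; apply: cvgr_lt (uF _ q10) _ _; lra.
pose g n x := ((F (u n))^-1 * F (u n * x)) * ((F (u n))^-1 * F (u n - u n * x)).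
have bg n : locally_bounded (g n).
  apply: locally_boundedM; (apply: locally_boundedM;
    first exact: locally_bounded_cst); first exact: locally_bounded_scale.
  by apply: (locally_bounded_scale (f := fun y => F (u n - y)));
    exact: locally_bounded_reflect.
have h : rint (g n) p q @[n --> \oo]
    --> rint (fun x => (x * (1 - x)) `^ (- alpha)) p q.
  apply: (@rint_bounded_cvg R _ _ p q
    ((p `^ (- alpha) + 1) * ((1 - q) `^ (- alpha) + 1)) N) => //.
  - by apply: powR_measurable; apply: measurable_funM => //;
      exact: measurable_funB.
  - move=> n x /NP[un0 un un'] /andP[px xq].
    rewrite !mulr_ge0 ?invr_ge0//=; apply: ler_pM; rewrite ?mulr_ge0 ?invr_ge0//.
      apply: le_trans (ltW un).
      by rewrite mulrC ler_pM2r ?invr_gt0// nF// ler_pM2l.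
    apply: le_trans (ltW un').
    rewrite mulrC ler_pM2r ?invr_gt0// nF// mulrBr mulr1 lerD2l lerN2.
    by rewrite ler_pM2l.
  - move=> x /andP[px xq].
    have x0 : 0 < x by apply: lt_le_trans px.
    have x1 : 0 < 1 - x by rewrite subr_gt0 (le_lt_trans xq).
    rewrite powRM ?ltW//; apply: cvgM; under eq_fun do rewrite [_^-1 * _]mulrC.
      exact: uF.
    by under eq_fun do rewrite -[X in X - _]mulr1 -mulrBr; exact: uF.
apply: cvg_trans h; apply: near_eq_cvg; exists N => // n /NP[un0 _ _].
rewrite rint_scale//; last 2 first.
- apply: locally_boundedM => //; exact: locally_bounded_reflect.
- by move=> x; rewrite mulr_ge0.
rewrite (_ : rint (g n) p q =
  rint (fun x => ((F (u n))^-1 ^+ 2) * (F (u n * x) * F (u n - u n * x))) p q).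
  rewrite rintZ.
    have Fn : F (u n) != 0 by rewrite gt_eqF.
    have un0' : u n != 0 by rewrite gt_eqF.
    by field; rewrite un0' Fn.
  apply: (locally_bounded_scale (f := fun y => F y * F (u n - y))).
  apply: locally_boundedM => //; exact: locally_bounded_reflect.
by apply: eq_rint => x _; rewrite /g; ring.
Unshelve. all: by end_near. Qed.

End regular_variation.

(** * Power integrals and truncated Beta integrals *)

Section power_integrals.
Variable R : realType.
Implicit Types (f F : R -> R) (a b x : R).

Lemma rint_FTC f F a b : a < b ->
  (forall x, a <= x <= b -> is_derive x 1 F (f x)) ->
  (forall x, a <= x <= b -> {for x, continuous f}) ->
  rint f a b = F b - F a.
Proof.
move=> ab dF cf.
have cF x : a <= x <= b -> {for x, continuous F}.
  move=> /dF dFx; apply/differentiable_continuous/derivable1_diffP.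
  exact: ex_derive.
rewrite /rint /Rintegral (@continuous_FTC2 _ f F)//.
- by apply: continuous_in_subspaceT => x; rewrite inE/= in_itv/=; exact: cf.
- split.
  + by move=> x; rewrite in_itv/= => /andP[/ltW ax /ltW xb];
      have := dF x; rewrite ax xb => /(_ isT) d; exact: ex_derive.
  + by apply: cvg_at_right_filter; apply: cF; rewrite lexx ltW.
  + by apply: cvg_at_left_filter; apply: cF; rewrite lexx ltW.
- move=> x; rewrite in_itv/= => /andP[/ltW ax /ltW xb].
  have := dF x; rewrite ax xb => /(_ isT) d.
  by rewrite derive1E derive_val.
Qed.

Lemma rint_powRN (alpha p q : R) : 1 < alpha -> 0 < p -> p < q ->
  rint (fun x => x `^ (- alpha)) p q =
  (p `^ (1 - alpha) - q `^ (1 - alpha)) / (alpha - 1).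
Proof.
move=> a1 p0 pq; have a0 : alpha - 1 != 0 by rewrite subr_eq0 gt_eqF.
have dF x : p <= x <= q -> is_derive x 1
    (fun x => - (alpha - 1)^-1 * x `^ (1 - alpha)) (x `^ (- alpha)).
  move=> /andP[px _]; have x0 : 0 < x by exact: lt_le_trans px.
  have d := is_derive1_powR (1 - alpha) x0.
  apply: is_derive_eq; rewrite /GRing.scale/=.
  rewrite (_ : 1 - alpha - 1 = - alpha); last by lra.
  by field; exact: a0.
have cf x : p <= x <= q -> {for x, continuous (fun x : R => x `^ (- alpha))}.
  move=> /andP[px _]; have x0 : 0 < x by exact: lt_le_trans px.
  apply/differentiable_continuous/derivable1_diffP.
  by apply: derivable_powR; rewrite in_itv/= x0.
by rewrite (rint_FTC pq dF cf); field; exact: a0.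
Qed.

Lemma is_derive_beta r x : 0 < x < 1 ->
  is_derive x 1 (fun x : R => (x * (1 - x)) `^ r)
    ((1 - 2 * x) * (r * (x * (1 - x)) `^ (r - 1))).
Proof.
move=> /andP[x0 x1].
have p0 : 0 < x * (1 - x) by rewrite mulr_gt0// subr_gt0.
have d : is_derive x 1 (fun x : R => x * (1 - x)) (1 - 2 * x).
  apply: is_derive_eq; rewrite /GRing.scale/=; ring.
have := @is_derive1_comp _ (@powR R ^~ r) (fun x : R => x * (1 - x)) x _ _
  (is_derive1_powR r p0) d.
by rewrite mulrC.
Qed.

Lemma continuous_beta r x : 0 < x < 1 ->
  {for x, continuous (fun x : R => (x * (1 - x)) `^ r)}.
Proof.
move=> x01; apply/differentiable_continuous/derivable1_diffP.
by have [] := is_derive_beta r x01.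
Qed.

(* Obtained from the antiderivative [- (1 - 2 x) (x (1 - x)) `^ (1 - alpha)]; this
   continues the Beta integral beyond its range of convergence and makes the
   factor [4 alpha - 6], hence the threshold [3 / 2], appear. *)
Lemma rint_beta (alpha e : R) : 1 < alpha -> 0 < e < 1 / 2 ->
  rint (fun x => (x * (1 - x)) `^ (- alpha)) e (1 / 2) =
  ((1 - 2 * e) * (e * (1 - e)) `^ (1 - alpha) +
   (4 * alpha - 6) * rint (fun x => (x * (1 - x)) `^ (1 - alpha)) e (1 / 2))
  / (alpha - 1).
Proof.
move=> a1 /andP[e0 e2]; have a0 : alpha - 1 != 0 by rewrite subr_eq0 gt_eqF.
have cb r x : e <= x <= 1 / 2 ->
    {for x, continuous (fun x : R => (x * (1 - x)) `^ r)}.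
  move=> /andP[ex x2]; apply: continuous_beta.
  by rewrite (lt_le_trans e0 ex)/= (le_lt_trans x2)//; lra.
have ib r : (@lebesgue_measure R).-integrable `[e, 1 / 2]
    (EFin \o (fun x : R => (x * (1 - x)) `^ r)).
  apply: continuous_compact_integrable; first exact: segment_compact.
  apply: continuous_in_subspaceT => x; rewrite inE/= in_itv/=; exact: cb.
apply: (canRL (mulfK a0)).
have -> : rint (fun x => (x * (1 - x)) `^ (- alpha)) e (1 / 2) * (alpha - 1) =
    rint (fun x => (alpha - 1) * (x * (1 - x)) `^ (- alpha) -
      (4 * alpha - 6) * (x * (1 - x)) `^ (1 - alpha)) e (1 / 2) +
    (4 * alpha - 6) * rint (fun x => (x * (1 - x)) `^ (1 - alpha)) e (1 / 2).
  rewrite /rint RintegralB//.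
  - by rewrite !RintegralZl// subrK mulrC.
  - exact: (integrableZl _ (alpha - 1) (ib (- alpha))).
  - exact: (integrableZl _ (4 * alpha - 6) (ib (1 - alpha))).
congr (_ + _).
have dF x : e <= x <= 1 / 2 -> is_derive x 1
    (fun x => - (1 - 2 * x) * (x * (1 - x)) `^ (1 - alpha))
    ((alpha - 1) * (x * (1 - x)) `^ (- alpha) -
      (4 * alpha - 6) * (x * (1 - x)) `^ (1 - alpha)).
  move=> /andP[ex x2].
  have x0 : 0 < x by exact: lt_le_trans ex.
  have x1 : x < 1 by apply: le_lt_trans x2 _; lra.
  have p0 : 0 < x * (1 - x) by rewrite mulr_gt0// subr_gt0.
  have d := @is_derive_beta (1 - alpha) x.
  rewrite x0 x1 in d; have {}d := d isT.
  (* With p = x (1 - x), the identity (1 - 2x)^2 = 1 - 4p expresses the derivative in p^(-alpha) and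
     p^(1 - alpha) only. *)
  apply: is_derive_eq; rewrite /GRing.scale/=.
  rewrite (_ : 1 - alpha - 1 = - alpha); last by lra.
  rewrite (_ : 1 - alpha = - alpha + 1); last by lra.
  rewrite powRD ?powRr1 ?(ltW p0)//; last by apply/implyP => _; rewrite gt_eqF.
  ring.
have cf x : e <= x <= 1 / 2 -> {for x, continuous (fun x : R =>
    (alpha - 1) * (x * (1 - x)) `^ (- alpha) -
      (4 * alpha - 6) * (x * (1 - x)) `^ (1 - alpha))}.
  move=> xe; apply: continuousB; apply: continuousM; try exact: cst_continuous;
    exact: cb.
(* The factor 1 - 2x kills the boundary term at 1/2; only the one at [e] survives. *)
rewrite (rint_FTC e2 dF cf) (_ : 1 - 2 * (1 / 2) = 0); last by field.
ring.
Qed.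

End power_integrals.

(** * Regularly varying tails *)

Section powers.
Variable R : realType.
Implicit Types (e a x y : R).

Lemma gt1_ltr_powR a x y : 1 < a -> x < y -> a `^ x < a `^ y.
Proof.
move=> a1 xy; rewrite /powR gt_eqF ?(lt_trans _ a1)//.
by rewrite ltr_expR ltr_pM2r// ln_gt0.
Qed.

Lemma powR_invN a x : 0 < a -> a^-1 `^ (- x) = a `^ x.
Proof. by move=> a0; rewrite -powR_inv1 ?ltW// -powRrM mulrNN mul1r. Qed.

(** Supplies the cut-off [e]; the cap 1/4 leaves [[e, 1/2]] a length of at least 1/4. *)
Lemma powR_small r eta : 0 < r -> 0 < eta ->
  exists e, [/\ 0 < e, e <= 1 / 4 :> R & e `^ r <= eta].
Proof.
move=> r0 eta0; exists (Num.min (1 / 4) (eta `^ r^-1)).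
split; [by rewrite lt_min powR_gt0// andbT; lra|by rewrite ge_min lexx|].
have e0 : 0 <= Num.min (1 / 4) (eta `^ r^-1).
  by rewrite le_min powR_ge0 andbT; lra.
have etaE : eta = (eta `^ r^-1) `^ r.
  by rewrite -powRrM mulVf ?gt_eqF// powRr1// ltW.
rewrite [leRHS]etaE; apply: ge0_ler_powR; rewrite ?nnegrE ?powR_ge0 ?(ltW r0)//.
by rewrite ge_min lexx orbT.
Qed.

(** The integrand is at least 1, as 0 < x (1 - x) < 1 carries a negative exponent. This fixes the
    size of the term that decides the sign: (4 alpha - 6) / 4 = alpha - 3/2. *)
Let beta_mass (alpha e : R) : 1 < alpha -> 0 < e -> e <= 1 / 4 ->
  1 / 4 <= rint (fun x => (x * (1 - x)) `^ (1 - alpha)) e (1 / 2).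
Proof.
move=> a1 e0 e4.
have e2 : e <= 1 / 2 by lra.
apply: (@le_trans _ _ (rint (fun=> 1) e (1 / 2))).
  by rewrite rint_cst//; lra.
apply: le_Rintegral => //.
- exact: locally_bounded_integrable (locally_bounded_cst 1).
- apply: continuous_compact_integrable; first exact: segment_compact.
  apply: continuous_in_subspaceT => x; rewrite inE/= in_itv/= => /andP[ex x2].
  by apply: continuous_beta; lra.
- move=> x /=; rewrite in_itv/= => /andP[ex x2].
  have p0 : 0 < x * (1 - x) by rewrite mulr_gt0//; lra.
  rewrite -[leLHS](powRr0 (x * (1 - x))) ger_powR ?p0/= ?subr_le0 ?ltW//.
  by nra.
Qed.

(** In [rint_beta], (1 - e)^(1 - alpha) is at least 1 and the remaining integral at least 1/4. The
    term e^(1 - alpha) / (alpha - 1) is the divergent part cancelled later; the loss 2 e^(2 - alpha)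
    vanishes with [e] because alpha < 2. *)
Lemma rint_beta_ge (alpha e : R) : 3 / 2 < alpha < 2 -> 0 < e -> e <= 1 / 4 ->
  (e `^ (1 - alpha) - 2 * e `^ (2 - alpha) + (alpha - 3 / 2)) / (alpha - 1) <=
  rint (fun x => (x * (1 - x)) `^ (- alpha)) e (1 / 2).
Proof.
move=> /andP[a32 a2] e0 e4.
have e1 : 0 < 1 - e by lra.
have a1 : 1 < alpha by lra.
rewrite rint_beta//; last by rewrite e0; lra.
rewrite ler_pM2r ?invr_gt0 ?subr_gt0//; apply: lerD.
  rewrite powRM ?(ltW e0) ?(ltW e1)// (_ : 2 - alpha = (1 - alpha) + 1); last by ring.
  rewrite [_ `^ (_ + 1)]powRD ?powRr1 ?(ltW e0)//; last first.
    by apply/implyP => _; rewrite gt_eqF.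
  have h : 1 <= (1 - e) `^ (1 - alpha).
    by rewrite -[leLHS](powRr0 (1 - e)) ger_powR ?e1/= ?subr_le0 ?ltW//; lra.
  have p0 : 0 < e `^ (1 - alpha) by exact: powR_gt0.
  rewrite (_ : _ - _ = (1 - 2 * e) * (e `^ (1 - alpha) * 1)); last by ring.
  by rewrite !ler_pM2l//; lra.
have := beta_mass a1 e0 e4; set B := rint _ _ _ => B4.
have : 0 <= (4 * alpha - 6) * (B - 1 / 4) by rewrite mulr_ge0//; lra.
lra.
Qed.

(** Here (1 - e)^(1 - alpha) <= 1 / (1 - e) and (1 - 2e) / (1 - e) <= 1, so the boundary term loses
    nothing. The factor 4 alpha - 6 is now negative, and the lower bound 1/4 on the remaining
    integral again goes the right way. *)
Lemma rint_beta_le (alpha e : R) : 1 < alpha < 3 / 2 -> 0 < e -> e <= 1 / 4 ->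
  rint (fun x => (x * (1 - x)) `^ (- alpha)) e (1 / 2) <=
  (e `^ (1 - alpha) - (3 / 2 - alpha)) / (alpha - 1).
Proof.
move=> /andP[a1 a32] e0 e4.
have e1 : 0 < 1 - e by lra.
rewrite rint_beta//; last by rewrite e0; lra.
rewrite ler_pM2r ?invr_gt0 ?subr_gt0//; apply: lerD.
  rewrite powRM ?(ltW e0) ?(ltW e1)//.
  have h : (1 - e) `^ (1 - alpha) <= (1 - e)^-1.
    by rewrite -powR_inv1 ?(ltW e1)// ger_powR ?e1/=; lra.
  have p0 : 0 < e `^ (1 - alpha) by exact: powR_gt0.
  rewrite mulrCA -[leRHS]mulr1 ler_pM2l//.
  apply: (@le_trans _ _ ((1 - 2 * e) * (1 - e)^-1)).
    by rewrite ler_pM2l//; lra.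
  by rewrite ler_pdivrMr//; lra.
have := beta_mass a1 e0 e4; set B := rint _ _ _ => B4.
have : 0 <= (6 - 4 * alpha) * (B - 1 / 4) by rewrite mulr_ge0//; lra.
lra.
Qed.

(** Halving a point beyond [2 * t1] stays beyond [t1], and finitely many halvings reach
    [[t1, 2 * t1]]. *)
Lemma dyadic_ind (t1 : R) (Pr : R -> Prop) : 0 < t1 ->
  (forall t, t1 <= t <= 2 * t1 -> Pr t) ->
  (forall t, 2 * t1 <= t -> Pr (t / 2) -> Pr t) ->
  forall t, t1 <= t -> Pr t.
Proof.
move=> t10 base step.
have H n t : t1 <= t <= 2 ^+ n * (2 * t1) -> Pr t.
  elim: n t => [|n IH] t /andP[tt1 tn].
    by apply: base; rewrite tt1 -[2 * t1]mul1r -(expr0 2).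
  have [/ltW t2|t2] := ltP (2 * t1) t; last by apply: base; rewrite tt1.
  apply: step => //; apply: IH; move: tn; rewrite exprS.
  by move=> tn; apply/andP; split; lra.
move=> t tt1; have t0 : 0 < t by exact: lt_le_trans tt1.
apply: (H (Num.bound (t / t1))); rewrite tt1/=.
have := archi_boundP (ltW (divr_gt0 t0 t10)); rewrite ltr_pdivrMr// => /ltW.
move/le_trans; apply; rewrite [2 * t1]mulrC mulrA -[leLHS]mulr1.
apply: ler_pM => //; last by lra.
  by rewrite mulr_ge0 ?ler0n ?ltW.
rewrite ler_pM2r// -natrX ler_nat; exact/ltnW/ltn_expl.
Qed.

End powers.

Section tail_convolution.
Variables (R : realType) (F : R -> R) (alpha : R).
Hypothesis nF : nonincreasing_fun F.
Hypothesis F0 : forall x, 0 < F x.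
Hypothesis rvF : regularly_varying F alpha.
Hypothesis alpha12 : 1 < alpha < 2.

Let bF : locally_bounded F := locally_bounded_nonincreasing nF.
Let F0' x : 0 <= F x := ltW (F0 x).
Let a1 : 1 < alpha. Proof. by case/andP: alpha12. Qed.
Let a2 : alpha < 2. Proof. by case/andP: alpha12. Qed.

Let g t := t ^+ 2 * F t.

(** The ratio g (t / 2) / g t tends to 2^alpha / 4, which is below 1 because alpha < 2; [q] is the
    midpoint between this limit and 1. *)
Lemma sqr_tail_halving : exists2 q : R, 0 < q < 1 &
  \forall t \near +oo, g (t / 2) <= q * g t.
Proof.
have h4 : (1 / 2 : R) `^ (- alpha) < 4.
  rewrite mul1r powR_invN// (_ : 4 = 2 `^ 2) ?gt1_ltr_powR ?ltr1n//.
  by rewrite powR_mulrn// expr2 -natrM.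
have p0 : 0 < (1 / 2 : R) `^ (- alpha) by apply: powR_gt0; lra.
set c := (1 / 2 : R) `^ (- alpha) in h4 p0.
have hc : (1 / 2) `^ (- alpha) < (c + 4) / 2 by rewrite /c in h4 p0 *; lra.
exists ((c + 4) / 8); first by apply/andP; split; lra.
near=> t.
have t0 : 0 < t by near: t; exact: nbhs_pinfty_gt.
have : F (1 / 2 * t) < (c + 4) / 2 * F t.
  by near: t; apply: (regularly_varying_lt F0 rvF _ hc); lra.
rewrite mul1r [2^-1 * t]mulrC /g => h.
rewrite (_ : _ * (t ^+ 2 * _) = (t / 2) ^+ 2 * ((c + 4) / 2 * F t)); last by field.
by rewrite ler_pM2l ?ltW// exprn_gt0// divr_gt0.
Unshelve. all: by end_near. Qed.

(* Since [alpha < 2], [t ^+ 2 * F t] grows geometrically along [t, 2 t, 4 t, ...],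
   which absorbs the accumulated increments. *)
Lemma halving_recursion : exists2 K : R, 0 < K &
  forall (M : R -> R) (delta : R), 0 <= delta ->
  (exists t0 : R, forall s t, t0 <= s <= t -> M s <= M t) ->
  (\forall t \near +oo, M t <= M (t / 2) + delta * g (t / 2)) ->
  exists M0, \forall t \near +oo, M t <= delta * K * g t + M0.
Proof.
have [q /andP[q0 q1] [tq [_ hq]]] := sqr_tail_halving.
(* The geometric sum q + q^2 + ..., that is, the solution of (K + 1) q = K, the identity on which
   the recursion closes. *)
exists (q / (1 - q)); first by rewrite divr_gt0// subr_gt0.
move=> M delta d0 [t0 mM] [tM [_ hM]].
pose t1 := Num.max 1 (Num.max t0 (Num.max (tq + 1) (tM + 1))).
have t10 : 0 < t1 by rewrite lt_max ltr01.
have t1P t : t1 <= t -> [/\ 0 < t, t0 <= t, tq < t & tM < t].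
  rewrite !ge_max => /and4P[? ? ? ?]; split=> //; lra.
have gt0 t : 0 <= g t by rewrite mulr_ge0// sqr_ge0.
set K := q / (1 - q).
have K0 : 0 <= K by rewrite divr_ge0 ?subr_ge0// ltW.
have KE : (K + 1) * q = K by rewrite /K; field; lra.
pose M0 := `|M (2 * t1)|.
exists M0; exists t1; split; first exact: num_real.
move=> t /ltW; apply: (@dyadic_ind _ t1 (fun t => M t <= delta * K * g t + M0)) => //.
  move=> {}t /andP[t1t t2]; have [_ t0t _ _] := t1P _ t1t.
  rewrite (le_trans (mM t (2 * t1) _)) ?t0t//.
  by rewrite (le_trans (ler_norm _))// lerDr mulr_ge0// mulr_ge0.
move=> {}t t2 IH; have t1t : t1 <= t by lra.
have [_ t0t qt Mt] := t1P _ t1t.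
apply: (le_trans (hM _ Mt)).
apply: (@le_trans _ _ (delta * ((K + 1) * g (t / 2)) + M0)); first by lra.
rewrite lerD2r -mulrA ler_wpM2l// -[in leRHS]KE -mulrA ler_wpM2l//; last exact: hq.
by rewrite addr_ge0.
Unshelve. all: by end_near. Qed.

(** Iterating the halving inequality [n] times bounds g below by g0 / q^n beyond 2^n t1. This makes
    additive constants negligible against t^2 F(t). *)
Lemma sqr_tail_cvgy B : \forall t \near +oo, B <= g t.
Proof.
have [q /andP[q0 q1] [tq [_ hq]]] := sqr_tail_halving.
pose t1 := Num.max 1 (tq + 1).
have t10 : 0 < t1 by rewrite lt_max ltr01.
have t1P t : t1 <= t -> 0 < t /\ tq < t.
  by rewrite ge_max => /andP[? ?]; split=> //; lra.
pose g0 := t1 ^+ 2 * F (2 * t1).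
have g00 : 0 < g0 by rewrite mulr_gt0// exprn_gt0.
have base t : t1 <= t -> g0 <= g t.
  apply: (@dyadic_ind _ t1 (fun t => g0 <= g t)) => // {}t.
    move=> /andP[t1t t2]; apply: ler_pM => //; rewrite ?sqr_ge0 ?nF//.
    by rewrite lerXn2r ?nnegrE//; lra.
  move=> t2 IH; have t1t : t1 <= t by lra.
  have [_ qt] := t1P _ t1t.
  apply: (le_trans IH); apply: (le_trans (hq _ qt)).
  by rewrite ler_piMl ?(ltW q1)// mulr_ge0 ?sqr_ge0.
have iter n t : 2 ^+ n * t1 <= t -> g0 <= q ^+ n * g t.
  elim: n t => [|n IH] t; first by rewrite !expr0 !mul1r; exact: base.
  rewrite exprS => tn.
  have tn2 : 2 ^+ n * t1 <= t / 2 by lra.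
  apply: (le_trans (IH _ tn2)); rewrite exprSr -mulrA ler_pM2l ?exprn_gt0//.
  suff /t1P[_] : t1 <= t by exact: hq.
  have : 1 <= 2 ^+ n :> R by rewrite exprn_ege1// ler1n.
  by nra.
have [n nB] : exists n, q ^+ n * B <= g0.
  have : q ^+ n * B @[n --> \oo] --> 0 * B.
    apply: cvgM; last exact: cvg_cst.
    by apply: cvg_expr; rewrite gtr0_norm.
  rewrite mul0r => /cvgr_le /(_ _ g00)[n _ /(_ n (leqnn n))].
  by exists n.
exists (2 ^+ n * t1); split; first exact: num_real.
move=> t /ltW /iter h.
by rewrite -(ler_pM2l (exprn_gt0 n q0)) (le_trans nB).
Qed.

End tail_convolution.

(** * Sign of a bracket of the truncated convolution *)

Section tail_convolution_sign.
Variables (R : realType) (F : R -> R) (alpha : R).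
Hypothesis nF : nonincreasing_fun F.
Hypothesis F0 : forall x, 0 < F x.
Hypothesis rvF : regularly_varying F alpha.
Hypothesis alpha12 : 1 < alpha < 2.
Hypothesis iF : forall a,
  (@lebesgue_measure R).-integrable `[a, +oo[ (EFin \o F).
(** What is retained of the density: at scale [t] the tail decreases at a rate of at most C F(t) /
    t, as [density_tail_lipschitz] provides. *)
Hypothesis lipF : exists2 C : R, 0 <= C & \forall t \near +oo,
  forall r s, t / 2 <= r <= s /\ s <= 2 * t -> F r - F s <= C * (s - r) * (F t / t).

Let bF : locally_bounded F := locally_bounded_nonincreasing nF.
Let F0' x : 0 <= F x := ltW (F0 x).
Let a1 : 1 < alpha. Proof. by case/andP: alpha12. Qed.
Let a2 : alpha < 2. Proof. by case/andP: alpha12. Qed.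

Let conv t u := F u * F (t - u).

Let bconv t : locally_bounded (conv t).
Proof. by apply: locally_boundedM => //; exact: locally_bounded_reflect. Qed.

(** The upper half of Karamata's theorem, by doubling: the block [[t, 2 * t]] contributes at most t
    F(t), and t F(t) shrinks by the factor 2c < 1 at each doubling since 2^(-alpha) < 1/2. The bound
    over [[t, b]] is uniform in [b]. *)
Lemma tint_tail_le : exists2 K, 0 < K &
  \forall t \near +oo, tint F t <= K * (t * F t).
Proof.
have h2 : (2 : R) `^ (- alpha) < 1 / 2.
  have -> : 1 / 2 = (2 : R) `^ (- 1) by rewrite powR_inv1// mul1r.
  by rewrite gt1_ltr_powR ?ltrN2 ?ltr1n.
have p0 : 0 < (2 : R) `^ (- alpha) by apply: powR_gt0.
pose c := ((2 : R) `^ (- alpha) + 1 / 2) / 2.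
have hc : (2 : R) `^ (- alpha) < c by rewrite /c; lra.
have c2 : c < 1 / 2 by rewrite /c; lra.
have [t0 [_ ht0]] := regularly_varying_lt F0 rvF (ltr0n R 2) hc.
have K0 : 0 < (1 - 2 * c)^-1 by rewrite invr_gt0; lra.
exists ((1 - 2 * c)^-1) => //.
exists (Num.max 0 t0); split; first exact: num_real.
have H n t b : Num.max 0 t0 < t -> t <= b <= 2 ^+ n * t ->
    rint F t b <= (1 - 2 * c)^-1 * (t * F t).
  elim: n t b => [|n IH] t b; rewrite gt_max => /andP[tp tt] /andP[tb bt].
    have -> : b = t by apply/eqP; rewrite eq_le tb andbT; rewrite mul1r in bt.
    rewrite /rint set_itv1 Rintegral_set1 mulr_ge0// ?mulr_ge0// ltW//.
  have F_t : rint F t (2 * t) <= t * F t.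
    apply: (@le_trans _ _ (rint (fun=> F t) t (2 * t))).
      apply: le_rint => //; first exact: locally_bounded_cst.
      by move=> x /andP[tx _]; exact: nF.
    by rewrite rint_cst; lra.
  have tF0 : 0 <= t * F t by rewrite mulr_ge0 ?(ltW tp).
  have Kge1 : 1 <= (1 - 2 * c)^-1 by rewrite invf_ge1; lra.
  have [b2|b2] := leP b (2 * t).
    apply: (@le_trans _ _ (rint F t (2 * t))).
      rewrite (@rint_split _ F t (2 * t) b) ?tb//.
      by rewrite lerDl rint_ge0.
    by apply: (le_trans F_t); rewrite ler_peMl.
  rewrite (@rint_split _ F t b (2 * t))//; last by apply/andP; split; lra.
  have IHt : rint F (2 * t) b <= (1 - 2 * c)^-1 * (2 * t * F (2 * t)).
    apply: IH; first by rewrite gt_max; apply/andP; split; lra.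
    by rewrite (ltW b2)/= mulrCA mulrA -exprS.
  apply: (le_trans (lerD F_t IHt)).
  have -> : (1 - 2 * c)^-1 * (t * F t) =
      t * F t + (1 - 2 * c)^-1 * (2 * t * (c * F t)).
    by field; lra.
  by rewrite lerD2l ler_pM2l// ler_pM2l ?mulr_gt0// ltW// ht0.
move=> t tt; apply: tint_le_bound => //; first by have [] := bF.
move=> b tb; apply: (H (Num.bound (b / t))) => //; rewrite tb/=.
have tp : 0 < t by move: tt; rewrite gt_max => /andP[].
rewrite -ler_pdivrMr//.
have b0 : 0 <= b / t by rewrite divr_ge0 ?(ltW tp)// (le_trans (ltW tp)).
apply: (le_trans (ltW (archi_boundP b0))).
by rewrite -natrX ler_nat; exact/ltnW/ltn_expl.
Qed.

(** The increment over [[t / 2, t]] is at most t F(t/2) t/2 = 2 (t/2)^2 F(t/2), so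
    [halving_recursion] applies with [delta = 2]. The positive part keeps the integral nondecreasing
    in [t] when [a] is negative. *)
Lemma first_moment_le a : exists2 K, 0 < K & \forall t \near +oo,
  rint (fun u => Num.max u 0 * F u) a t <= K * (t ^+ 2 * F t).
Proof.
have [K K0 hK] := halving_recursion F0 rvF alpha12.
have bm : locally_bounded (fun u => Num.max u 0 * F u).
  by apply: locally_boundedM => //; exact: locally_bounded_positive_part.
have m0 x : 0 <= Num.max x 0 * F x by rewrite mulr_ge0// le_max lexx orbT.
have [//|||M0 hM] := hK (fun t => rint (fun u => Num.max u 0 * F u) a t) 2.
  exists a => s t /andP[a_s st].
  by rewrite [leRHS](@rint_split _ _ a t s) ?a_s// lerDl rint_ge0.
  near=> t; have t0 : 0 < t by near: t; exact: nbhs_pinfty_gt.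
  have ta : 2 * a <= t by near: t; apply: nbhs_pinfty_ge; exact: num_real.
  rewrite (@rint_split _ _ a t (t / 2))//; last by apply/andP; split; lra.
  rewrite lerD2l (_ : 2 * (_ ^+ 2 * _) = t * F (t / 2) * (t - t / 2)); last by field.
  rewrite -rint_cst; last by lra.
  apply: le_rint => //; first exact: locally_bounded_cst.
  move=> x /andP[tx xt]; apply: ler_pM => //; last exact: nF.
    by rewrite le_max lexx orbT.
  by rewrite ge_max xt ltW.
exists (2 * K + 1); first by lra.
near=> t.
have h1 : rint (fun u => Num.max u 0 * F u) a t <= 2 * K * (t ^+ 2 * F t) + M0.
  by near: t.
have h2 : M0 <= t ^+ 2 * F t.
  by near: t; exact: (sqr_tail_cvgy nF F0 rvF alpha12).
lra.
Unshelve. all: by end_near. Qed.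


Let near_scale (Pr : R -> Prop) N : 1 <= N ->
  (\forall t \near +oo, Pr t) -> \forall t \near +oo, Pr (t * N).
Proof.
move=> N1 [M [_ hM]]; exists (Num.max 0 M); split; first exact: num_real.
move=> t; rewrite gt_max => /andP[t0 tM]; apply: hM.
by apply: (lt_le_trans tM); rewrite ler_peMr// ltW.
Qed.

(** With N = 1/e, the tail beyond t N is of order N^(1 - alpha) t F(t). In the divisor 2 K + 1, the
    summand 2 K pays for this tail, with a factor 2 of slack in regular variation, and the 1 makes
    N^(1 - alpha) itself at most [eta]. *)
Let small_tail eta : 0 < eta -> exists N : R, [/\ 4 <= N,
  N `^ (1 - alpha) <= eta & \forall t \near +oo, tint F (t * N) <= eta * (t * F t)].
Proof.
move=> eta0; have [K K0 hK] := tint_tail_le.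
have K1 : 0 < 2 * K + 1 by lra.
have [|e [e0 e4 he]] := @powR_small R (alpha - 1) (eta / (2 * K + 1)) _
  (divr_gt0 eta0 K1); first by rewrite subr_gt0.
have eN : e^-1 `^ (1 - alpha) = e `^ (alpha - 1).
  by rewrite -(powR_invN (alpha - 1) e0) opprB.
have e'0 : 0 < e^-1 by rewrite invr_gt0.
have N4 : 4 <= e^-1 by rewrite -[leLHS]invrK lef_pV2 ?posrE//; lra.
have he' : (2 * K + 1) * e `^ (alpha - 1) <= eta by rewrite mulrC -ler_pdivlMr.
have p0 : 0 < e `^ (alpha - 1) by exact: powR_gt0.
exists e^-1; split=> //.
  by rewrite eN; apply: le_trans he'; nra.
have Np0 : 0 < e^-1 `^ (- alpha) by exact: powR_gt0.
near=> t; have t0 : 0 < t by near: t; exact: nbhs_pinfty_gt.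
have h1 : tint F (t * e^-1) <= K * (t * e^-1 * F (t * e^-1)).
  by near: t; apply: (near_scale (Pr := fun t => tint F t <= K * (t * F t))) => //; lra.
have h2 : F (e^-1 * t) < 2 * e^-1 `^ (- alpha) * F t.
  by near: t; apply: (regularly_varying_lt F0 rvF) => //; lra.
apply: (le_trans h1).
apply: (@le_trans _ _ (K * (t * e^-1 * (2 * e^-1 `^ (- alpha) * F t)))).
  by rewrite !ler_pM2l ?mulr_gt0// [t * _]mulrC ltW.
have -> : K * (t * e^-1 * (2 * e^-1 `^ (- alpha) * F t)) =
    2 * K * (e^-1 `^ (- alpha) * e^-1) * (t * F t) by ring.
rewrite ler_pM2r ?mulr_gt0//.
have -> : e^-1 `^ (- alpha) * e^-1 = e `^ (alpha - 1).
  rewrite -eN -[X in _ * X]powRr1 ?ltW// -powRD; first by congr (_ `^ _); lra.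
  by apply/implyP => _; rewrite gt_eqF.
by rewrite (le_trans _ he')//; nra.
Unshelve. all: by end_near. Qed.

Let cut_point (a n t e : R) : a <= n -> 0 <= n -> 4 * n <= t * e ->
  t * e <= t / 4 -> 0 < t -> a <= t * e <= t / 2.
Proof. by lra. Qed.

Let shift_bounds (a' n t e : R) : 0 <= a' -> a' <= n -> 0 <= n ->
  4 * n <= t * e -> t * e <= t / 4 -> 0 < t ->
  t / 2 <= t <= t + a' /\ t + a' <= 2 * t.
Proof. by lra. Qed.

Let reflect_bounds (x t e : R) : 0 < x -> x <= t * e -> t * e <= t / 4 ->
  0 < t -> t / 2 <= t - x <= t /\ t <= 2 * t.
Proof. by lra. Qed.

(** [A1], [A2], [A3] stand for the integrals of F over [[a, t e]], [[t e, t N]] and beyond, [C1] and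
    [C2] for those of the convolution over [[a, t e]] and [[t e, t / 2]], and [T] for t F(t)^2. Four
    errors of b/8 leave b/4 of the margin 3b/4. *)
Let assemble_gt (A1 A2 A3 C1 C2 B P b T f : R) :
  (B - b / 8) * T <= C2 -> f * A2 <= (P + b / 8) * T -> f * A3 <= b / 8 * T ->
  f * A1 <= C1 + b / 8 * T -> 3 / 4 * b * T <= (B - P) * T ->
  f * (A1 + (A2 + A3)) + b / 4 * T <= C1 + C2.
Proof. by lra. Qed.

Let assemble_lt (A1 A2 A3 C1 C2 B P b T f : R) : 0 <= b * T ->
  C2 <= (B + b / 8) * T -> (P - b / 8) * T <= f * A2 -> 0 <= f * A3 ->
  C1 <= f * A1 + b / 8 * T -> (B - P) * T <= - (7 / 8) * b * T ->
  C1 + C2 + b / 4 * T <= f * (A1 + (A2 + A3)).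
Proof. by lra. Qed.

(** Once the powers e^(1 - alpha) cancel, the middle ranges give B - P >= 3b/4 with b = (alpha -
    3/2) / (alpha - 1). On [[a, t e]] monotonicity suffices, F (t - u) >= F t for u >= 0, up to a
    correction when [a] is negative. *)
Lemma tail_convolution_gt a : 3 / 2 < alpha -> exists2 k, 0 < k &
  \forall t \near +oo,
    F t * tint F a + k * (t * F t ^+ 2) <= rint (conv t) a (t / 2).
Proof.
move=> a32; pose b := (alpha - 3 / 2) / (alpha - 1).
have am0 : 0 < alpha - 1 by rewrite subr_gt0.
have b0 : 0 < b by rewrite divr_gt0// subr_gt0.
have [||e [e0 e4 he]] := @powR_small R (2 - alpha) ((alpha - 3 / 2) / 8).
  by rewrite subr_gt0.
  by rewrite divr_gt0// subr_gt0.
have [|N [N4 _ hN]] := @small_tail (b / 8); first by rewrite divr_gt0.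
have [C C0 hC] := lipF.
(* For u >= a, negative u included, F (t - u) >= F (t + a'); replacing F (t + a') by F t costs at
   most C a' F(t) / t. *)
pose a' := Num.max 0 (- a).
have a'0 : 0 <= a' by rewrite le_max lexx.
have Ia : 0 <= tint F a by exact: tint_ge0.
have e12 : e < 1 / 2 by lra.
have eN : e < N by lra.
have cB := rint_convolution_scaled_cvg nF F0 rvF e0 (ltW e12)
  (_ : 1 / 2 < 1).
have {}cB := cB ltac:(lra).
have cP := rint_scaled_cvg nF F0 rvF e0 (ltW eN).
set B := rint (fun x => (x * (1 - x)) `^ (- alpha)) e (1 / 2).
pose P := (e `^ (1 - alpha) - N `^ (1 - alpha)) / (alpha - 1).
have BP : 3 / 4 * b <= B - P.
  have := @rint_beta_ge R alpha e; rewrite a32 a2 => /(_ isT e0 e4) hB.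
  apply: le_trans (lerB hB (lexx P)).
  rewrite /P /b -mulrBl mulrA ler_pM2r ?invr_gt0//.
  have : 0 < N `^ (1 - alpha) by rewrite powR_gt0//; lra.
  by move: he; lra.
exists (b / 4); first by rewrite divr_gt0.
near=> t.
have t0 : 0 < t by near: t; exact: nbhs_pinfty_gt.
have ta : 4 * `|a| / e <= t by near: t; apply: nbhs_pinfty_ge; exact: num_real.
have {}ta : 4 * `|a| <= t * e by rewrite -ler_pdivrMr.
have aa : a <= `|a| by exact: ler_norm.
have a'a : a' <= `|a| by rewrite ge_max normr_ge0 -normrN ler_norm.
have a0 : 0 <= `|a| by [].
have te : t * e <= t / 4.
  by rewrite ler_pM2l//; lra.
have Ft := F0 t.
have T0 : 0 < t * F t ^+ 2 by rewrite mulr_gt0// exprn_gt0.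
set T := t * F t ^+ 2 in T0 *.
have H1 : (B - b / 8) * T <= rint (conv t) (t * e) (t / 2).
  rewrite -ler_pdivlMr// -[t / 2]/(t * 2^-1) -[2^-1]mul1r /T.
  near: t; apply: (cvgr_ge _ cB); rewrite -/B; lra.
have H2 : F t * rint F (t * e) (t * N) <= (P + b / 8) * T.
  rewrite /T expr2 mulrA mulrA [_ * F t in leRHS]mulrC ler_pM2l//.
  rewrite -mulrA -ler_pdivrMr ?mulr_gt0//.
  near: t; apply: (cvgr_le _ cP); rewrite rint_powRN// -/P; lra.
have H3 : F t * tint F (t * N) <= b / 8 * T.
  rewrite /T (_ : _ * (t * _) = F t * (b / 8 * (t * F t))); last by ring.
  by rewrite ler_pM2l//; near: t.
have bb := cut_point aa a0 ta te t0.
have [bb1 bb2] := andP bb.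
have H4 : F t * rint F a (t * e) <= rint (conv t) a (t * e) + b / 8 * T.
  have L1 : F (t + a') * rint F a (t * e) <= rint (conv t) a (t * e).
    rewrite -rintZ//; apply: le_rint => //.
      by apply: locally_boundedM => //; exact: locally_bounded_cst.
    move=> x /andP[ax _]; rewrite mulrC ler_pM2l// nF// lerD2l.
    by rewrite le_max lerN2 ax orbT.
  have L2 : F t - F (t + a') <= C * (t + a' - t) * (F t / t).
    have hCt : forall r s, t / 2 <= r <= s /\ s <= 2 * t ->
        F r - F s <= C * (s - r) * (F t / t) by near: t.
    exact: (hCt _ _ (shift_bounds a'0 a'a a0 ta te t0)).
  have L3 : rint F a (t * e) <= tint F a.
    by rewrite (@tint_split _ F a (t * e))// lerDl tint_ge0.
  (* The correction is a constant times F(t) / t, to be compared with t F(t)^2 = t^2 F(t) F(t) / t,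
     whose first factor tends to infinity. *)
  have L4 : C * a' * tint F a <= b / 8 * (t ^+ 2 * F t).
    have b8 : 0 < b / 8 by exact: divr_gt0.
    rewrite -ler_pdivrMl//; near: t; exact: (sqr_tail_cvgy nF F0 rvF alpha12).
  have A0 : 0 <= rint F a (t * e) by exact: rint_ge0.
  rewrite (_ : t + a' - t = a') in L2; last by ring.
  apply: (@le_trans _ _ ((F (t + a') + C * a' * (F t / t)) * rint F a (t * e))).
    by rewrite ler_wpM2r// -lerBlDl.
  rewrite mulrDl; apply: lerD => //.
  apply: (@le_trans _ _ (C * a' * (F t / t) * tint F a)).
    by rewrite ler_wpM2l// !mulr_ge0 ?invr_ge0 ?(ltW t0).
  rewrite (_ : _ * tint F a = (C * a' * tint F a) * (F t / t)); last by ring.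
  rewrite (_ : b / 8 * T = (b / 8 * (t ^+ 2 * F t)) * (F t / t)).
    by rewrite ler_pM2r// divr_gt0.
  by rewrite /T; field; rewrite gt_eqF.
rewrite (@tint_split _ F a (t * e))//.
rewrite (@tint_split _ F (t * e) (t * N))//; last by rewrite ler_pM2l// ltW.
rewrite (@rint_split _ (conv t) a (t / 2) (t * e))//.
have := ler_wpM2r (ltW T0) BP.
exact: (assemble_gt H1 H2 H3 H4).
Unshelve. all: by end_near. Qed.

(** On [[a, t e]] the reverse estimate needs F (t - u) <= F t + C u F(t) / t for u > 0. The excess
    is a first moment of order (t e)^2 F(t e), that is e^(2 - alpha) t^2 F(t), and is made small by
    the choice of [e]. *)
Lemma tail_convolution_lt a : alpha < 3 / 2 -> exists2 k, 0 < k &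
  \forall t \near +oo,
    rint (conv t) a (t / 2) + k * (t * F t ^+ 2) <= F t * tint F a.
Proof.
move=> a32; pose b := (3 / 2 - alpha) / (alpha - 1).
have am0 : 0 < alpha - 1 by rewrite subr_gt0.
have b0 : 0 < b by rewrite divr_gt0// subr_gt0.
have [C C0 hC] := lipF.
have [K K0 hK] := first_moment_le a.
(* The 2 is the slack in F (e t) < 2 e^(-alpha) F t; adding 1 keeps the divisor positive when [C] is
   0. *)
have CK : 0 < 2 * C * K + 1 by rewrite ltr_wpDl// !mulr_ge0// ltW.
have b8 : 0 < b / 8 by exact: divr_gt0.
have D0 : 0 < b / 8 / (2 * C * K + 1) by exact: divr_gt0.
have [||e [e0 e4 he]] := @powR_small R (2 - alpha) (b / 8 / (2 * C * K + 1)) => //.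
  by rewrite subr_gt0.
have {}he : 2 * C * K * e `^ (2 - alpha) <= b / 8.
  have : (2 * C * K + 1) * e `^ (2 - alpha) <= b / 8.
    by rewrite mulrC -ler_pdivlMr.
  by have := powR_ge0 e (2 - alpha); lra.
(* The part of the power integral missing beyond [N] lowers [P], the unfavourable direction, so [N]
   has to make N^(1 - alpha) / (alpha - 1) at most b/8. *)
have [|N [N4 hN' _]] := @small_tail (b / 8 * (alpha - 1)).
  by rewrite mulr_gt0// divr_gt0.
have e12 : e < 1 / 2 by lra.
have eN : e < N by lra.
have cB := rint_convolution_scaled_cvg nF F0 rvF e0 (ltW e12)
  (_ : 1 / 2 < 1).
have {}cB := cB ltac:(lra).
have cP := rint_scaled_cvg nF F0 rvF e0 (ltW eN).
set B := rint (fun x => (x * (1 - x)) `^ (- alpha)) e (1 / 2).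
pose P := (e `^ (1 - alpha) - N `^ (1 - alpha)) / (alpha - 1).
have BP : B - P <= - (7 / 8) * b.
  have := @rint_beta_le R alpha e; rewrite a32 a1 => /(_ isT e0 e4) hB.
  apply: (le_trans (lerB hB (lexx P))).
  rewrite /P /b -mulrBl mulrA ler_pM2r ?invr_gt0//.
  have bE : b * (alpha - 1) = 3 / 2 - alpha by rewrite /b mulfVK// gt_eqF.
  move: hN'; rewrite (_ : b / 8 * _ = b * (alpha - 1) / 8); last by ring.
  by rewrite bE; lra.
exists (b / 4); first by rewrite divr_gt0.
near=> t.
have t0 : 0 < t by near: t; exact: nbhs_pinfty_gt.
have ta : 4 * `|a| / e <= t by near: t; apply: nbhs_pinfty_ge; exact: num_real.
have {}ta : 4 * `|a| <= t * e by rewrite -ler_pdivrMr.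
have aa : a <= `|a| by exact: ler_norm.
have a0 : 0 <= `|a| by [].
have te : t * e <= t / 4.
  by rewrite ler_pM2l//; lra.
have Ft := F0 t.
have T0 : 0 < t * F t ^+ 2 by rewrite mulr_gt0// exprn_gt0.
set T := t * F t ^+ 2 in T0 *.
have H1 : rint (conv t) (t * e) (t / 2) <= (B + b / 8) * T.
  rewrite -ler_pdivrMr// -[t / 2]/(t * 2^-1) -[2^-1]mul1r /T.
  near: t; apply: (cvgr_le _ cB); rewrite -/B; lra.
have H2 : (P - b / 8) * T <= F t * rint F (t * e) (t * N).
  rewrite /T expr2 mulrA mulrA [_ * F t in leLHS]mulrC ler_pM2l//.
  rewrite -mulrA -ler_pdivlMr ?mulr_gt0//.
  near: t; apply: (cvgr_ge _ cP); rewrite rint_powRN// -/P; lra.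
have bb := cut_point aa a0 ta te t0.
have [bb1 bb2] := andP bb.
have H4 : rint (conv t) a (t * e) <= F t * rint F a (t * e) + b / 8 * T.
  have bm : locally_bounded (fun u => Num.max u 0 * F u).
    by apply: locally_boundedM => //; exact: locally_bounded_positive_part.
  have L1 : rint (conv t) a (t * e) <= F t * rint F a (t * e) +
      C * (F t / t) * rint (fun u => Num.max u 0 * F u) a (t * e).
    rewrite -!rintZ// -rintD//; last 2 first.
    - by apply: locally_boundedM => //; exact: locally_bounded_cst.
    - by apply: locally_boundedM => //; exact: locally_bounded_cst.
    apply: le_rint => //.
      by apply: locally_boundedD;
        apply: locally_boundedM => //; exact: locally_bounded_cst.
    move=> x /andP[ax xe].
    have -> : F t * F x + C * (F t / t) * (Num.max x 0 * F x) =
        F x * (F t + C * Num.max x 0 * (F t / t)) by ring.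
    rewrite ler_pM2l//.
    have [x0|x0] := leP x 0.
      by rewrite mulr0 mul0r addr0 nF// lerBrDr gerDl.
    have hCt : forall r s, t / 2 <= r <= s /\ s <= 2 * t ->
        F r - F s <= C * (s - r) * (F t / t) by near: t.
    have := hCt (t - x) t; rewrite (_ : t - (t - x) = x); last by ring.
    move=> h.
    by rewrite -lerBlDl; apply: h; exact: (reflect_bounds x0 xe te t0).
  apply: (le_trans L1); rewrite lerD2l.
  have L2 : rint (fun u => Num.max u 0 * F u) a (t * e) <=
      K * ((t * e) ^+ 2 * F (t * e)).
    near: t; have [M [_ hM]] := hK.
    exists (Num.max 0 (M / e)); split; first exact: num_real.
    by move=> s; rewrite gt_max => /andP[s0 sM]; apply: hM; rewrite -ltr_pdivrMr.
  have L3 : F (e * t) < 2 * e `^ (- alpha) * F t.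
    near: t; apply: (regularly_varying_lt F0 rvF) => //.
    have : 0 < e `^ (- alpha) by exact: powR_gt0.
    lra.
  apply: (@le_trans _ _ (C * (F t / t) *
      (K * ((t * e) ^+ 2 * (2 * e `^ (- alpha) * F t))))).
    rewrite ler_wpM2l//; first by rewrite !mulr_ge0 ?invr_ge0 ?(ltW t0).
    apply: (le_trans L2); rewrite ler_pM2l// ler_pM2l ?exprn_gt0 ?mulr_gt0//.
    by rewrite [t * e]mulrC ltW.
  have -> : C * (F t / t) * (K * ((t * e) ^+ 2 * (2 * e `^ (- alpha) * F t))) =
      2 * C * K * (e ^+ 2 * e `^ (- alpha)) * T.
    by rewrite /T; field; rewrite gt_eqF.
  have -> : e ^+ 2 * e `^ (- alpha) = e `^ (2 - alpha).
    by rewrite -powR_mulrn ?(ltW e0)// -powRD//; apply/implyP => _; rewrite gt_eqF.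
  by rewrite ler_pM2r.
have A3 : 0 <= tint F (t * N) by exact: tint_ge0.
have FA3 : 0 <= F t * tint F (t * N) by rewrite mulr_ge0.
rewrite (@tint_split _ F a (t * e))//.
rewrite (@tint_split _ F (t * e) (t * N))//; last by rewrite ler_pM2l// ltW.
rewrite (@rint_split _ (conv t) a (t / 2) (t * e))//.
have bT := mulr_ge0 (ltW b0) (ltW T0).
have := ler_wpM2r (ltW T0) BP.
exact: (assemble_lt bT H1 H2 FA3 H4).
Unshelve. all: by end_near. Qed.

End tail_convolution_sign.

(** * Tail increments controlled by the density *)

Section density_tail.
Variables (R : realType) (F f : R -> R) (alpha : R).
Hypothesis alpha0 : 0 < alpha.
Hypothesis nF : nonincreasing_fun F.
Hypothesis F0 : forall x, 0 < F x.
Hypothesis rvF : regularly_varying F alpha.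
Hypothesis cf : continuous f.
Hypothesis f0 : forall x, 0 <= f x.
Hypothesis rvf : regularly_varying f (alpha + 1).
Hypothesis Ff : forall r s, r <= s -> F r - F s = rint f r s.

Let bf : locally_bounded f.
Proof.
split; first exact: continuous_measurable_fun.
move=> a b; have [ab|ba] := leP a b; last first.
  by exists 0 => x /andP[ax xb]; have := lt_le_trans ba (le_trans ax xb); rewrite ltxx.
have [c _ hc] := EVT_max ab (continuous_subspaceT cf).
by exists (f c) => x xab; rewrite ger0_norm// hc// in_itv.
Qed.

Let bmin (h : R -> R) c : locally_bounded h -> locally_bounded (fun x => Num.min (h x) c).
Proof.
move=> [mh bh]; split; first exact: measurable_minr.
move=> a b; have [M hM] := bh a b; exists (M + `|c|) => x /hM xM.
rewrite (le_trans (_ : _ <= `|h x| + `|c|)) ?lerD2r//.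
by rewrite /Num.min; case: ifP => _; rewrite ?lerDl ?lerDr.
Qed.

(* As [u -> +oo], [f (u x) / f u] tends to [x `^ - (alpha + 1)], whereas its
   integral over [1, 2] is at most [F u / (u f u)]. Truncating at [2] and passing
   to the limit shows that this ratio cannot become arbitrarily small. *)
Lemma density_le_tail : exists2 C, 0 <= C &
  \forall t \near +oo, t * f t <= C * F t.
Proof.
apply: contrapT => noC.
(* Points beyond [n] at which F t / (t f t) is below 1 / (n + 1). *)
have seqP (n : nat) : exists t, n%:R < t /\ n.+1%:R * F t < t * f t.
  apply: contrapT => no; apply: noC; exists n.+1%:R => //.
  exists n%:R; split; first exact: num_real.
  move=> t nt; rewrite leNgt; apply/negP => h; apply: no; exists t.
  by split.
have [u uP] := choice seqP.
have u0 n : 0 < u n by have [h _] := uP n; apply: le_lt_trans h.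
have fu n : 0 < f (u n).
  have [_ h] := uP n; rewrite -(pmulr_rgt0 _ (u0 n)); apply: lt_trans h.
  by rewrite mulr_gt0.
have uoo : u n @[n --> \oo] --> +oo.
  apply/cvgryPgt => A; near=> n; have [h _] := uP n; apply: lt_trans h.
  by near: n; exact: nbhs_infty_gtr.
(* Without monotonicity of [f], domination comes from the truncation; the limit x^(-(alpha + 1)) is
   at most 1 on [[1, 2]], so the level 2 does not alter it. *)
pose h n x := Num.min ((f (u n))^-1 * f (u n * x)) 2.
have bh n : locally_bounded (h n).
  apply: bmin; apply: locally_boundedM; first exact: locally_bounded_cst.
  exact: locally_bounded_scale.
have h_cvg : rint (h n) 1 2 @[n --> \oo] -->
    rint (fun x => x `^ (- (alpha + 1))) 1 2.
  apply: (@rint_bounded_cvg _ _ _ _ _ 2 0) => //.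
  - by apply: measurable_funTS; exact: measurable_powR.
  - move=> n x _ _; rewrite le_min ge_min lexx orbT ler0n !andbT.
    by rewrite mulr_ge0// invr_ge0 ltW.
  - move=> x /andP[x1 _].
    have x0 : 0 < x by exact: lt_le_trans x1.
    have := rvf x0 => /cvg_pinftyP/(_ _ uoo) hx.
    have x2 : x `^ (- (alpha + 1)) < 2.
      rewrite (@le_lt_trans _ _ 1) ?ltr1n// -[leRHS](powRr0 x) ler_powR//.
      by rewrite oppr_le0 addr_ge0// ltW.
    have gx : (f (u n))^-1 * f (u n * x) @[n --> \oo] --> x `^ (- (alpha + 1)).
      rewrite -[X in _ --> X]mul1r.
      rewrite (_ : (fun n => _) = (fun n => f (x * u n) /
      (x `^ (- (alpha + 1)) * f (u n)) * x `^ (- (alpha + 1)))).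
        by apply: cvgM; [exact: hx|exact: cvg_cst].
      apply/funext => n; rewrite [u n * x]mulrC; field.
      by rewrite !gt_eqF// powR_gt0.
    apply: (cvg_trans _ gx); apply: near_eq_cvg; near=> n.
    rewrite /h min_l//; near: n; exact: (cvgr_le _ gx).
have h_small n : rint (h n) 1 2 <= n.+1%:R^-1.
  apply: (@le_trans _ _ (rint (fun x => (f (u n))^-1 * f (u n * x)) 1 2)).
    apply: le_rint => //.
      apply: locally_boundedM; first exact: locally_bounded_cst.
      exact: locally_bounded_scale.
    by move=> x _; rewrite ge_min lexx.
  rewrite rintZ; last exact: locally_bounded_scale.
  have := rint_scale 1 2 bf f0 (u0 n); rewrite mulr1 -Ff; last by have := u0 n; lra.
  move=> hE; have [_ un] := uP n.
  rewrite -(ler_pM2l (mulr_gt0 (ltr0Sn R n) (mulr_gt0 (fu n) (u0 n)))).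
  have -> : n.+1%:R * (f (u n) * u n) *
    ((f (u n))^-1 * rint (fun x => f (u n * x)) 1 2) =
    n.+1%:R * (u n * rint (fun x => f (u n * x)) 1 2) by field; rewrite gt_eqF.
  rewrite -hE.
  have -> : n.+1%:R * (f (u n) * u n) / n.+1%:R = u n * f (u n) by field.
  by apply: le_trans (ltW un); rewrite ler_pM2l// gerBl ltW.
have pos : 0 < rint (fun x => x `^ (- (alpha + 1))) 1 2.
  rewrite rint_powRN ?ltr1n ?ltrDr// (_ : 1 - (alpha + 1) = - alpha); last by lra.
  rewrite addrK divr_gt0// subr_gt0 powR1 -[ltRHS](powRr0 2) gt1_ltr_powR ?ltr1n//.
  by rewrite oppr_lt0.
have : rint (fun x => x `^ (- (alpha + 1))) 1 2 <= 0.
  exact: (ler_cvg_to h_cvg (@cvg_harmonic R) (nearW _ h_small)).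
by rewrite leNgt pos.
Unshelve. all: by end_near. Qed.

(** For x >= t / 2 the previous bound gives f x <= C F x / x <= (2 C / t) F (t / 2), and F (t / 2)
    is at most a constant times F t by regular variation; integration over [[r, s]] concludes. *)
Lemma density_tail_lipschitz : exists2 C : R, 0 <= C &
  \forall t \near +oo, forall r s,
    t / 2 <= r <= s /\ s <= 2 * t -> F r - F s <= C * (s - r) * (F t / t).
Proof.
have [C C0 [t0 [_ hC]]] := density_le_tail.
have p0 : 0 < (1 / 2 : R) `^ (- alpha) by apply: powR_gt0; lra.
exists (2 * C * ((1 / 2 : R) `^ (- alpha) + 1)); first by rewrite !mulr_ge0//; lra.
near=> t => r s [/andP[tr rs] s2].
have tp : 0 < t by near: t; exact: nbhs_pinfty_gt.
have tt0 : 2 * t0 < t by near: t; apply: nbhs_pinfty_gt; exact: num_real.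
have hF : F (1 / 2 * t) < ((1 / 2 : R) `^ (- alpha) + 1) * F t.
  by near: t; apply: (regularly_varying_lt F0 rvF); lra.
rewrite Ff// (_ : _ * (s - r) * _ =
  (2 * C * ((1 / 2) `^ (- alpha) + 1) * (F t / t)) * (s - r)); last by ring.
rewrite -rint_cst//; apply: le_rint => //; first exact: locally_bounded_cst.
move=> x /andP[rx _].
have tx : t / 2 <= x by lra.
have x0 : 0 < x by lra.
have fx : x * f x <= C * F x by apply: hC; lra.
have Fx : F x <= F (1 / 2 * t) by apply: nF; lra.
rewrite -(ler_pM2l x0); apply: (le_trans fx).
apply: (@le_trans _ _ (C * (((1 / 2) `^ (- alpha) + 1) * F t))).
  by rewrite ler_wpM2l//; apply: le_trans Fx (ltW hF).
rewrite [leRHS](_ : _ = (2 * x / t) * (C * (((1 / 2) `^ (- alpha) + 1) * F t))).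
  rewrite ler_peMl//; first by rewrite !mulr_ge0// ?addr_ge0// ltW.
  by rewrite ler_pdivlMr//; lra.
by field; rewrite gt_eqF.
Unshelve. all: by end_near. Qed.

End density_tail.

(** * Sign of [w - v] far to the left *)

Section drift_sign.
Variable R : realType.
Notation mu := (@lebesgue_measure R).

Lemma integrable_tail_le (f h : R -> R) a : measurable_fun setT f ->
  (forall x, a <= x -> 0 <= f x <= h x) ->
  mu.-integrable `[a, +oo[ (EFin \o h) -> mu.-integrable `[a, +oo[ (EFin \o f).
Proof.
move=> mf fh; apply: le_integrable => //.
  by apply/measurable_EFinP; exact: measurable_funTS.
move=> x /=; rewrite in_itv/= andbT => /fh /andP[f0 fh'].
by rewrite lee_fin !ger0_norm// (le_trans f0).
Qed.

Lemma integrable_tail_shift (f : R -> R) a t : measurable_fun setT f ->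
  (forall x, 0 <= f x) -> mu.-integrable `[a, +oo[ (EFin \o f) ->
  mu.-integrable `[a + t, +oo[ (EFin \o (fun x : R => f (x - t))).
Proof.
move=> mf f0 fi.
have mft : measurable_fun setT (fun x : R => f (x - t)).
  by apply: (measurableT_comp mf); exact: measurable_funB.
apply/integrableP; split.
  by apply/measurable_EFinP; exact: measurable_funTS.
have -> : (\int[mu]_(x in `[(a + t)%R, +oo[) `|(EFin \o (fun x : R => f (x - t)%R)) x| =
    \int[mu]_(x in `[a, +oo[) (f x)%:E)%E.
  rewrite -(ge0_integral_affine (- t) (oner_neq0 R) (measurable_itv _) mf f0).
  rewrite normr1 mul1e (_ : (fun x : R => _) @^-1` _ = `[a + t, +oo[%classic).
    by apply: eq_integral => x _; rewrite mul1r /= ger0_norm.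
  by apply/seteqP; split=> x /=; rewrite !in_itv/= !andbT mul1r lerBrDr.
by apply: integrable_lty.
Qed.

Variables (F N : R -> R) (alpha m a : R).
Hypothesis nF : nonincreasing_fun F.
Hypothesis nN : nonincreasing_fun N.
Hypothesis F0 : forall x, 0 < F x.
Hypothesis N0 : forall x, 0 <= N x.
Hypothesis FN : forall x, F (- x) + N x = 1.
Hypothesis rvF : regularly_varying F alpha.
Hypothesis alpha12 : 1 < alpha < 2.
Hypothesis iF : forall b, mu.-integrable `[b, +oo[ (EFin \o F).
Hypothesis iN : forall b, mu.-integrable `[b, +oo[ (EFin \o N).
Hypothesis lipF : exists2 C : R, 0 <= C & \forall t \near +oo,
  forall r s, t / 2 <= r <= s /\ s <= 2 * t -> F r - F s <= C * (s - r) * (F t / t).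
(** The mean is -m, written through the two tails. With [a_eq], the boundary terms of the brackets
    based at [a] and at 0 add up to F(t) times the integral of N. *)
Hypothesis m_eq : tint N 0 - tint F 0 = m.
Hypothesis a_eq : tint F a = m.

Let bF : locally_bounded F := locally_bounded_nonincreasing nF.
Let bN : locally_bounded N := locally_bounded_nonincreasing nN.
Let F0' x : 0 <= F x := ltW (F0 x).
Let F1 x : F x <= 1.
Proof. by rewrite -(FN (- x)) opprK lerDl. Qed.
Let N1 x : N x <= 1.
Proof. by rewrite -(FN x) lerDr. Qed.

Let conv t u := F u * F (t - u).
(** The complement of [conv]: as N (u - t) = 1 - F (t - u), the two functions add up to F. *)
Let back t u := F u * N (u - t).

Let bconv t : locally_bounded (conv t).
Proof. by apply: locally_boundedM => //; exact: locally_bounded_reflect. Qed.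

Let bNt t : locally_bounded (fun u => N (u - t)).
Proof.
have := locally_bounded_affine 1 (- t) bN; congr locally_bounded.
by apply/funext => x; rewrite mul1r.
Qed.

Let bback t : locally_bounded (back t).
Proof. exact: locally_boundedM. Qed.

Let iconv t b : mu.-integrable `[b, +oo[ (EFin \o conv t).
Proof.
apply: integrable_tail_le (iF b); first by have [] := bconv t.
by move=> x _; rewrite mulr_ge0//= ler_piMr.
Qed.

Let iback t b : mu.-integrable `[b, +oo[ (EFin \o back t).
Proof.
apply: integrable_tail_le (iF b); first by have [] := bback t.
by move=> x _; rewrite mulr_ge0//= ler_piMr.
Qed.

Let iNt t : mu.-integrable `[t, +oo[ (EFin \o (fun u => N (u - t))).
Proof.
have := @integrable_tail_shift N 0 t _ N0 (iN 0); rewrite add0r; apply.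
by have [] := bN.
Qed.

(* For [F] and [N] the tails of [X], the left-hand side is [m * w (- t)] and
   [tint F t] is [m * v (- t)] as soon as [a <= t]. *)
Lemma tail_convolution_split t : 0 < t -> a <= t / 2 ->
  tint (conv t) a =
  rint (conv t) a (t / 2) + rint (conv t) 0 (t / 2) + tint F t - tint (back t) t.
Proof.
move=> t0 at2.
rewrite (@tint_split _ (conv t) a (t / 2))//.
rewrite (@tint_split _ (conv t) (t / 2) t)//; last by lra.
(* The convolution is symmetric under u -> t - u, which carries [[t / 2, t]] to [[0, t / 2]]: the
   origin of the bracket based at 0. *)
have -> : rint (conv t) (t / 2) t = rint (conv t) 0 (t / 2).
  have := @rint_reflect _ (conv t) 0 (t / 2) t (bconv t) _.
  rewrite subr0 (_ : t - t / 2 = t / 2); last by field.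
  move=> <-; last by move=> x; rewrite mulr_ge0.
  by apply: eq_rint => x _; rewrite /conv subKr mulrC.
have -> : tint F t = tint (conv t) t + tint (back t) t.
  rewrite /tint -RintegralD//; apply: eq_Rintegral => x _.
  rewrite /conv /back -mulrDr (_ : t - x = - (x - t)) ?FN ?mulr1//; ring.
ring.
Qed.

(** After the shift u = t + s, this is nonnegativity of the integral of (F t - F (t + s)) N s, the
    favourable sign for a lower bound on w - v. *)
Lemma tint_back_le t : tint (back t) t <= F t * tint N 0.
Proof.
rewrite -(@tint_shift _ N 0 t)//; last by have [] := bN.
rewrite add0r /tint -RintegralZl//; apply: le_Rintegral => //.
  exact: (integrableZl _ (F t) (iNt t)).
by move=> x /=; rewrite in_itv/= andbT => tx; rewrite ler_wpM2r// nF.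
Qed.

Lemma tail_convolution_superharmonic_fails : 3 / 2 < alpha ->
  exists2 k, 0 < k & \forall t \near +oo,
    tint F t + k * (t * F t ^+ 2) <= tint (conv t) a.
Proof.
move=> a32.
have [k k0 hk] := tail_convolution_gt nF F0 rvF alpha12 iF lipF a a32.
have [k' k'0 hk'] := tail_convolution_gt nF F0 rvF alpha12 iF lipF 0 a32.
exists (k + k'); first exact: addr_gt0.
near=> t.
rewrite tail_convolution_split; last 2 first.
- by near: t; exact: nbhs_pinfty_gt.
- rewrite ler_pdivlMr//; near: t; apply: nbhs_pinfty_ge; exact: num_real.
have h1 : F t * tint F a + k * (t * F t ^+ 2) <= rint (conv t) a (t / 2) by near: t.
have h2 : F t * tint F 0 + k' * (t * F t ^+ 2) <= rint (conv t) 0 (t / 2) by near: t.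
have := tint_back_le t.
have : tint N 0 = tint F a + tint F 0 by rewrite a_eq -m_eq subrK.
move=> ->; move: h1 h2; rewrite mulrDr mulrDl; set T := t * _.
move: (rint _ _ _) (rint _ _ _) (tint F t) (tint _ _) (F t * _) (F t * _) => *.
lra.
Unshelve. all: by end_near. Qed.

Hypothesis A2 : forall eps, 0 < eps ->
  \forall t \near +oo, tint N t <= eps * (t * F t).

(** The increment over [[t / 2, t]] is at most t times the integral of N from t / 2 on, which (A2)
    makes an arbitrarily small multiple of (t/2)^2 F(t/2). Half of [eps] pays for the recursion, the
    other half for its additive constant. *)
Lemma left_first_moment_le eps : 0 < eps -> \forall t \near +oo,
  rint (fun s => Num.max s 0 * N s) 0 t <= eps * (t ^+ 2 * F t).
Proof.
move=> eps0.
have [K K0 hK] := halving_recursion F0 rvF alpha12.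
have bm : locally_bounded (fun u => Num.max u 0 * N u).
  by apply: locally_boundedM => //; exact: locally_bounded_positive_part.
have m0 x : 0 <= Num.max x 0 * N x by rewrite mulr_ge0// le_max lexx orbT.
pose d := eps / (2 * K).
have d0 : 0 < d by rewrite divr_gt0// mulr_gt0.
have [|||M0 hM] := hK (fun t => rint (fun u => Num.max u 0 * N u) 0 t) d.
- exact: ltW.
- exists 0 => s t /andP[a_s st].
  by rewrite [leRHS](@rint_split _ _ 0 t s) ?a_s// lerDl rint_ge0.
- have [s [_ hs]] := A2 (divr_gt0 d0 (ltr0n R 2)).
  near=> t; have t0 : 0 < t by near: t; exact: nbhs_pinfty_gt.
  rewrite (@rint_split _ _ 0 t (t / 2))//; last by apply/andP; split; lra.
  rewrite lerD2l.
  apply: (@le_trans _ _ (t * tint N (t / 2))).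
    rewrite (@tint_split _ N (t / 2) t)//; last by lra.
    rewrite mulrDr -rintZ//; apply: (@le_trans _ _ (rint (fun x => t * N x) (t / 2) t)).
      apply: le_rint => //.
        by apply: locally_boundedM => //; exact: locally_bounded_cst.
      move=> x /andP[tx xt]; rewrite ler_wpM2r// ge_max xt ltW//.
    by rewrite lerDl mulr_ge0 ?(ltW t0)// tint_ge0.
  have h : tint N (t / 2) <= d / 2 * (t / 2 * F (t / 2)).
    apply: hs; rewrite ltr_pdivlMr//; near: t; apply: nbhs_pinfty_gt; exact: num_real.
  apply: (@le_trans _ _ (t * (d / 2 * (t / 2 * F (t / 2))))).
    by rewrite ler_pM2l.
  by rewrite le_eqVlt; apply/orP; left; apply/eqP; field.
near=> t.
have h1 : rint (fun u => Num.max u 0 * N u) 0 t <= d * K * (t ^+ 2 * F t) + M0.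
  by near: t.
have h2 : M0 / (eps / 2) <= t ^+ 2 * F t.
  by near: t; exact: (sqr_tail_cvgy nF F0 rvF alpha12).
move: h2; rewrite ler_pdivrMr ?divr_gt0// => h2.
have dK : d * K = eps / 2 by rewrite /d; field; rewrite gt_eqF.
apply: (le_trans h1); rewrite dK; lra.
Unshelve. all: by end_near. Qed.

(** The integral of (F t - F (t + s)) N s is split at s = t. Below, the increment is at most C s
    F(t) / t and the first moment of N is small; above, it is at most F t and (A2) applies
    directly. *)
Lemma tint_back_ge eps : 0 < eps -> \forall t \near +oo,
  F t * tint N 0 <= tint (back t) t + eps * (t * F t ^+ 2).
Proof.
move=> eps0; have [C C0 hC] := lipF.
have C1 : 0 < C + 1 by lra.
have bm : locally_bounded (fun u => Num.max u 0 * N u).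
  by apply: locally_boundedM => //; exact: locally_bounded_positive_part.
have m0 x : 0 <= Num.max x 0 * N x by rewrite mulr_ge0// le_max lexx orbT.
have d0 : 0 < eps / (2 * (C + 1)) by rewrite divr_gt0// mulr_gt0.
near=> t.
have t0 : 0 < t by near: t; exact: nbhs_pinfty_gt.
have t2 : t <= 2 * t by lra.
have Ft := F0 t.
have hN : tint N t <= eps / 2 * (t * F t) by near: t; apply: A2; exact: divr_gt0.
have hM : rint (fun s => Num.max s 0 * N s) 0 t <=
    eps / (2 * (C + 1)) * (t ^+ 2 * F t) by near: t; exact: left_first_moment_le.
have mN : measurable_fun setT N by have [] := bN.
rewrite -(@tint_shift _ N 0 t)// add0r (@tint_split _ _ t (2 * t))//.
rewrite (_ : 2 * t = t + t); last by ring.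
rewrite tint_shift// -(_ : 2 * t = t + t); last by ring.
have s1 : F t * rint (fun x => N (x - t)) t (2 * t) <= rint (back t) t (2 * t) +
    C * (F t / t) * rint (fun x => Num.max (x - t) 0 * N (x - t)) t (2 * t).
  have bm' : locally_bounded (fun x => Num.max (x - t) 0 * N (x - t)).
    have := locally_bounded_affine 1 (- t) bm; congr locally_bounded.
    by apply/funext => x; rewrite mul1r.
  rewrite -!rintZ// -rintD//; last first.
    by apply: locally_boundedM => //; exact: locally_bounded_cst.
  apply: le_rint.
  - by apply: locally_boundedM => //; exact: locally_bounded_cst.
  - apply: locally_boundedD => //.
    by apply: locally_boundedM => //; exact: locally_bounded_cst.
  move=> x /andP[tx x2].
  rewrite [leRHS](_ : _ =
    (F x + C * (F t / t) * Num.max (x - t) 0) * N (x - t)); last first.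
    by rewrite /back; ring.
  rewrite ler_wpM2r// max_l ?subr_ge0//.
  have hCt : forall r s, t / 2 <= r <= s /\ s <= 2 * t ->
      F r - F s <= C * (s - r) * (F t / t) by near: t.
  rewrite addrC -lerBlDr mulrAC; apply: hCt; split=> //.
  by rewrite tx andbT ler_pdivrMr// ler_pMr// ler1n.
have s2 : rint (fun x => Num.max (x - t) 0 * N (x - t)) t (2 * t) =
    rint (fun s => Num.max s 0 * N s) 0 t.
  have := rint_affine t (2 * t) (- t) bm m0 (ltr01).
  rewrite !mul1r subrr (_ : 2 * t - t = t); last by ring.
  by move=> <-; apply: eq_rint => x _; rewrite mul1r.
have s3 : rint (back t) t (2 * t) <= tint (back t) t.
  rewrite (@tint_split _ (back t) t (2 * t))// lerDl tint_ge0// => x _.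
  by rewrite mulr_ge0.
rewrite s2 in s1.
have s4 : C * (F t / t) * rint (fun s => Num.max s 0 * N s) 0 t <=
    eps / 2 * (t * F t ^+ 2).
  apply: (@le_trans _ _ ((C + 1) * (F t / t) * (eps / (2 * (C + 1)) * (t ^+ 2 * F t)))).
    apply: ler_pM => //; first by rewrite !mulr_ge0 ?invr_ge0 ?(ltW t0).
      exact: rint_ge0.
    by rewrite ler_wpM2r ?divr_ge0 ?(ltW t0)// lerDl.
  rewrite le_eqVlt; apply/orP; left; apply/eqP; field.
  by rewrite !gt_eqF.
have s5 : F t * tint N t <= eps / 2 * (t * F t ^+ 2).
  rewrite (_ : _ * (t * _ ^+ 2) = F t * (eps / 2 * (t * F t))); last by ring.
  by rewrite ler_pM2l.
rewrite mulrDr; apply: (le_trans (lerD (le_trans s1 (lerD s3 s4)) s5)).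
by rewrite -addrA lerD2l -mulrDl -splitr.
Unshelve. all: by end_near. Qed.

Lemma tail_convolution_superharmonic : alpha < 3 / 2 ->
  \forall t \near +oo, tint (conv t) a <= tint F t.
Proof.
move=> a32.
have [k k0 hk] := tail_convolution_lt nF F0 rvF alpha12 iF lipF a a32.
have [k' k'0 hk'] := tail_convolution_lt nF F0 rvF alpha12 iF lipF 0 a32.
near=> t.
have Ft := F0 t.
have t0 : 0 < t by near: t; exact: nbhs_pinfty_gt.
rewrite tail_convolution_split//; last first.
  rewrite ler_pdivlMr//; near: t; apply: nbhs_pinfty_ge; exact: num_real.
have h1 : rint (conv t) a (t / 2) + k * (t * F t ^+ 2) <= F t * tint F a by near: t.
have h2 : rint (conv t) 0 (t / 2) + k' * (t * F t ^+ 2) <= F t * tint F 0 by near: t.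
(* Taking [eps = k] lets the margin of the bracket based at [a] absorb this error. *)
have h3 : F t * tint N 0 <= tint (back t) t + k * (t * F t ^+ 2).
  by near: t; exact: tint_back_ge.
have h4 : 0 <= k' * (t * F t ^+ 2) by rewrite !mulr_ge0 ?sqr_ge0// ltW.
move: h3; rewrite (_ : tint N 0 = tint F a + tint F 0); last by rewrite a_eq -m_eq subrK.
move: h1 h2 h4; rewrite mulrDr; set T := t * _.
move: (k * T) (k' * T) (rint _ _ _) (rint _ _ _) => ? ? ? ?.
move: (tint F t) (tint _ _) (F t * _) (F t * _) => *.
lra.
Unshelve. all: by end_near. Qed.

End drift_sign.

(** * The Blanchet-Glynn functions *)

Section walk_tails.
Context {R : realType} {d : measure_display} {T : measurableType d}.
Variables (P : probability T R) (X : {RV P >-> R}).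
Notation mu := (@lebesgue_measure R).

Let F := tail_prob P X.

(** P(X <= -s), with the non-strict inequality that makes it the exact complement of [F (- s)]. For
    s >= 0 it differs from the tail of [X^\-] by the mass of the point -s. *)
Definition left_tail (s : R) : R := 1 - tail_prob P X (- s).

Let N := left_tail.

Lemma measurable_gt_event t : measurable [set w | t < X w].
Proof.
have -> : [set w | t < X w] = X @^-1` `]t, +oo[%classic.
  by apply/seteqP; split=> w /=; rewrite in_itv/= andbT.
exact: measurable_funPTI.
Qed.

Lemma tail_probE t : (F t)%:E = P [set w | t < X w].
Proof.
by rewrite /F /tail_prob fineK// fin_num_measure//; exact: measurable_gt_event.
Qed.

Lemma tail_prob_ccdf t : (F t)%:E = ccdf X t.
Proof.
rewrite tail_probE /ccdf /distribution /pushforward; congr (P _).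
by apply/seteqP; split=> w /=; rewrite in_itv/= andbT.
Qed.

Lemma tail_prob_ge0 t : 0 <= F t.
Proof. by rewrite -lee_fin tail_probE measure_ge0. Qed.

Lemma tail_prob_le1 t : F t <= 1.
Proof. by rewrite -lee_fin tail_probE probability_le1//; exact: measurable_gt_event. Qed.

Lemma tail_prob_nonincreasing : nonincreasing_fun F.
Proof. by move=> s t st; rewrite -lee_fin !tail_prob_ccdf; exact: ccdf_nonincreasing. Qed.

Lemma left_tail_cdf s : (N s)%:E = cdf X (- s).
Proof.
by rewrite /N /left_tail EFinB tail_prob_ccdf cdf_1_ccdf.
Qed.

Lemma left_tail_ge0 s : 0 <= N s.
Proof. by rewrite subr_ge0 tail_prob_le1. Qed.

Lemma left_tail_nonincreasing : nonincreasing_fun N.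
Proof.
by move=> s t st; rewrite /N /left_tail lerD2l lerN2 tail_prob_nonincreasing// lerN2.
Qed.

Lemma tail_left_tail s : F (- s) + N s = 1.
Proof. by rewrite /N /left_tail addrC subrK. Qed.

Hypothesis X_unbounded : unbounded_right_support X.

Lemma tail_prob_gt0 t : 0 < F t.
Proof. by rewrite -lte_fin tail_probE X_unbounded. Qed.

Hypothesis X_int : P.-integrable setT (EFin \o X).

Let bF : locally_bounded F := locally_bounded_nonincreasing tail_prob_nonincreasing.
Let bN : locally_bounded N := locally_bounded_nonincreasing left_tail_nonincreasing.

Let integrable_tail_any (G : R -> R) : locally_bounded G ->
  mu.-integrable `[0, +oo[ (EFin \o G) ->
  forall b, mu.-integrable `[b, +oo[ (EFin \o G).
Proof.
move=> bG iG b.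
have [b0|b0] := leP 0 b; first exact: integrable_tail iG b0.
have mG : measurable_fun setT (fun x => `|(EFin \o G) x|%E).
  by apply: measurableT_comp => //; apply/measurable_EFinP; have [] := bG.
have E : `[b, +oo[%classic = `[b, 0[%classic `|` `[0, +oo[%classic.
  apply/seteqP; split=> x /=; rewrite !in_itv/= !andbT.
    by move=> bx; have [x0|x0] := ltP x 0; [left; rewrite bx|right].
  by move=> [/andP[]//|]; apply: le_trans; exact: ltW.
have i0 : mu.-integrable `[b, 0[ (EFin \o G).
  apply: integrableS (locally_bounded_integrable b 0 bG) => //.
  by move=> x /=; rewrite !in_itv/= => /andP[-> /ltW].
apply/integrableP; split.
  by apply/measurable_EFinP; apply: measurable_funTS; have [] := bG.
rewrite E ge0_integral_setU//.
- by apply: lte_add_pinfty; [case/integrableP : i0|case/integrableP : iG].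
- exact: measurable_funTS.
- apply/disj_set2P/seteqP; split=> x //= []; rewrite !in_itv/= andbT.
  by move=> /andP[_ x0]; rewrite leNgt x0.
Qed.

Let EXE : ('E_P[X] = \int[mu]_(r in `[0%R, +oo[) (F r)%:E -
  \int[mu]_(r in `[0%R, +oo[) (N r)%:E)%E.
Proof.
rewrite expectation_cdf_ccdf; last exact/Lfun1_integrable.
congr (_ - _)%E.
  by apply: eq_integral => x _; rewrite tail_prob_ccdf.
have N1 : (-1 : R) != 0 by rewrite oppr_eq0 oner_eq0.
have mN : measurable_fun setT N by have [] := bN.
rewrite -(ge0_integral_affine 0 N1 (measurable_itv _) mN left_tail_ge0).
rewrite normrN normr1 mul1e (_ : (fun x : R => _) @^-1` _ = `]-oo, 0]%classic).
  rewrite integral_itv_bndo_bndc//.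
    apply: eq_integral => x _; rewrite left_tail_cdf; congr (cdf X _).
    by rewrite addr0 mulN1r opprK.
  by apply: measurable_funTS; exact: cdf_measurable.
by apply/seteqP; split=> x /=; rewrite !in_itv/= addr0 mulN1r ?andbT oppr_ge0.
Qed.

(** A finite mean forces both halves to be finite: were one infinite, so would be the difference,
    [+oo - +oo] being [-oo] by convention. *)
Let tails_finite : ((\int[mu]_(r in `[0%R, +oo[) (F r)%:E < +oo) /\
  (\int[mu]_(r in `[0%R, +oo[) (N r)%:E < +oo))%E.
Proof.
have fi : ('E_P[X])%E \is a fin_num by rewrite unlock; exact: integrable_fin_num.
have f0 : (0 <= \int[mu]_(r in `[0%R, +oo[) (F r)%:E)%E.
  by apply: integral_ge0 => x _; rewrite lee_fin tail_prob_ge0.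
have n0 : (0 <= \int[mu]_(r in `[0%R, +oo[) (N r)%:E)%E.
  by apply: integral_ge0 => x _; rewrite lee_fin left_tail_ge0.
move: fi; rewrite EXE.
case: (integral _ _ _) f0 => [x| |] // _; last first.
  by case: (integral _ _ _) n0.
by case: (integral _ _ _) n0 => [y| |] // _ _; rewrite !ltry.
Qed.

Lemma integrable_tail_prob b : mu.-integrable `[b, +oo[ (EFin \o F).
Proof.
apply: integrable_tail_any => //; apply/integrableP; split.
  by apply/measurable_EFinP; apply: measurable_funTS; have [] := bF.
under eq_integral do rewrite /= ger0_norm ?tail_prob_ge0//.
by case: tails_finite.
Qed.

Lemma integrable_left_tail b : mu.-integrable `[b, +oo[ (EFin \o N).
Proof.
apply: integrable_tail_any => //; apply/integrableP; split.
  by apply/measurable_EFinP; apply: measurable_funTS; have [] := bN.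
under eq_integral do rewrite /= ger0_norm ?left_tail_ge0//.
by case: tails_finite.
Qed.

Hypothesis EX_lt0 : ('E_P[X] < 0)%E.

Let m := `|fine ('E_P[X])%E|.

Lemma mean_gt0 : 0 < m.
Proof.
rewrite normr_gt0 fine_eq0 ?lt_eqF//.
by rewrite unlock integrable_fin_num.
Qed.

Lemma mean_tails : tint N 0 - tint F 0 = m.
Proof.
have h0 : fine ('E_P[X])%E < 0.
  by rewrite -lte_fin fineK// unlock integrable_fin_num.
rewrite /m ltr0_norm// EXE fineB ?opprB//.
- by have := integrable_tail_prob 0; exact: integrable_fin_num.
- by have := integrable_left_tail 0; exact: integrable_fin_num.
Qed.

Let tint_split' (x y : R) : x <= y -> tint F x = rint F x y + tint F y.
Proof. by move=> xy; rewrite -tint_split//; exact: integrable_tail_prob. Qed.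

Let rint_bounds x y : x <= y -> F y * (y - x) <= rint F x y <= y - x.
Proof.
move=> xy; apply/andP; split.
  rewrite -rint_cst//; apply: le_rint => //; first exact: locally_bounded_cst.
  by move=> z /andP[_ zy]; exact: tail_prob_nonincreasing.
rewrite -[leRHS]mul1r -rint_cst//; apply: le_rint => //.
  exact: locally_bounded_cst.
by move=> z _; exact: tail_prob_le1.
Qed.

Let rint_pos x y : x <= y -> 0 <= rint F x y.
Proof. by move=> _; apply: rint_ge0 => z _; exact: tail_prob_ge0. Qed.

Lemma integrated_tail_decreasing x y : x < y -> tint F y < tint F x.
Proof.
move=> xy; rewrite (tint_split' (ltW xy)) ltrDr.
have /andP[h _] := rint_bounds (ltW xy).
by apply: lt_le_trans h; rewrite mulr_gt0 ?tail_prob_gt0// subr_gt0.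
Qed.

(** The root is where the minimum in [bg_v] switches: v(x) = 1 exactly for x >= -a. It may be
    negative. The integrated tail is 1-Lipschitz, hence continuous, and takes values on both sides
    of [m]. *)
Lemma integrated_tail_root : exists a, tint F a = m.
Proof.
have [b hb] : exists b, 0 <= b /\ tint F b <= m.
  apply: contrapT => no.
  have h b : 0 <= b -> m <= tint F b.
    by move=> b0; rewrite leNgt; apply/negP => /ltW hb; apply: no; exists b.
  have : tint F 0 <= tint F 0 - m.
    apply: tint_le_bound; first by have [] := bF.
    - by move=> x _; exact: tail_prob_ge0.
    - exact: integrable_tail_prob.
    - by move=> b b0; rewrite lerBrDr (tint_split' b0) lerD2l h.
  by rewrite lerBrDr gerDl leNgt mean_gt0.
(* On [[c, 0]] the tail is at least F 0, so a length of m / F 0 already yields an integral of at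
   least [m]. *)
pose c := - (m / F 0).
have F00 := tail_prob_gt0 0.
have c0 : c <= 0 by rewrite oppr_le0 divr_ge0 ?ltW ?mean_gt0.
have hc : m <= tint F c.
  rewrite (tint_split' c0); have /andP[h _] := rint_bounds c0.
  have t0 : 0 <= tint F 0 by apply: tint_ge0 => x _; exact: tail_prob_ge0.
  rewrite (le_trans _ (lerD h t0))// addr0 sub0r opprK mulrC divfK// gt_eqF//.
case: hb => b0 hb.
have cb : c <= b by exact: le_trans b0.
have cI : continuous (tint F).
  move=> x; apply/cvgrPdist_lt => e e0; near=> y.
  have xy : `|x - y| < e by near: y; exact: (@nbhsx_ballx R R x e e0).
  apply: le_lt_trans xy.
  have [h|/ltW h] := leP x y.
    have /andP[_ r1] := rint_bounds h.
    by rewrite (tint_split' h) addrK ler_norml (le_trans _ (rint_pos h))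
      ?oppr_le0// ler0_norm ?subr_le0// opprB.
  have /andP[_ r1] := rint_bounds h.
  rewrite (tint_split' h) opprD addrCA subrr addr0 normrN.
  by rewrite ger0_norm ?rint_pos// ger0_norm ?subr_ge0.
have [|r _ rm] := @IVT _ (tint F) c b m cb (continuous_subspaceT cI).
  by rewrite ge_min hb orbT le_max hc.
by exists r.
Unshelve. all: by end_near. Qed.

End walk_tails.

Section blanchet_glynn_weights.
Context {R : realType} {d : measure_display} {T : measurableType d}.
Variables (P : probability T R) (X : {RV P >-> R}).
Hypothesis X_int : P.-integrable setT (EFin \o X).
Hypothesis EX_lt0 : ('E_P[X] < 0)%E.
Hypothesis X_unbounded : unbounded_right_support X.

Let mvx x : measurable_fun setT (fun w => (bg_v X (x + X w))%:E).
Proof.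
apply/measurable_EFinP.
have mv : measurable_fun setT (bg_v X) by exact: measurable_bg_v.
apply: (measurableT_comp mv).
by apply: measurable_funD => //; exact: measurable_funPT.
Qed.

Let ge0v x w : (0 <= (bg_v X (x + X w))%:E)%E.
Proof. by rewrite lee_fin ltW// bg_v_gt0. Qed.

Let int_le1 x : (\int[P]_w (bg_v X (x + X w))%:E <= 1)%E.
Proof.
apply: (@le_trans _ _ (\int[P]_w 1)%E).
  by apply: ge0_le_integral => // w _; rewrite lee_fin bg_v_le1.
by rewrite integral_cst//= probability_setT mul1e.
Qed.

Lemma bg_wE x : (bg_w X x)%:E = (\int[P]_w (bg_v X (x + X w))%:E)%E.
Proof.
rewrite /bg_w unlock fineK// ge0_fin_numE; last exact: integral_ge0.
exact: (le_lt_trans (int_le1 x) (ltry 1)).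
Qed.

Lemma bg_w_le1 x : bg_w X x <= 1.
Proof. by rewrite -lee_fin bg_wE. Qed.

Lemma bg_w_nondecreasing : nondecreasing_fun (bg_w X).
Proof.
move=> x y xy; rewrite -lee_fin !bg_wE.
apply: ge0_le_integral => // w _.
by rewrite lee_fin bg_v_nondecreasing// lerD2r.
Qed.

End blanchet_glynn_weights.

Section blanchet_glynn_integrals.
Context {R : realType} {d : measure_display} {T : measurableType d}.
Variables (P : probability T R) (X : {RV P >-> R}) (alpha : R).
Notation mu := (@lebesgue_measure R).

Let F := tail_prob P X.
Let N := left_tail X.

Hypothesis X_int : P.-integrable setT (EFin \o X).
Hypothesis EX_lt0 : ('E_P[X] < 0)%E.
Hypothesis X_unbounded : unbounded_right_support X.
Hypothesis A3 : assumption_A3 X alpha.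

Let bF : locally_bounded F :=
  locally_bounded_nonincreasing (tail_prob_nonincreasing X).

Lemma density_singleton x : P [set w | X w = x] = 0%E.
Proof.
case: A3 => f [_ _ Xf _].
have -> : P [set w | X w = x] = distribution P X [set x] by [].
by rewrite Xf// integral_set1.
Qed.

Lemma tail_prob_density (f : R -> R) :
  (forall A : set R, measurable A ->
     distribution P X A = (\int[mu]_(x in A) (f x)%:E)%E) ->
  measurable_fun setT f ->
  forall r s, r <= s -> F r - F s = rint f r s.
Proof.
move=> Xf mf r s rs.
have mI : measurable (X @^-1` `]r, s]%classic) by exact: measurable_funPTI.
have : (F r)%:E = (P (X @^-1` `]r, s]%classic) + (F s)%:E)%E.
  rewrite !tail_probE -measureU//.
  - congr (P _); apply/seteqP; split=> w /=; rewrite in_itv/=.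
      by move=> rX; have [?|?] := leP (X w) s; [left; rewrite rX|right].
    by move=> [/andP[]//|]; exact: le_lt_trans.
  - exact: measurable_gt_event.
  - apply/seteqP; split=> w //= []; rewrite in_itv/= => /andP[_].
    by rewrite leNgt => /negP.
have -> : P (X @^-1` `]r, s]%classic) = (\int[mu]_(x in `]r, s]) (f x)%:E)%E.
  by rewrite -Xf.
rewrite integral_itv_obnd_cbnd; last first.
  by apply/measurable_EFinP; exact: measurable_funTS.
rewrite /rint /Rintegral.
case: (integral _ _ _) => [x| |]//= [->].
by rewrite addrK.
Qed.

Lemma tail_prob_lipschitz : 0 < alpha -> assumption_A1 X alpha ->
  exists2 C : R, 0 <= C & \forall t \near +oo, forall r s,
    t / 2 <= r <= s /\ s <= 2 * t -> F r - F s <= C * (s - r) * (F t / t).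
Proof.
move=> a0 A1; case: A3 => f [cf f0 Xf rvf].
apply: (@density_tail_lipschitz R F f alpha) => //.
- exact: tail_prob_nonincreasing.
- exact: tail_prob_gt0.
- by apply: tail_prob_density => //; exact: continuous_measurable_fun.
Qed.

(** Since h t <= t eventually, the integral from [h t] controls the one from [t]. The strict and
    non-strict left tails agree because the density excludes atoms. *)
Lemma tint_left_tail_littleo : assumption_A2 X -> forall eps, 0 < eps ->
  \forall t \near +oo, tint N t <= eps * (t * F t).
Proof.
move=> [h [hoo ho hA2]] eps eps0; near=> t.
have t0 : 0 < t by near: t; exact: nbhs_pinfty_gt.
have h0 : 0 <= h t by near: t; move/cvgryPge : hoo; exact.
have ht : `|h t| <= 1 * `|t| by near: t; exact: ho.
rewrite mul1r !ger0_norm ?(ltW t0)// in ht.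
have iN := integrable_left_tail X_int.
have N0 := left_tail_ge0 X.
apply: (@le_trans _ _ (tint N (h t))).
  by rewrite (@tint_split _ N (h t) t)// lerDr rint_ge0.
have hE : tint N (h t) =
    \int[mu]_(s in `[h t, +oo[) tail_prob P (X^\-) s.
  apply: eq_Rintegral => s; rewrite inE/= in_itv/= andbT => hs.
  apply: EFin_inj; rewrite left_tail_cdf.
  have -> : (tail_prob P (X^\-) s)%:E = P [set w | s < (X^\-) w].
    exact: (tail_probE (X^\- : {RV P >-> R})).
  have -> : cdf X (- s) = P ([set w | X w < - s] `|` [set w | X w = - s]).
    rewrite /cdf /distribution /pushforward; congr (P _).
    apply/seteqP; split=> w /=; rewrite in_itv/= le_eqVlt.
      by move=> /orP[/eqP|]; [right|left].
    by move=> [->|->]; rewrite ?eqxx ?orbT.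
  have E1 : [set w | s < (X^\-) w] = [set w | X w < - s].
    apply/seteqP; split=> w /=; rewrite /funrneg lt_max ltrNr.
      by move=> /orP[//|]; rewrite ltNge (le_trans h0).
    by move=> ->.
  rewrite -E1 measureU.
  - by rewrite [X in (_ + X)%E](density_singleton (- s)) adde0.
  - exact: (measurable_gt_event (X^\- : {RV P >-> R})).
  - have -> : [set w | X w = - s] = X @^-1` [set - s] by [].
    exact: measurable_funPTI.
  - by rewrite E1; apply/seteqP; split=> w //= [] /[swap] ->; rewrite ltxx.
have : `|\int[mu]_(s in `[h t, +oo[) tail_prob P (X^\-) s| <=
    eps * `|t * tail_prob P (X^\+) t| by near: t; exact: hA2.
rewrite -hE => hle; apply: (le_trans (ler_norm _)); apply: (le_trans hle).
rewrite ler_pM2l// (_ : tail_prob P (X^\+) t = F t).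
  by rewrite ger0_norm// mulr_ge0 ?(ltW t0)// tail_prob_ge0.
rewrite /F /tail_prob; congr (fine (P _)).
apply/seteqP; split=> w /=; rewrite /funrpos lt_max.
  by move=> /orP[//|]; rewrite ltNge ltW.
by move=> ->.
Unshelve. all: by end_near. Qed.

Variable a : R.
Hypothesis a_eq : tint F a = `|fine ('E_P[X])%E|.
Let m := `|fine ('E_P[X])%E|.

Let m0 : 0 < m. Proof. exact: mean_gt0. Qed.

(** [tint F] decreases and equals [m] at [a], so the minimum with 1 amounts to truncating the lower
    limit at [a]. *)
Lemma bg_v_tint x : m * bg_v X x = tint F (Num.max a (- x)).
Proof.
have -> : bg_v X x = Num.min 1 (m^-1 * tint F (- x)) by [].
have I_le x' y : x' <= y -> tint F y <= tint F x'.
  rewrite le_eqVlt => /predU1P[->//|xy].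
  exact/ltW/(integrated_tail_decreasing X_unbounded).
have [ax|xa] := leP a (- x).
  rewrite min_r ?mulVKf ?gt_eqF//.
  by rewrite mulrC ler_pdivrMr// mul1r /m -a_eq I_le.
rewrite min_l ?mulr1//.
by rewrite mulrC ler_pdivlMr// mul1r /m -a_eq I_le// ltW.
Qed.

(* Tonelli's theorem applied to [m v (- t + X) = \int_(u >= a) F u 1_(u > t - X)]. *)
Lemma bg_w_tint t : m * bg_w X (- t) = tint (fun u => F u * F (t - u)) a.
Proof.
pose A : set (T * R) := [set p | a <= p.2].
pose B : set (T * R) := [set p | t - X p.1 < p.2].
have mA : measurable A.
  have -> : A = setT `*` `[a, +oo[%classic.
    by apply/seteqP; split=> p /=; rewrite /A/= in_itv/= andbT => // -[].
  exact: measurableX.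
have mXp : measurable_fun setT (fun p : T * R => p.2 - (t - X p.1)).
  apply: measurable_funB; first exact: measurable_snd.
  apply: measurable_funB => //.
  by apply: (measurableT_comp (measurable_funPT X)); exact: measurable_fst.
have mB : measurable B.
  have -> : B = (fun p : T * R => p.2 - (t - X p.1)) @^-1` `]0, +oo[%classic.
    by apply/seteqP; split=> p /=; rewrite /B/= in_itv/= andbT subr_gt0.
  by rewrite -[X in measurable X]setTI; exact: mXp.
pose G (p : T * R) : \bar R := (F p.2 * \1_(A `&` B) p)%:E.
have mG : measurable_fun setT G.
  apply/measurable_EFinP; apply: measurable_funM.
    by apply: (measurableT_comp bF.1); exact: measurable_snd.
  exact/measurable_indic/measurableI.
have G0 p : (0 <= G p)%E by rewrite lee_fin mulr_ge0// tail_prob_ge0.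
have mF : measurable_fun setT F by have [] := bF.
have mF' (D : set R) : measurable_fun D (EFin \o F).
  by apply/measurable_EFinP; exact: measurable_funTS.
have vE w : (\int[mu]_u G (w, u) = (m * bg_v X (- t + X w))%:E)%E.
  rewrite bg_v_tint opprD opprK.
  transitivity (\int[mu]_(u in [set u : R | (a <= u)%R /\ (t - X w < u)%R]) (F u)%:E)%E.
    rewrite [RHS]integral_mkcond; apply: eq_integral => u _.
    rewrite /G patchE; case: ifPn => h.
      by rewrite indicE mem_set ?mulr1//; move: h; rewrite inE.
    rewrite indicE memNset ?mulr0//; apply: contraNnot h => h.
    by rewrite inE.
  have [h|h] := leP a (t - X w).
    have -> : [set u | a <= u /\ t - X w < u] = `]t - X w, +oo[%classic.
      apply/seteqP; split=> u /=; rewrite in_itv/= andbT; first by case.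
      by move=> tu; split => //; rewrite (le_trans h)// ltW.
    rewrite integral_itv_obnd_cbnd// /tint /Rintegral fineK//.
    exact: (integrable_fin_num _ (integrable_tail_prob X_int _)).
  have -> : [set u | a <= u /\ t - X w < u] = `[a, +oo[%classic.
    apply/seteqP; split=> u /=; rewrite in_itv/= andbT; first by case.
    by move=> au; split => //; rewrite (lt_le_trans h).
  rewrite /tint /Rintegral fineK//.
  exact: (integrable_fin_num _ (integrable_tail_prob X_int _)).
have wE u : (\int[P]_w G (w, u) =
    (((fun u => (F u * F (t - u))%R) \_ `[a, +oo[) u)%:E)%E.
  have mE : measurable [set w | (t - u < X w)%R] by exact: measurable_gt_event.
  rewrite patchE; case: ifPn => h.
    rewrite EFinM.
    have -> : (F (t - u))%:E =
        (\int[P]_w (\1_[set w | (t - u < X w)%R] w)%:E)%E :> \bar R.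
      by rewrite integral_indic// setIT; exact: tail_probE.
    rewrite -ge0_integralZl//=; last 2 first.
    - by apply/measurable_EFinP/measurable_indic.
    - by rewrite lee_fin tail_prob_ge0.
    apply: eq_integral => w _; rewrite /G -EFinM; congr (_ * _)%:E.
    rewrite !indicE; congr (nat_of_bool _)%:R; apply/idP/idP; rewrite !inE.
      by move=> [_]; rewrite /B/= ltrBlDr addrC -ltrBlDr.
    move: h; rewrite inE/= in_itv/= andbT => au tX; split=> //.
    by rewrite /B/= ltrBlDr addrC -ltrBlDr.
  rewrite integral0_eq// => w _; rewrite /G indicE memNset ?mulr0//.
  by move=> [au _]; move/negP : h; apply; rewrite inE/= in_itv/= andbT.
have mv : measurable_fun setT (bg_v X) by exact: measurable_bg_v.
have bE : (m * bg_w X (- t))%:E = (\int[P]_w \int[mu]_u G (w, u))%E.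
  under [RHS]eq_integral do rewrite vE EFinM.
  rewrite ge0_integralZl//=; last 3 first.
  - apply/measurable_EFinP; apply: (measurableT_comp mv).
    by apply: measurable_funD => //; exact: measurable_funPT.
  - by move=> w _; rewrite lee_fin ltW// bg_v_gt0.
  - by rewrite lee_fin ltW.
  by rewrite EFinM bg_wE.
rewrite -[LHS]/(fine (m * bg_w X (- t))%:E) bE (@fubini_tonelli _ _ _ _ _ P mu G mG G0).
under eq_integral do rewrite wE.
by rewrite /tint Rintegral_mkcond.
Qed.

End blanchet_glynn_integrals.

Section blanchet_glynn_drift.
Context {R : realType} {d : measure_display} {T : measurableType d}.
Variables (P : probability T R) (X : {RV P >-> R}) (alpha : R).
Hypothesis X_int : P.-integrable setT (EFin \o X).
Hypothesis EX_lt0 : ('E_P[X] < 0)%E.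
Hypothesis X_unbounded : unbounded_right_support X.
Hypothesis A1 : assumption_A1 X alpha.
Hypothesis A2 : assumption_A2 X.
Hypothesis A3 : assumption_A3 X alpha.

Let F := tail_prob P X.

Lemma bg_v_eventually_lt1 : exists x0 : R, forall x, x <= x0 -> bg_v X x < 1.
Proof.
have [a aE] := integrated_tail_root X_unbounded X_int EX_lt0.
have m0 := mean_gt0 X_int EX_lt0.
exists (- (a + 1)) => x xa.
rewrite -(ltr_pM2l m0) mulr1 (bg_v_tint X_int EX_lt0 X_unbounded aE) -aE.
apply: (integrated_tail_decreasing X_unbounded) => //.
by rewrite lt_max; apply/orP; right; lra.
Qed.

Lemma bg_v_eventually1 : exists x1 : R, forall x, x1 <= x -> bg_v X x = 1.
Proof.
have [a aE] := integrated_tail_root X_unbounded X_int EX_lt0.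
have m0 := mean_gt0 X_int EX_lt0.
exists (- a) => x ax; apply: (mulfI (lt0r_neq0 m0)).
by rewrite mulr1 (bg_v_tint X_int EX_lt0 X_unbounded aE) max_l// lerNl.
Qed.

Lemma bg_superharmonic : 1 < alpha < 3 / 2 ->
  exists x0 : R, forall x, x <= x0 -> bg_w X x <= bg_v X x.
Proof.
move=> /andP[a1 a32].
have [a aE] := integrated_tail_root X_unbounded X_int EX_lt0.
have m0 := mean_gt0 X_int EX_lt0.
have alpha12 : 1 < alpha < 2 by rewrite a1; lra.
have [//|t0 [_ ht0]] := @tail_convolution_superharmonic R F (left_tail X) alpha
  _ a (tail_prob_nonincreasing X) (left_tail_nonincreasing X)
  (tail_prob_gt0 X_unbounded) (left_tail_ge0 X) (tail_left_tail X) A1 alpha12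
  (integrable_tail_prob X_int) (integrable_left_tail X_int)
  (tail_prob_lipschitz X_unbounded A3 (lt_trans ltr01 a1) A1)
  (mean_tails X_int EX_lt0) aE (tint_left_tail_littleo X_int A3 A2).
exists (- (Num.max t0 a + 1)) => x xa.
have [xt0 xa'] : t0 < - x /\ a <= - x.
  have : t0 <= Num.max t0 a by rewrite le_max lexx.
  have : a <= Num.max t0 a by rewrite le_max lexx orbT.
  by move=> ? ?; split; lra.
rewrite -(ler_pM2l m0) -[in bg_w X x](opprK x) (bg_w_tint X_int EX_lt0 X_unbounded aE).
by rewrite (bg_v_tint X_int EX_lt0 X_unbounded aE) max_r// ht0.
Qed.

Lemma bg_strictly_subharmonic : 3 / 2 < alpha < 2 ->
  exists x0 : R, forall l u, u <= x0 -> exists2 th : R, 0 <= th < 1 &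
    forall x, l <= x <= u -> bg_v X x <= th * bg_w X x.
Proof.
move=> /andP[a32 a2].
have [a aE] := integrated_tail_root X_unbounded X_int EX_lt0.
have m0 := mean_gt0 X_int EX_lt0.
have alpha12 : 1 < alpha < 2 by rewrite a2 andbT; lra.
have a0 : 0 < alpha by lra.
have [//|k k0 [t0 [_ ht0]]] := @tail_convolution_superharmonic_fails R F
  (left_tail X) alpha _ a (tail_prob_nonincreasing X)
  (left_tail_nonincreasing X)
  (tail_prob_gt0 X_unbounded) (left_tail_ge0 X) (tail_left_tail X) A1 alpha12
  (integrable_tail_prob X_int) (integrable_left_tail X_int)
  (tail_prob_lipschitz X_unbounded A3 a0 A1)
  (mean_tails X_int EX_lt0) aE.
exists (- (Num.max 1 (Num.max t0 a) + 1)) => l u ux0.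
have F0 := tail_prob_gt0 X_unbounded.
set m := `|fine ('E_P[X])%E| in m0.
(* For 1 <= -x <= -l the margin k (-x) F(-x)^2 / m is at least k F(-l)^2 / m. The cap at 1 keeps 1 -
   del nonnegative; as w <= 1, the additive margin implies the multiplicative one. *)
pose del := Num.min 1 (k * F (- l) ^+ 2 / m).
have del0 : 0 < del by rewrite lt_min ltr01 divr_gt0// mulr_gt0// exprn_gt0.
have del1 : del <= 1 by rewrite ge_min lexx.
exists (1 - del); first by rewrite subr_ge0 del1 gtrBl.
move=> x /andP[lx xu].
have [x1 xt0 xa] : [/\ 1 <= - x, t0 < - x & a <= - x].
  have : t0 <= Num.max 1 (Num.max t0 a) by rewrite !le_max lexx orbT.
  have : a <= Num.max 1 (Num.max t0 a) by rewrite !le_max lexx !orbT.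
  have : 1 <= Num.max 1 (Num.max t0 a) by rewrite le_max lexx.
  by move=> ? ? ?; split; lra.
have h1 : bg_v X x + del <= bg_w X x.
  rewrite -(ler_pM2l m0) mulrDr -[in bg_w X x](opprK x).
  rewrite (bg_w_tint X_int EX_lt0 X_unbounded aE).
  rewrite (bg_v_tint X_int EX_lt0 X_unbounded aE) max_r//.
  apply: le_trans (ht0 _ xt0); rewrite lerD2l.
  apply: (@le_trans _ _ (k * F (- l) ^+ 2)).
    by rewrite mulrC -ler_pdivlMr// ge_min lexx orbT.
  rewrite ler_pM2l// -[leLHS]mul1r; apply: ler_pM => //; first exact: sqr_ge0.
  rewrite lerXn2r ?nnegrE ?(ltW (F0 _))//.
  by apply: tail_prob_nonincreasing; rewrite lerN2.
have w1 : bg_w X x <= 1 by exact: bg_w_le1.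
have : del * bg_w X x <= del by rewrite ler_piMr// ltW.
lra.
Qed.

End blanchet_glynn_drift.

(** * Laws on path space *)

Section density_measure.
Context {d : measure_display} {Y : measurableType d} {R : realType}.
Variables (mu : {measure set Y -> \bar R}) (D : Y -> R).
Hypotheses (D0 : forall y, 0 <= D y) (mD : measurable_fun setT D).

(* The proofs are (unused) arguments so that the measure structure below can be
   inferred. *)
Definition weighted_measure & (forall y, 0 <= D y) & measurable_fun setT D :
  set Y -> \bar R := fun A => (\int[mu]_(y in A) (D y)%:E)%E.

Let nu := weighted_measure D0 mD.

Let nu0 : nu set0 = 0%E.
Proof. by rewrite /nu /weighted_measure integral_set0. Qed.

Let nu_ge0 A : (0 <= nu A)%E.
Proof. by apply: integral_ge0 => y _; rewrite lee_fin. Qed.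

Let nu_sigma_additive : semi_sigma_additive nu.
Proof.
move=> /= A mA tA mUA; rewrite /nu /weighted_measure; apply: cvg_toP.
  apply: ereal_nondecreasing_is_cvgn => m n mn.
  apply: lee_sum_nneg_natr => // k _ _.
  by apply: integral_ge0 => y _; rewrite lee_fin.
rewrite ge0_integral_bigcup//=.
- by apply/measurable_EFinP; exact: measurable_funTS.
- by move=> y _; rewrite lee_fin.
Qed.

HB.instance Definition _ := isMeasure.Build _ _ _ (weighted_measure D0 mD)
  nu0 nu_ge0 nu_sigma_additive.

Import HBNNSimple.

(** Integration against a measure with density, from indicators to simple functions to monotone
    limits. *)
Lemma ge0_integral_weighted (g : Y -> \bar R) : measurable_fun setT g ->
  (forall y, (0 <= g y)%E) ->
  (\int[nu]_y g y = \int[mu]_y (g y * (D y)%:E))%E.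
Proof.
move=> mg g0.
pose h := nnsfun_approx measurableT mg.
have hlim y : (EFin \o h n) y @[n --> \oo] --> g y.
  by apply: cvg_nnsfun_approx.
have hnd y : {homo (fun n => (h n y)%:E) : n m / (n <= m)%N >-> (n <= m)%E}.
  by move=> n m nm; rewrite lee_fin; exact/lefP/nd_nnsfun_approx.
have mDE : measurable_fun setT (fun y => (D y)%:E) by exact/measurable_EFinP.
have -> : (\int[nu]_y g y = lim (\int[nu]_y (EFin \o h n) y @[n --> \oo]))%E.
  rewrite -monotone_convergence//.
  - by apply: eq_integral => y _; apply/esym/cvg_lim => //; exact: hlim.
  - by move=> n; apply/measurable_EFinP.
  - by move=> n y _; rewrite lee_fin.
  - by move=> y _; exact: hnd.
have -> : (\int[mu]_y (g y * (D y)%:E) =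
    lim (\int[mu]_y ((EFin \o h n) y * (D y)%:E) @[n --> \oo]))%E.
  rewrite -monotone_convergence//.
  - apply: eq_integral => y _; apply/esym/cvg_lim => //.
    by apply: cvgeZr => //; exact: hlim.
  - by move=> n; apply: emeasurable_funM => //; exact/measurable_EFinP.
  - by move=> n y _; rewrite mule_ge0// lee_fin.
  - by move=> y _ n m nm; rewrite lee_wpmul2r ?lee_fin//; exact: hnd.
congr (lim (_ @ \oo)); apply/funext => n.
have mpre r : measurable (h n @^-1` [set r]) by [].
transitivity (\int[nu]_y (\sum_(r \in range (h n))
    (r * \1_(h n @^-1` [set r]) y)%:E))%E.
  by apply: eq_integral => y _; rewrite /= fimfunE -fsumEFin.
rewrite ge0_integral_fsum//; last 2 first.
- by move=> r; apply/measurable_EFinP; apply: measurable_funM => //.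
- by move=> r y _; exact: nnfun_muleindic_ge0.
transitivity (\int[mu]_y (\sum_(r \in range (h n))
    ((r * \1_(h n @^-1` [set r]) y)%:E * (D y)%:E)))%E; last first.
  apply: eq_integral => y _; rewrite -ge0_mule_fsuml.
    by rewrite fsumEFin//= -(fimfunE (h n) y).
  by move=> r; exact: nnfun_muleindic_ge0.
rewrite ge0_integral_fsum//; last 2 first.
- move=> r; apply: emeasurable_funM => //.
  by apply/measurable_EFinP; apply: measurable_funM.
- by move=> r y _; rewrite mule_ge0 ?lee_fin//; exact: nnfun_muleindic_ge0.
apply: eq_fsbigr => r; rewrite inE => -[y _ yr].
have r0 : 0 <= r by rewrite -yr.
under eq_integral do rewrite EFinM.
rewrite ge0_integralZl//; last exact/measurable_EFinP/measurable_indic.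
rewrite integral_indic// setIT.
under [RHS]eq_integral do rewrite EFinM -muleA.
rewrite ge0_integralZl//; last 2 first.
- by apply: emeasurable_funM => //; exact/measurable_EFinP.
- by move=> z _; rewrite mule_ge0 ?lee_fin.
congr (_ * _)%E.
transitivity (\int[mu]_(z in h n @^-1` [set r]) (D z)%:E)%E; first by [].
rewrite integral_mkcond; apply: eq_integral => z _; rewrite patchE indicE.
by case: ifPn => _; rewrite ?mul1e ?mul0e.
Qed.

End density_measure.

Section coordinate_paths.
Variable R : realType.

(* Paths with the sigma-algebra of their first [n] coordinates: the measurable sets
   of [cpath n.+1] are the events of [natural_filtration n]. *)
Definition cpath (n : nat) : Type :=
  g_sigma_algebraType (\bigcup_(k in `I_n) @coordinate_events R k).

HB.instance Definition _ n := Measurable.on (cpath n).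

Lemma measurable_coordinate n k : (k < n)%N ->
  measurable_fun setT (fun s : cpath n => (s k : R)).
Proof.
move=> kn _ A mA; apply: sub_sigma_algebra; exists k => //.
by exists A.
Qed.

Lemma measurable_cpath d (Y : measurableType d) n (f : Y -> cpath n) :
  (forall k, (k < n)%N -> measurable_fun setT (fun y => (f y k : R))) ->
  measurable_fun setT f.
Proof.
move=> mf; apply: measurability => //.
move=> _ [_ [k kn [A mA <-]] <-].
rewrite !setTI; have := mf k kn measurableT A mA.
by rewrite setTI.
Qed.

Lemma measurable_path_space d (Y : measurableType d) (f : Y -> path_space R) :
  (forall k, measurable_fun setT (fun y => (f y k : R))) -> measurable_fun setT f.
Proof.
move=> mf; apply: measurability => //.
move=> _ [_ [k kn [A mA <-]] <-].
rewrite !setTI; have := mf k measurableT A mA.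
by rewrite setTI.
Qed.

Lemma natural_filtration_sub m n (A : set (path_space R)) : (m <= n)%N ->
  natural_filtration m A -> natural_filtration n A.
Proof.
move=> mn; apply: sub_smallest2r; first exact: smallest_sigma_algebra.
by move=> B [k /= km hB]; exists k => //=; exact: leq_trans km _.
Qed.

Lemma natural_filtration_measurable n (A : set (path_space R)) :
  natural_filtration n A -> measurable A.
Proof.
apply: sub_smallest2r; first exact: smallest_sigma_algebra.
by move=> B [k _ hB]; exists k.
Qed.

Lemma natural_filtration_coordinate n k (B : set R) : (k <= n)%N ->
  measurable B -> natural_filtration n [set s : path_space R | B (s k)].
Proof.
move=> kn mB; have := @measurable_coordinate n.+1 k kn measurableT B mB.
by rewrite setTI.
Qed.

(** The sets with this property form a sigma-algebra containing the generators. At n = 0, membership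
    in an event depends on the starting point alone. *)
Lemma natural_filtration_agree n (A : set (path_space R)) :
  natural_filtration n A -> forall s s' : nat -> R,
  (forall k, (k <= n)%N -> s k = s' k) -> A s -> A s'.
Proof.
pose inv : set (set (path_space R)) := [set A | forall s s' : nat -> R,
  (forall k, (k <= n)%N -> s k = s' k) -> A s -> A s'].
move=> nA; suff : inv A by [].
apply: nA; split.
  split.
  - by move=> s s' _.
  - move=> B hB s s' ss' [_ Bs]; split => // Bs'; apply: Bs.
    by apply: hB Bs' => k kn; rewrite ss'.
  - move=> B hB s s' ss' [i _ Bs]; exists i => //.
    exact: hB ss' Bs.
move=> _ [k /= kn [B mB <-]] s s' ss' [_ Bs]; split => //=.
by rewrite -ss'.
Qed.

End coordinate_paths.

Section walk_independence.
Context {R : realType} {d : measure_display} {T : measurableType d}.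
Variables (P : probability T R) (X : {RV P >-> R}) (Xs : nat -> {RV P >-> R}).
Hypothesis iid : iid_copies X Xs.

Let increments (n : nat) (w : T) : cpath R n := fun i => Xs i w.

Let partial_sums n (x : cpath R n) : cpath R n.+1 := fun k => \sum_(i < k) x i.

Let measurable_increments n : measurable_fun setT (increments n).
Proof. by apply: measurable_cpath => k _; exact: measurable_funPT. Qed.

Let measurable_partial_sums n : measurable_fun setT (@partial_sums n).
Proof.
apply: measurable_cpath => k kn.
apply: measurable_sum => i; apply: measurable_coordinate.
by apply: leq_trans (ltn_ord i) _.
Qed.

Lemma measurable_walk_cpath n :
  measurable_fun setT (fun w => walk_path Xs w : cpath R n).
Proof.
apply: measurable_cpath => k _.
by apply: measurable_sum => i; exact: measurable_funPT.
Qed.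

Lemma measurable_walk_path :
  measurable_fun setT (fun w => walk_path Xs w : path_space R).
Proof.
apply: measurable_path_space => k.
by apply: measurable_sum => i; exact: measurable_funPT.
Qed.

Lemma walk_path0 w : walk_path Xs w 0%N = 0.
Proof. by rewrite /walk_path big_ord0. Qed.

Lemma walk_pathS n w : walk_path Xs w n.+1 = walk_path Xs w n + Xs n w.
Proof. by rewrite /walk_path big_ord_recr. Qed.

Let prod_law n (A : nat -> set R) : (forall i, measurable (A i)) ->
  P (\bigcap_(i in `I_n) Xs i @^-1` A i) = (\prod_(i < n) P (Xs i @^-1` A i))%E.
Proof.
move=> mA; have [_ ind] := iid.
have := ind [fset i | i in iota 0 n]%fset A mA.
have -> : [set` [fset i | i in iota 0 n]%fset] = `I_n.
  by apply/seteqP; split=> i /=; rewrite in_fset /= mem_iota add0n.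
move=> ->; rewrite -(big_mkord xpredT (fun i => P (Xs i @^-1` A i))).
apply: perm_big; rewrite /index_iota subn0; apply: uniq_perm.
- exact: fset_uniq.
- exact: iota_uniq.
- by move=> i; rewrite in_fset.
Qed.

(** Independence is given on cylinders of increments. These form a pi-system generating the
    sigma-algebra of the first [n] increments, so the two finite measures agreeing on it coincide;
    [partial_sums] turns an event on the path into one on the increments. *)
Lemma walk_step_independent n (A : set (path_space R)) (B : set R) :
  natural_filtration n A -> measurable B ->
  P (walk_path Xs @^-1` A `&` Xs n @^-1` B) =
  (P (walk_path Xs @^-1` A) * P (Xs n @^-1` B))%E.
Proof.
move=> nA mB.
have mA' : measurable (@partial_sums n @^-1` A).
  by rewrite -[X in measurable X]setTI; exact: measurable_partial_sums.
have mXB : measurable (Xs n @^-1` B) by exact: measurable_funPTI.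
pose G : set (set (cpath R n)) := [set C | exists2 D : nat -> set R,
  forall i, measurable (D i) & C = \bigcap_(i in `I_n) [set x | D i (x i)]].
have mincr C : measurable C -> measurable (increments n @^-1` C).
  by move=> mC; rewrite -[X in measurable X]setTI; exact: measurable_increments.
have GI : setI_closed G.
  move=> _ _ [D mD ->] [E mE ->]; exists (fun i => D i `&` E i).
    by move=> i; exact: measurableI.
  apply/seteqP; split=> x /=.
    by move=> [h1 h2] i iN; split; [exact: h1|exact: h2].
  by move=> h; split=> i iN; have [] := h i iN.
have GT : G setT.
  by exists (fun=> setT) => //; apply/seteqP; split=> x.
have G_measurable : G `<=` measurable.
  move=> _ [D mD ->]; apply: bigcap_measurableType => i iN.
  by rewrite -[X in measurable X]setTI; exact: measurable_coordinate.
pose p := fine (P (Xs n @^-1` B)).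
have pE : p%:E = P (Xs n @^-1` B) by rewrite /p fineK// fin_num_measure.
have p0 : 0 <= p by rewrite -lee_fin pE.
pose nu0 : {measure set (cpath R n) -> \bar R} :=
  pushforward (mrestr P mXB) (increments n).
pose nu := nu0 (@measurable_increments n).
pose nu0' : {measure set (cpath R n) -> \bar R} :=
  mscale (NngNum p0) (pushforward P (increments n)).
pose nu' := nu0' (@measurable_increments n).
have sG : measurable `<=` <<s G >>.
  apply: smallest_sub; first exact: smallest_sigma_algebra.
  move=> _ [k /= kn [D mD <-]]; apply: sub_sigma_algebra.
  exists (fun i => if i == k then D else setT); first by move=> i; case: ifP.
  rewrite setTI; apply/seteqP; split=> x /=.
    by move=> Dx i _; case: eqP => [->|].
  by move=> /(_ k kn); rewrite eqxx.
have nuE C : nu C = P (increments n @^-1` C `&` Xs n @^-1` B) by [].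
have nu'E C : nu' C = (P (increments n @^-1` C) * P (Xs n @^-1` B))%E.
  by rewrite muleC -pE.
rewrite -[LHS](nuE (@partial_sums n @^-1` A)).
rewrite -[RHS](nu'E (@partial_sums n @^-1` A)).
apply: (@g_sigma_algebra_measure_unique _ _ (cpath R n) G G_measurable
  (fun=> setT) (fun=> GT) _ nu nu' GI _ _ _ (sG _ mA')).
- by rewrite bigcup_const//; exists 0%N.
- move=> _ [D mD ->]; rewrite nuE nu'E.
  pose D' i := if i == n then B else D i.
  have mD' i : measurable (D' i) by rewrite /D'; case: ifP.
  have E1 : increments n @^-1` (\bigcap_(i in `I_n) [set x | D i (x i)]) =
      \bigcap_(i in `I_n) Xs i @^-1` D i by apply/seteqP; split=> w.
  have E2 : \bigcap_(i in `I_n) Xs i @^-1` D i `&` Xs n @^-1` B =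
      \bigcap_(i in `I_n.+1) Xs i @^-1` D' i.
    apply/seteqP; split=> w /=.
      move=> [h hB] i /=; rewrite ltnS leq_eqVlt /D' => /predU1P[->|iN].
        by rewrite eqxx.
      by rewrite (ltn_eqF iN); exact: h.
    move=> h; split; last by have := h n (ltnSn n); rewrite /D' /= eqxx.
    move=> i /= iN; have := h i (leqW iN).
    by rewrite /D' /= (ltn_eqF iN).
  rewrite E1 E2 !prod_law// big_ord_recr/= /D' eqxx; congr (_ * _)%E.
  by apply: eq_bigr => i _; rewrite (ltn_eqF (ltn_ord i)).
- move=> _; rewrite nuE preimage_setT setTI.
  by apply: (@le_lt_trans _ _ 1%E); rewrite ?probability_le1// ltry.
Qed.

End walk_independence.

(** * Density of the proposal over finitely many steps *)

Section path_density.
Context {R : realType} {d : measure_display} {T : measurableType d}.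
Variables (P : probability T R) (X : {RV P >-> R}) (Xs : nat -> {RV P >-> R}).
Hypothesis iid : iid_copies X Xs.

Let walkn n : {mfun T >-> cpath R n} :=
  HB.pack (fun w => walk_path Xs w : cpath R n)
    (isMeasurableFun.Build _ _ _ _ _ (measurable_walk_cpath Xs (n:=n))).

Let stepn n : {mfun T >-> (cpath R n.+1 * R)%type} :=
  HB.pack (fun w => (walkn n.+1 w, Xs n w))
    (isMeasurableFun.Build _ _ _ _ _
      (measurable_fun_pair (measurable_funPT (walkn n.+1)) (measurable_funPT (Xs n)))).

(** The path up to time [n] and the next increment have the product law, by uniqueness of the
    product measure; Tonelli's theorem then integrates the increment out. *)
Lemma integral_walk_step n (f : cpath R n.+1 * R -> \bar R) :
  measurable_fun setT f -> (forall p, (0 <= f p)%E) ->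
  (\int[P]_w f (walk_path Xs w, Xs n w) =
   \int[P]_w \int[P]_w' f (walk_path Xs w, X w'))%E.
Proof.
move=> mf f0.
transitivity (\int[distribution P (stepn n)]_p f p)%E.
  by rewrite ge0_integral_distribution.
transitivity (\int[(distribution P (walkn n.+1) \x distribution P X)%E]_p f p)%E.
  apply: eq_measure_integral => C mC _.
  apply/esym; apply: product_measure_unique => // A B mA mB.
  rewrite /distribution /pushforward.
  rewrite [LHS](walk_step_independent iid mA mB); congr (_ * _)%E.
  by have [h _] := iid; exact: h.
rewrite fubini_tonelli1// ge0_integral_distribution//.
- apply: eq_integral => w _ /=.
  rewrite /fubini_F ge0_integral_distribution//.
  exact: measurable_fun_pair2.
- exact: measurable_fun_fubini_tonelli_F.
- by move=> s; apply: integral_ge0.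
Qed.

Variables (v w : R -> R).
Hypotheses (mv : measurable_fun setT v)
  (minv : measurable_fun setT (fun x => (w x)^-1)).
Hypotheses (v0 : forall x, 0 < v x) (w0 : forall x, 0 < w x).

Definition path_density n (s : nat -> R) : R :=
  \prod_(i < n) (v (s i.+1) / w (s i)).

Lemma path_density_gt0 n s : 0 < path_density n s.
Proof. by apply: prodr_gt0 => i _; rewrite divr_gt0. Qed.

Lemma measurable_path_density n :
  measurable_fun setT (path_density n : cpath R n.+1 -> R).
Proof.
apply: measurable_prod => i _; apply: measurable_funM.
  apply: (measurableT_comp mv); apply: measurable_coordinate.
  by rewrite ltnS.
apply: (measurableT_comp minv); apply: measurable_coordinate.
by rewrite ltnS ltnW.
Qed.

(* [bg_kernel X b c] is convertible to the case [v z = bg_v X (z - b - c)] and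
   [w z = bg_w X (z - b - c)]. *)
Definition twisted_kernel (y : R) (A : set R) : \bar R :=
  (\int[walk_kernel X y]_(z in A) (v z / w y)%:E)%E.

Lemma twisted_kernelE y A : measurable A ->
  twisted_kernel y A =
  (\int[P]_w' ((\1_A (y + X w') * (v (y + X w') / w y))%R)%:E)%E.
Proof.
move=> mA; rewrite /twisted_kernel integral_mkcond /walk_kernel.
have -> : (fun z => (v z / w y)%:E) \_ A = (fun z => (\1_A z * (v z / w y))%:E).
  apply/funext => z; rewrite patchE indicE; case: ifPn => _.
    by rewrite mul1r.
  by rewrite mul0r.
rewrite ge0_integral_distribution//.
- apply/measurable_EFinP; apply: measurable_funM => //.
  exact: measurable_funM.
- by move=> z; rewrite lee_fin mulr_ge0 ?divr_ge0 ?(ltW (v0 _)) ?(ltW (w0 _)).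
Qed.

Let mstep (B : set R) : measurable B -> measurable_fun setT (fun p : R * T =>
  \1_B (p.1 + X p.2) * (v (p.1 + X p.2) / w p.1)).
Proof.
move=> mB.
have msum : measurable_fun setT (fun p : R * T => p.1 + X p.2).
  apply: measurable_funD; first exact: measurable_fst.
  by apply: (measurableT_comp (measurable_funPT X)); exact: measurable_snd.
apply: measurable_funM.
  exact: (measurableT_comp (measurable_indic mB)).
apply: measurable_funM; first exact: (measurableT_comp mv).
by apply: (measurableT_comp minv); exact: measurable_fst.
Qed.

Let step_ge0 (B : set R) y z : 0 <= \1_B z * (v z / w y).
Proof. by rewrite mulr_ge0 ?divr_ge0 ?(ltW (v0 _)) ?(ltW (w0 _)). Qed.

Lemma measurable_twisted_kernel (B : set R) : measurable B ->
  measurable_fun setT (twisted_kernel ^~ B).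
Proof.
move=> mB.
pose f (p : R * T) : \bar R := (\1_B (p.1 + X p.2) * (v (p.1 + X p.2) / w p.1))%:E.
have -> : twisted_kernel ^~ B = fubini_F P f.
  by apply/funext => y; rewrite twisted_kernelE.
have mf : measurable_fun setT f by apply/measurable_EFinP; exact: mstep.
by apply: measurable_fun_fubini_tonelli_F => // p; rewrite lee_fin.
Qed.

Lemma twisted_kernel_ge0 y B : (0 <= twisted_kernel y B)%E.
Proof.
by apply: integral_ge0 => z _; rewrite lee_fin divr_ge0 ?(ltW (v0 _)) ?(ltW (w0 _)).
Qed.

Variable Q : probability (path_space R) R.
Hypothesis Q_chain : chain_law twisted_kernel 0 Q.

Let mid n : measurable_fun setT (fun s : path_space R => (s : cpath R n)).
Proof.
apply: measurable_cpath => k _ _ A mA.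
by apply: sub_sigma_algebra; exists k => //; exists A.
Qed.

Let Qn n : {measure set (cpath R n) -> \bar R} :=
  distribution Q (HB.pack (fun s : path_space R => (s : cpath R n))
    (isMeasurableFun.Build _ _ _ _ _ (@mid n)) : {mfun path_space R >-> cpath R n}).

Let D0 n s : 0 <= path_density n s := ltW (path_density_gt0 n s).

Let Wn n : {measure set (cpath R n.+1) -> \bar R} :=
  weighted_measure (distribution P (walkn n.+1)) (D0 n) (@measurable_path_density n).

Let mDE n : measurable_fun setT (fun s : cpath R n.+1 => (path_density n s)%:E).
Proof. by apply/measurable_EFinP; exact: measurable_path_density. Qed.

Let WnE n (A : set (cpath R n.+1)) : measurable A ->
  Wn n A = (\int[P]_(w in walk_path Xs @^-1` A) (path_density n (walk_path Xs w))%:E)%E.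
Proof.
move=> mA; rewrite /Wn /= /weighted_measure integral_mkcond.
rewrite ge0_integral_distribution; last 2 first.
- by apply/(measurable_restrictT _ _).1 => //; exact: measurable_funTS.
- by move=> s; apply: erestrict_ge0 => s' _; rewrite lee_fin.
by rewrite [RHS]integral_mkcond.
Qed.

(** An event of time 0 contains all paths started at 0 or none, so both sides are 1 or both are
    0. *)
Let Qn0 (A : set (path_space R)) : natural_filtration 0 A ->
  Q A = (\int[P]_(w in walk_path Xs @^-1` A) (path_density 0 (walk_path Xs w))%:E)%E.
Proof.
move=> nA; have mA := natural_filtration_measurable nA.
have [Q0 _] := Q_chain.
pose z : nat -> R := fun=> 0.
have m0 : measurable [set s : path_space R | s 0%N = 0].
  exact: (natural_filtration_measurable
    (natural_filtration_coordinate (leqnn 0) (measurable_set1 (0 : R)))).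
rewrite /path_density; under eq_integral do rewrite big_ord0.
rewrite integral_cst ?mul1e; last first.
  rewrite -[X in measurable X]setTI; exact: measurable_walk_path.
have [zA|zA] := pselect (A z).
  have -> : walk_path Xs @^-1` A = setT.
    apply/seteqP; split=> // u _ /=; apply: (natural_filtration_agree nA) zA => k.
    by rewrite leqn0 => /eqP ->; rewrite walk_path0.
  rewrite [RHS](@probability_setT _ _ _ P).
  apply/eqP; rewrite eq_le probability_le1//=.
  rewrite -Q0 le_measure ?inE// => s /= s0.
  apply: (natural_filtration_agree nA) zA => k.
  by rewrite leqn0 => /eqP ->; rewrite s0.
have -> : walk_path Xs @^-1` A = set0.
  apply/seteqP; split=> // u /= Au; apply: zA.
  apply: (natural_filtration_agree nA) Au => k.
  by rewrite leqn0 => /eqP ->; rewrite walk_path0.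
rewrite measure0; apply/eqP; rewrite eq_le measure_ge0 andbT.
have sub : A `<=` ~` [set s : path_space R | s 0%N = 0].
  move=> s As /= s0; apply: zA; apply: (natural_filtration_agree nA) As => k.
  by rewrite leqn0 => /eqP ->; rewrite s0.
have : (Q A <= Q (~` [set s : path_space R | s 0%N = 0%R]))%E.
  by rewrite le_measure ?inE//; exact: measurableC.
by rewrite probability_setC// Q0 subee.
Qed.

(** [chain_law] prescribes Q on the intersections of an event of F_n with a condition on the
    coordinate n + 1. These form a pi-system generating F_(n+1), so it suffices to compare the two
    measures there. *)
Theorem chain_law_density n (A : set (path_space R)) : natural_filtration n A ->
  Q A = (\int[P]_(w in walk_path Xs @^-1` A) (path_density n (walk_path Xs w))%:E)%E.
Proof.
elim: n A => [|n IH] A nA; first exact: Qn0.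
have [_ Qstep] := Q_chain.
(* The induction hypothesis as an equality of measures on the first n + 1 coordinates: an integral
   of the kernel against Q becomes one against the weighted law of the walk. *)
have IHn C : measurable C -> Qn n.+1 C = Wn n C.
  by move=> mC; rewrite WnE// -IH.
pose G : set (set (cpath R n.+2)) := [set C | exists H B,
  [/\ natural_filtration n H, measurable B &
      C = H `&` [set s : path_space R | B (s n.+1)]]].
have GT : G setT.
  exists setT, setT; split=> //; last by rewrite setTI; apply/seteqP; split.
  exact: (@measurableT _ (cpath R n.+1)).
have GI : setI_closed G.
  move=> _ _ [H [B [nH mB ->]]] [H' [B' [nH' mB' ->]]].
  exists (H `&` H'), (B `&` B'); split; last by rewrite setIACA.
    exact: (@measurableI _ (cpath R n.+1)).
  exact: measurableI.
have Gm : G `<=` measurable.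
  move=> _ [H [B [nH mB ->]]]; apply: measurableI.
    exact: natural_filtration_sub nH.
  exact: natural_filtration_coordinate.
have sG : (measurable : set (set (cpath R n.+2))) `<=` <<s G >>.
  apply: smallest_sub; first exact: smallest_sigma_algebra.
  move=> _ [k /= kn [B mB <-]]; apply: sub_sigma_algebra; rewrite setTI.
  move: kn; rewrite ltnS leq_eqVlt => /predU1P[->|kn].
    exists setT, B; split=> //; last by rewrite setTI.
    exact: (@measurableT _ (cpath R n.+1)).
  exists [set s | B (s k)], setT; split=> //.
    exact: natural_filtration_coordinate.
  by apply/seteqP; split=> s //= -[].
rewrite -WnE//.
transitivity (Qn n.+2 A); first by [].
apply: (@g_sigma_algebra_measure_unique _ _ (cpath R n.+2) G Gm
  (fun=> setT) (fun=> GT) _ (Qn n.+2) (Wn n.+1) GI _ _ _ (sG _ nA)).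
- by rewrite bigcup_const//; exists 0%N.
- move=> _ [H [B [nH mB ->]]].
  rewrite WnE; last by apply: Gm; exists H, B.
  transitivity (Q (H `&` [set s : path_space R | B (s n.+1)])); first by [].
  rewrite Qstep//.
  (* The density of the past times the one-step density, in terms of the past and the next
     increment; averaging over the increment produces [twisted_kernel]. *)
  pose f (p : cpath R n.+1 * R) : R := \1_H p.1 * (path_density n p.1 *
    (\1_B (p.1 n + p.2) * (v (p.1 n + p.2) / w (p.1 n)))).
  have mn : measurable_fun setT (fun p : cpath R n.+1 * R => (p.1 n : R)).
    by apply: (measurableT_comp (@measurable_coordinate R n.+1 n (ltnSn n))).
  have msum : measurable_fun setT (fun p : cpath R n.+1 * R => (p.1 n : R) + p.2).
    exact: measurable_funD.
  have mf : measurable_fun setT f.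
    apply: measurable_funM.
      have mH : measurable (H : set (cpath R n.+1)) by exact: nH.
      by apply: (measurableT_comp (measurable_indic mH)).
    apply: measurable_funM.
      exact: (measurableT_comp (@measurable_path_density n)).
    apply: measurable_funM.
      by apply: (measurableT_comp (measurable_indic mB)).
    apply: measurable_funM; first exact: (measurableT_comp mv).
    exact: (measurableT_comp minv).
  have f0 p : 0 <= f p by rewrite !mulr_ge0 ?invr_ge0 ?(ltW (v0 _)) ?(ltW (w0 _)).
  transitivity (\int[P]_u (f (walk_path Xs u, Xs n u))%:E)%E; last first.
    rewrite [RHS]integral_mkcond; apply: eq_integral => u _.
    rewrite patchE /f /= -walk_pathS; case: ifPn.
      rewrite inE => -[Hu Bu]; rewrite !indicE !mem_set// !mul1r.
      by rewrite /path_density [in RHS]big_ord_recr.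
    move=> /negP; rewrite inE => nHB; rewrite !indicE.
    have [Hu|Hu] := pselect (H (walk_path Xs u)); last by rewrite memNset// mul0r.
    have [Bu|Bu] := pselect (B (walk_path Xs u n.+1)); first by exfalso; apply: nHB.
    by rewrite (memNset Bu) mul0r !mulr0.
  rewrite (@integral_walk_step n (EFin \o f))//; last by apply/measurable_EFinP.
  have fE s : (\int[P]_w' (f (s, X w'))%:E =
      (\1_H s * path_density n s)%:E * twisted_kernel (s n) B)%E.
    have mB' : measurable_fun setT (fun u => (\1_B (s n + X u) *
        (v (s n + X u) / w (s n)))%:E).
      by apply/measurable_EFinP; exact: (measurable_fun_pair2 (s n) (mstep mB)).
    rewrite twisted_kernelE// -ge0_integralZl//=.
    - by apply: eq_integral => u _; rewrite -EFinM /f /= mulrA.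
    - by move=> u _; rewrite lee_fin.
    - by rewrite lee_fin mulr_ge0.
  under [RHS]eq_integral do rewrite fE.
  pose g (s : cpath R n.+1) : \bar R := ((\1_H s)%:E * twisted_kernel (s n) B)%E.
  have mg : measurable_fun setT g.
    apply: emeasurable_funM.
      by apply/measurable_EFinP; apply: measurable_indic; exact: nH.
    exact: (measurableT_comp (measurable_twisted_kernel mB)
      (@measurable_coordinate R n.+1 n (ltnSn n))).
  have g0 s : (0 <= g s)%E by rewrite mule_ge0 ?twisted_kernel_ge0// lee_fin.
  transitivity (\int[Q]_s g s)%E.
    rewrite integral_mkcond; apply: eq_integral => s _.
    rewrite patchE /g indicE.
    by case: ifPn => _; rewrite ?mul1e ?mul0e.
  transitivity (\int[Qn n.+1]_s g s)%E.
    by rewrite ge0_integral_distribution.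
  transitivity (\int[Wn n]_s g s)%E.
    by apply: eq_measure_integral => C mC _; exact: IHn.
  rewrite ge0_integral_weighted// ge0_integral_distribution//.
  - apply: eq_integral => u _ /=; rewrite /g EFinM.
    by rewrite muleAC.
  - exact: emeasurable_funM.
  - by move=> s; rewrite mule_ge0// lee_fin.
- by move=> _; exact: (le_lt_trans (probability_le1 Q measurableT) (ltry 1)).
Qed.

End path_density.

(** * First passage and direct proposals *)

Section hitting_events.
Variable R : realType.

Lemma hitting_time_le (b : R) (s : path_space R) n :
  (hitting_time b s <= n%:R%:E)%E <-> exists2 k, (k <= n)%N & b < s k.
Proof.
split=> [h|[k kn bk]]; last first.
  apply: ge_ereal_inf; exists (k%:R%:E); first by exists k.
  by rewrite lee_fin ler_nat.
apply: contrapT => no; move: h; apply/negP; rewrite -ltNge.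
(* Crossing times are integers: if none is at most [n], their infimum is at least n + 1. *)
apply: (@lt_le_trans _ _ n.+1%:R%:E); first by rewrite lte_fin ltr_nat.
apply: le_ereal_inf_tmp => _ [k /= bk <-]; rewrite lee_fin ler_nat ltnNge.
by apply/negP => kn; apply: no; exists k.
Qed.

Lemma hitting_time_lty (b : R) (s : path_space R) :
  (hitting_time b s < +oo)%E <-> exists k, b < s k.
Proof.
split=> [|[k bk]].
  by move/ereal_inf_lt => [_ [k bk _] _]; exists k.
apply: (@le_lt_trans _ _ k%:R%:E); last exact: ltry.
by apply/hitting_time_le; exists k.
Qed.

Lemma natural_filtration_hitting (b : R) n :
  natural_filtration n [set s : path_space R | (hitting_time b s <= n%:R%:E)%E].
Proof.
have -> : [set s : path_space R | (hitting_time b s <= n%:R%:E)%E] =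
    \bigcup_(k in `I_n.+1) [set s : path_space R | `]b, +oo[%classic (s k)].
  apply/seteqP; split=> s /=.
    by move/hitting_time_le => [k kn bk]; exists k => //=; rewrite in_itv/= bk.
  move=> [k /= kn]; rewrite in_itv/= andbT => bk.
  by apply/hitting_time_le; exists k.
apply: (@bigcup_measurable _ (cpath R n.+1)) => k kn.
exact: natural_filtration_coordinate.
Qed.

Lemma stopped_events_first_passage (b : R) n (B : set (path_space R)) :
  natural_filtration n B ->
  (forall s, B s -> (forall i, (i < n)%N -> s i <= b) /\ b < s n) ->
  stopped_events b B.
Proof.
move=> nB hB; split; first exact: natural_filtration_measurable nB.
move=> m; have [nm|mn] := leqP n m.
  apply: (@measurableI _ (cpath R m.+1)).
    exact: natural_filtration_sub nB.
  exact: natural_filtration_hitting.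
have -> : B `&` [set s | (hitting_time b s <= m%:R%:E)%E] = set0.
  apply/seteqP; split=> // s /= [Bs /hitting_time_le[k km bk]].
  have [h _] := hB s Bs; have := h k (leq_ltn_trans km mn).
  by rewrite leNgt bk.
exact: (@measurable0 _ (cpath R m.+1)).
Qed.

(** Shifting the numerators by one index turns the density into v(s_n) / v(s_0) times the product of
    the ratios v(s_i) / w(s_i), all at least 1. *)
Lemma path_density_ge1 (v w : R -> R) n (s : nat -> R) :
  (forall x, 0 < v x) -> (forall x, 0 < w x) ->
  (forall i, (i < n)%N -> w (s i) <= v (s i)) -> v (s 0%N) <= v (s n) ->
  1 <= path_density v w n s.
Proof.
move=> v0 w0 wv v0n.
suff H m : (m <= n)%N -> v (s m) / v (s 0%N) <= path_density v w m s.
  by apply: le_trans (H n (leqnn n)); rewrite ler_pdivlMr// mul1r.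
elim: m => [|m IH] mn.
  by rewrite /path_density big_ord0 divff// gt_eqF.
rewrite /path_density big_ord_recr/= -/(path_density v w m s).
apply: (@le_trans _ _ (v (s m) / v (s 0%N) * (v (s m.+1) / w (s m)))).
  have -> : v (s m) / v (s 0%N) * (v (s m.+1) / w (s m)) =
      v (s m.+1) / v (s 0%N) * (v (s m) / w (s m)).
    by field; rewrite !gt_eqF.
  by rewrite ler_peMr ?divr_ge0 ?(ltW (v0 _))// ler_pdivlMr// mul1r wv.
by rewrite ler_wpM2r ?IH ?(ltnW mn)// divr_ge0// ltW.
Qed.

(* Beyond time [k] every step multiplies the density by [v x / w x <= th], up to
   the telescoping boundary factor [v (s (k + j)) / v (s k)]. *)
Lemma path_density_le_geometric (v w : R -> R) k j (s : nat -> R) (kap th : R) :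
  (forall x, 0 < v x) -> (forall x, 0 < w x) -> (forall x, v x <= 1) ->
  0 <= kap -> 0 <= th ->
  (forall i, (i < k)%N -> (w (s i))^-1 <= kap) ->
  (forall i, (i < j)%N -> v (s (k + i)%N) <= th * w (s (k + i)%N)) ->
  path_density v w (k + j) s <= kap ^+ k * th ^+ j / v (s k).
Proof.
move=> v0 w0 v1 kap0 th0 hk hj.
have D0 n : 0 <= path_density v w n s.
  by apply: prodr_ge0 => i _; rewrite divr_ge0// ltW.
have Hk m : (m <= k)%N -> path_density v w m s <= kap ^+ m.
  elim: m => [|m IH] mk; first by rewrite /path_density big_ord0.
  rewrite /path_density big_ord_recr/= -/(path_density v w m s) exprSr.
  apply: ler_pM => //; [by rewrite divr_ge0 // ltW|exact/IH/ltnW|].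
  apply: le_trans (hk m mk); rewrite -[leRHS]mul1r ler_wpM2r// invr_ge0 ltW//.
have Hj : (forall i, (i < j)%N -> v (s (k + i)%N) <= th * w (s (k + i)%N)) ->
    path_density v w (k + j) s <= kap ^+ k * th ^+ j * (v (s (k + j)%N) / v (s k)).
  elim: j {hj} => [|j IH] hj.
    by rewrite addn0 expr0 mulr1 divff ?gt_eqF// mulr1; exact: Hk.
  rewrite addnS /path_density big_ord_recr/= -/(path_density v w (k + j) s).
  apply: (@le_trans _ _ (kap ^+ k * th ^+ j * (v (s (k + j)%N) / v (s k)) *
      (v (s (k + j).+1) / w (s (k + j)%N)))).
    rewrite ler_wpM2r ?divr_ge0 ?(ltW (v0 _)) ?(ltW (w0 _))//.
    by apply: IH => i ij; apply: hj; rewrite ltnS ltnW.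
  have -> : kap ^+ k * th ^+ j * (v (s (k + j)%N) / v (s k)) *
      (v (s (k + j).+1) / w (s (k + j)%N)) =
      kap ^+ k * th ^+ j * (v (s (k + j).+1) / v (s k)) *
      (v (s (k + j)%N) / w (s (k + j)%N)) by field; rewrite !gt_eqF.
  have -> : kap ^+ k * th ^+ j.+1 * (v (s (k + j).+1) / v (s k)) =
      kap ^+ k * th ^+ j * (v (s (k + j).+1) / v (s k)) * th.
    by rewrite exprSr; ring.
  apply: ler_wpM2l.
    by rewrite !mulr_ge0 ?exprn_ge0 ?invr_ge0 ?(ltW (v0 _)).
  by rewrite ler_pdivrMr// hj.
apply: (le_trans (Hj hj)); rewrite mulrA ler_pM2r ?invr_gt0//.
by rewrite ler_piMr// mulr_ge0 ?exprn_ge0.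
Qed.

End hitting_events.

(** * Steering the walk along events of positive probability *)

Section positive_paths.
Context {R : realType} {d : measure_display} {T : measurableType d}.
Variables (P : probability T R) (X : {RV P >-> R}) (Xs : nat -> {RV P >-> R}).
Hypothesis iid : iid_copies X Xs.

(** The walk is steered through events, as a single path may have probability zero. *)
Let reach n (G : set (path_space R)) :=
  natural_filtration n G /\ (0 < P (walk_path Xs @^-1` G))%E.

Lemma reachable_step n G (U : set R) : reach n G -> measurable U ->
  (0 < P (X @^-1` U))%E ->
  exists2 H, reach n.+1 H & forall s, H s -> G s /\ U (s n.+1 - s n).
Proof.
move=> [nG PG] mU PU.
pose H : set (path_space R) := G `&` [set s : path_space R | U (s n.+1 - s n)].
exists H; last by move=> s [].
have nU : natural_filtration n.+1 [set s : path_space R | U (s n.+1 - s n)].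
  have : measurable_fun setT (fun s : cpath R n.+2 => (s n.+1 : R) - s n).
    by apply: measurable_funB; apply: measurable_coordinate; rewrite ?ltnS// leqnSn.
  by move=> /(_ measurableT U mU); rewrite setTI.
split.
  apply: (@measurableI _ (cpath R n.+2)) => //.
  exact: natural_filtration_sub nG.
have -> : walk_path Xs @^-1` H = walk_path Xs @^-1` G `&` Xs n @^-1` U.
  apply/seteqP; split=> w /=; rewrite /H /= walk_pathS addrAC subrr add0r//.
rewrite (walk_step_independent iid nG mU) mule_gt0//.
by have [h _] := iid; rewrite [P _](h n U mU).
Qed.

Lemma reachable_start : reach 0 [set s : path_space R | s 0%N = 0].
Proof.
split; first exact: (natural_filtration_coordinate (leqnn 0) (measurable_set1 (0 : R))).
have -> : walk_path Xs @^-1` [set s : path_space R | s 0%N = 0] = setT.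
  by apply/seteqP; split=> w //= _; rewrite walk_path0.
by rewrite probability_setT.
Qed.

(** Lets the next step depend on the current position: of two alternatives covering G, at least one
    keeps positive probability. *)
Lemma reachable_split n G G1 G2 : reach n G -> natural_filtration n G1 ->
  natural_filtration n G2 -> G `<=` G1 `|` G2 ->
  reach n (G `&` G1) \/ reach n (G `&` G2).
Proof.
move=> [nG PG] n1 n2 G12.
have nI H : natural_filtration n H -> natural_filtration n (G `&` H).
  exact: (@measurableI _ (cpath R n.+1)).
have mI H : natural_filtration n H -> measurable (walk_path Xs @^-1` (G `&` H)).
  move=> nH; rewrite -[X in measurable X]setTI.
  apply: (measurable_walk_path Xs) => //.
  exact: natural_filtration_measurable (nI _ nH).
have [h1|h1] := ltP 0%E (P (walk_path Xs @^-1` (G `&` G1))).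
  by left; split => //; exact: nI.
right; split; first exact: nI.
rewrite lt0e measure_ge0 andbT; apply/eqP => h2.
move: PG; apply/negP; rewrite -leNgt.
have -> : walk_path Xs @^-1` G =
    walk_path Xs @^-1` (G `&` G1) `|` walk_path Xs @^-1` (G `&` G2).
  apply/seteqP; split=> w /=; last by move=> [[]|[]].
  by move=> Gw; case: (G12 _ Gw); [left|right].
have E1 : P (walk_path Xs @^-1` (G `&` G1)) = 0%E.
  by apply/eqP; rewrite eq_le h1 measure_ge0.
apply: (le_trans (measureU2 P (mI _ n1) (mI _ n2))).
by rewrite [X in (X + _ <= _)%E]E1 [X in (_ + X <= _)%E]h2 adde0.
Qed.

Variables (A r : R).
Hypothesis r0 : 0 < r.
Hypothesis down : (0 < P (X @^-1` `[(- A)%R, (- r)%R]%classic))%E.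
Hypothesis up : (0 < P (X @^-1` `[0%R, A]%classic))%E.

Let A0 : 0 <= A.
Proof.
rewrite leNgt; apply/negP => A0; move: up.
by rewrite set_itv_ge ?preimage_set0 ?measure0 ?ltxx// bnd_simp -ltNge.
Qed.

Lemma reachable_descent k : exists2 G, reach k G & forall s, G s ->
  [/\ s 0%N = 0, forall i, (i <= k)%N -> - (k%:R * A) <= s i <= 0 &
      s k <= - (k%:R * r)].
Proof.
elim: k => [|k [G rG hG]].
  exists [set s : path_space R | s 0%N = 0]; first exact: reachable_start.
  move=> s /= s0; split=> //; last by rewrite s0 mul0r oppr0.
  by move=> i; rewrite leqn0 => /eqP ->; rewrite s0 mul0r oppr0 lexx.
have [H rH hH] := reachable_step rG (measurable_itv _) down.
exists H => // s /hH[/hG[s0 hs sk]]; rewrite /= in_itv/= => /andP[d1 d2].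
have k1 : k.+1%:R = k%:R + 1 :> R by rewrite natr1.
have A_ge0 := A0; have r_gt0 := r0.
split=> //; last by rewrite k1; lra.
move=> i; rewrite leq_eqVlt => /predU1P[->|ik].
  have := hs k (leqnn k) => /andP[h1 h2]; rewrite k1.
  by apply/andP; split; lra.
have := hs i ik => /andP[h1 h2]; rewrite k1.
by apply/andP; split; lra.
Qed.

(** From a height of at least -M + A the walk steps down, otherwise up, by at most A. The band
    [[-M, -L]] has width at least 2 A, so both moves stay inside. *)
Lemma reachable_sojourn k N L M : 0 <= L -> L <= k%:R * r -> k%:R * A <= M ->
  L + 2 * A <= M ->
  exists2 G, reach (k + N) G & forall s, G s ->
  [/\ s 0%N = 0, forall i, (i <= k)%N -> - (k%:R * A) <= s i <= 0 &
      forall i, (i <= N)%N -> - M <= s (k + i)%N <= - L].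
Proof.
move=> L0 Lk kM LM; have A_ge0 := A0; have r_gt0 := r0; elim: N => [|N [G rG hG]].
  rewrite addn0; have [G rG hG] := reachable_descent k.
  exists G => // s /hG[s0 hs sk]; split=> // i; rewrite leqn0 => /eqP ->.
  rewrite addn0; have := hs k (leqnn k) => /andP[h1 h2].
  by apply/andP; split; lra.
pose G1 : set (path_space R) := [set s | `[- M + A, +oo[%classic (s (k + N)%N)].
pose G2 : set (path_space R) := [set s | `]-oo, - M + A]%classic (s (k + N)%N)].
have n1 : natural_filtration (k + N) G1 by exact: natural_filtration_coordinate.
have n2 : natural_filtration (k + N) G2 by exact: natural_filtration_coordinate.
have G12 : G `<=` G1 `|` G2.
  move=> s _; rewrite /G1 /G2 /= !in_itv/= andbT.
  by have [?|/ltW ?] := leP (- M + A) (s (k + N)%N); [left|right].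
have [r1|r2] := reachable_split rG n1 n2 G12.
- have [H rH hH] := reachable_step r1 (measurable_itv _) down.
  exists H; first by rewrite addnS.
  move=> s /hH[[/hG[s0 hs hN]]]; rewrite /G1 /= !in_itv/= andbT => h /andP[d1 d2].
  split=> // i; rewrite leq_eqVlt => /predU1P[->|iN]; last exact: hN.
  have := hN N (leqnn N) => /andP[h1 h2]; rewrite addnS.
  by apply/andP; split; lra.
- have [H rH hH] := reachable_step r2 (measurable_itv _) up.
  exists H; first by rewrite addnS.
  move=> s /hH[[/hG[s0 hs hN]]]; rewrite /G2 /= !in_itv/= => h /andP[d1 d2].
  split=> // i; rewrite leq_eqVlt => /predU1P[->|iN]; last exact: hN.
  have := hN N (leqnn N) => /andP[h1 h2]; rewrite addnS.
  by apply/andP; split; lra.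
Qed.

End positive_paths.

Section bounded_steps.
Context {R : realType} {d : measure_display} {T : measurableType d}.
Variables (P : probability T R) (X : {RV P >-> R}).

Lemma positive_bounded_part (I : set R) : measurable I ->
  (0 < P (X @^-1` I))%E ->
  exists n : nat, (0 < P (X @^-1` (I `&` `[(- n%:R)%R, n%:R]%classic)))%E.
Proof.
move=> mI PI; apply: contrapT => no.
pose F n : set T := X @^-1` (I `&` `[- n%:R, n%:R]%classic).
have mF n : measurable (F n).
  by apply: measurable_funPTI; exact: measurableI.
have F0 n : P (F n) = 0%E.
  apply/eqP; rewrite eq_le measure_ge0 andbT leNgt; apply/negP => h.
  by apply: no; exists n.
have FU : \bigcup_n F n = X @^-1` I.
  apply/seteqP; split=> w /=; first by move=> [n _ []].
  move=> Iw; exists (Num.bound `|X w|) => //; split=> //=.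
  by rewrite in_itv/= -ler_norml; apply/ltW/archi_boundP.
have := nondecreasing_cvg_mu (mu := P) mF _ _; rewrite FU => h.
have : P (X @^-1` I) = 0%E.
  apply: (@cvg_unique _ _ (P \o F @ \oo)) => //; first apply: h.
  - exact: measurable_funPTI.
  - move=> m n mn; rewrite subsetEset => w [Iw] /=; rewrite !in_itv/= => /andP[h1 h2].
    have mn' : m%:R <= n%:R :> R by rewrite ler_nat.
    by split => //=; rewrite in_itv/=; apply/andP; split; lra.
  - rewrite (_ : P \o F = cst 0%E); first exact: cvg_cst.
    by apply/funext => n /=.
by move=> E; move: PI; rewrite E ltxx.
Qed.

End bounded_steps.

Section proposals.
Context {R : realType} {d : measure_display} {T : measurableType d}.
Variables (P : probability T R) (X : {RV P >-> R}) (Xs : nat -> {RV P >-> R}).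
Hypothesis iid : iid_copies X Xs.
Hypothesis X_int : P.-integrable setT (EFin \o X).
Hypothesis EX_lt0 : ('E_P[X] < 0)%E.
Hypothesis X_unbounded : unbounded_right_support X.

Let v0 (y z : R) : 0 < bg_v X (z - y).
Proof. exact: bg_v_gt0. Qed.

Let w0 (y z : R) : 0 < bg_w X (z - y).
Proof. exact: bg_w_gt0. Qed.

Let mshift b c : measurable_fun setT (fun z : R => z - b - c).
Proof. by apply: measurable_funB => //; exact: measurable_funB. Qed.

Let mv b c : measurable_fun setT (fun z : R => bg_v X (z - b - c)).
Proof.
have m : measurable_fun setT (bg_v X) by exact: measurable_bg_v.
exact: (measurableT_comp m (@mshift b c)).
Qed.

Let minv b c : measurable_fun setT (fun z : R => (bg_w X (z - b - c))^-1).
Proof.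
apply: nonincreasing_measurable => // x y xy.
by rewrite lef_pV2 ?posrE ?bg_w_gt0// bg_w_nondecreasing// !lerD2r.
Qed.

Let bg_density b c := path_density (fun z => bg_v X (z - b - c))
  (fun z => bg_w X (z - b - c)).

Lemma bg_density_law b c (Q : probability (path_space R) R) :
  chain_law (bg_kernel X b c) 0 Q -> forall n (A : set (path_space R)),
  natural_filtration n A ->
  Q A = (\int[P]_(w in walk_path Xs @^-1` A)
           (bg_density b c n (walk_path Xs w))%:E)%E.
Proof.
move=> hQ n A nA.
by apply: (chain_law_density iid (@mv b c) (@minv b c)).
Qed.

Let measurable_bg_density b c n : measurable_fun setT
  (fun w => (bg_density b c n (walk_path Xs w))%:E).
Proof.
apply/measurable_EFinP.
exact: (measurableT_comp (measurable_path_density (@mv b c) (@minv b c) (n:=n))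
  (measurable_walk_cpath Xs (n:=n.+1))).
Qed.

(** Otherwise the left tail vanishes on []0, +oo[], against the negative mean. *)
Lemma negative_step_probability : exists2 r : R, 0 < r &
  (0 < P (X @^-1` `]-oo, (- r)%R]%classic))%E.
Proof.
apply: contrapT => no.
have N0 s : 0 < s -> left_tail X s = 0.
  move=> s0; apply/eqP; rewrite eq_le left_tail_ge0 andbT leNgt; apply/negP => h.
  by apply: no; exists s => //; rewrite -lte_fin left_tail_cdf in h.
have : tint (left_tail X) 0 = 0.
  rewrite /tint -Rintegral_itv_obnd_cbnd.
    rewrite (@eq_Rintegral _ _ _ _ _ (fun=> 0)); first by rewrite Rintegral_cst// mul0r.
    by move=> s; rewrite inE/= in_itv/= andbT => /N0.
  apply: integrableS (integrable_left_tail X_int 0) => //.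
  by move=> s /=; rewrite !in_itv/= !andbT => /ltW.
have := mean_tails X_int EX_lt0; have := mean_gt0 X_int EX_lt0.
have : 0 <= tint (tail_prob P X) 0 by apply: tint_ge0 => x _; exact: tail_prob_ge0.
move=> h1 h2 h3 h4; lra.
Qed.

Lemma bounded_steps : exists A r : R, [/\ 0 < r,
  (0 < P (X @^-1` `[(- A)%R, (- r)%R]%classic))%E &
  (0 < P (X @^-1` `[0%R, A]%classic))%E].
Proof.
have [r r0 Pr] := negative_step_probability.
have [n hn] := positive_bounded_part (measurable_itv _) Pr.
have Pu : (0 < P (X @^-1` `]0%R, +oo[%classic))%E.
  have -> : X @^-1` `]0, +oo[%classic = [set w | 0 < X w].
    by apply/seteqP; split=> w /=; rewrite in_itv/= andbT.
  exact: X_unbounded.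
have [m hm] := positive_bounded_part (measurable_itv _) Pu.
exists (n%:R + m%:R), r; split=> //.
- apply: (lt_le_trans hn); apply: le_measure; rewrite ?inE; try exact: measurable_funPTI.
    by apply: measurable_funPTI; exact: measurableI.
  move=> w /= [h1]; move: h1; rewrite !in_itv/= => h1 /andP[h2 h3].
  by rewrite h1 andbT (le_trans _ h2)// lerN2 lerDl.
- apply: (lt_le_trans hm); apply: le_measure; rewrite ?inE; try exact: measurable_funPTI.
    by apply: measurable_funPTI; exact: measurableI.
  move=> w /= [h1]; move: h1; rewrite !in_itv/= andbT => /ltW -> /andP[_ h3] /=.
  by rewrite (le_trans h3)// lerDr.
Qed.

(** Before the passage s_i <= b, so s_i - b - c <= -c <= x0 and the density is at least 1 on any
    first passage event; a stopped event is exhausted by such slices. Strictness comes from a single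
    large jump. *)
Lemma direct_proposal_of_superharmonic (c x0 b : R) :
  (forall x, x <= x0 -> bg_w X x <= bg_v X x) ->
  bg_v X (- b - c) < 1 -> - c <= x0 -> 0 <= b ->
  forall Q : probability (path_space R) R,
  chain_law (bg_kernel X b c) 0 Q -> direct_proposal b (walk_law Xs) Q.
Proof.
move=> wv vlt cx0 b0 Q hQ.
have law := bg_density_law hQ.
have mwalk (B : set (path_space R)) : measurable B -> measurable (walk_path Xs @^-1` B).
  by move=> mB; rewrite -[X in measurable X]setTI; exact: measurable_walk_path.
have dens_ge1 n s : s 0%N = 0 -> (forall i, (i < n)%N -> s i <= b) -> b < s n ->
    1 <= bg_density b c n s.
  move=> s0 sb bn; apply: path_density_ge1 => //.
  - move=> i /sb ib; apply: wv; lra.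
  - by apply: bg_v_nondecreasing => //; rewrite s0; lra.
have first_le n (B : set (path_space R)) : natural_filtration n B ->
    (forall s, B s -> (forall i, (i < n)%N -> s i <= b) /\ b < s n) ->
    (P (walk_path Xs @^-1` B) <= Q B)%E.
  move=> nB hB; rewrite (law n B nB).
  have mB := mwalk _ (natural_filtration_measurable nB).
  rewrite -[leLHS]mul1e -(integral_cst P mB).
  apply: ge0_le_integral => //.
  - apply: measurable_funTS; exact: measurable_bg_density.
  - move=> w /= /hB[h1 h2]; rewrite lee_fin dens_ge1// walk_path0//.
have tau_lt n : natural_filtration n
    [set s : path_space R | (hitting_time b s <= n%:R%:E)%E].
  exact: natural_filtration_hitting.
split.
- move=> B [mB hB] Bfin.
  pose C n := B `&` [set s : path_space R | (hitting_time b s <= n%:R%:E)%E].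
  have mC n : measurable (C n) by exact: natural_filtration_measurable (hB n).
  have ndC : nondecreasing_seq C.
    move=> m n mn; rewrite subsetEset => s [Bs h]; split=> //=.
    by apply: (le_trans h); rewrite lee_fin ler_nat.
  have CU : \bigcup_n C n = B.
    apply/seteqP; split=> s /=; first by move=> [n _ []].
    move=> Bs; have /hitting_time_lty[k bk] := Bfin _ Bs.
    by exists k => //; split=> //; apply/hitting_time_le; exists k.
  have le_C n : (P (walk_path Xs @^-1` C n) <= Q (C n))%E.
    elim: n => [|n IH].
      apply: (first_le 0%N); first exact: hB.
      move=> s [_ /hitting_time_le[k]]; rewrite leqn0 => /eqP -> bs.
      by split.
    (* The slice on which the level is crossed for the first time at n + 1. *)
    pose E := C n.+1 `\` C n.
    have nE : natural_filtration n.+1 E.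
      apply: (@measurableD _ (cpath R n.+2)); first exact: hB.
      exact: natural_filtration_sub (hB n).
    have CE : C n.+1 = C n `|` E.
      rewrite /E setDE setUIr setUCr setIT setUC.
      apply/esym/setUidl; rewrite -subsetEset; exact: ndC.
    have dE : C n `&` E = set0 by apply/seteqP; split=> // s [Cs []].
    have mE := natural_filtration_measurable nE.
    rewrite CE preimage_setU !measureU//; last 3 first.
    - exact: mwalk.
    - exact: mwalk.
    - by rewrite -preimage_setI dE preimage_set0.
    apply: leeD => //; apply: (first_le n.+1) => // s [[Bs /hitting_time_le[k kn bk]] nC].
    have sb i : (i < n.+1)%N -> s i <= b.
      rewrite ltnS => i_n; rewrite leNgt; apply/negP => bi; apply: nC.
      by split=> //; apply/hitting_time_le; exists i.
    split=> //; move: kn; rewrite leq_eqVlt => /predU1P[<-//|kn].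
    by have := sb k kn; rewrite leNgt bk.
  have cP : (P \o (fun n => walk_path Xs @^-1` C n)) n @[n --> \oo] -->
      P (walk_path Xs @^-1` B).
    rewrite -CU preimage_bigcup; apply: nondecreasing_cvg_mu.
    - by move=> n; exact: mwalk.
    - by rewrite -preimage_bigcup CU; exact: mwalk.
    - move=> m n mn; rewrite subsetEset; apply: preimage_subset.
      by rewrite -subsetEset; exact: ndC.
  have cQ : (Q \o C) n @[n --> \oo] --> Q B.
    by rewrite -CU; apply: nondecreasing_cvg_mu => //; rewrite CU.
  by apply: (lee_cvg_to cP cQ); exact: nearW.
- have [x1 hx1] := bg_v_eventually1 X_int EX_lt0 X_unbounded.
  (* A first jump beyond [M] crosses [b] and lands where v = 1, so its density is exactly 1 / w(-b -
     c), which exceeds 1. *)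
  pose M := Num.max b (x1 + b + c).
  pose B : set (path_space R) := [set s | s 0%N = 0] `&`
    [set s | `]M, +oo[%classic (s 1%N)].
  have nB : natural_filtration 1 B.
    apply: (@measurableI _ (cpath R 2)).
      exact: (natural_filtration_coordinate (leq0n 1) (measurable_set1 (0 : R))).
    exact: natural_filtration_coordinate.
  have hB s : B s -> [/\ s 0%N = 0, b < s 1%N & x1 <= s 1%N - b - c].
    move=> [s0] /=; rewrite in_itv/= andbT gt_max => /andP[bs xs].
    by split=> //; lra.
  exists B; split.
  + apply: (stopped_events_first_passage nB) => s /hB[s0 bs _]; split=> // i.
    by rewrite ltnS leqn0 => /eqP ->; rewrite s0.
  + by move=> s /hB[_ bs _]; apply/hitting_time_lty; exists 1%N.
  rewrite (law 1%N B nB) /walk_law /pushforward.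
  have PB : (0 < P (walk_path Xs @^-1` B))%E.
    have -> : walk_path Xs @^-1` B = Xs 0%N @^-1` `]M, +oo[%classic.
      apply/seteqP; split=> w /=; rewrite /B /= walk_pathS walk_path0 add0r.
        by move=> [].
      by [].
    have [h _] := iid; rewrite [P _](h 0%N _ (measurable_itv _)).
    rewrite /distribution /pushforward.
    have -> : X @^-1` `]M, +oo[%classic = [set w | M < X w].
      by apply/seteqP; split=> w /=; rewrite in_itv/= andbT.
    exact: X_unbounded.
  have wlt : bg_w X (- b - c) < 1.
    by apply: le_lt_trans vlt; apply: wv; lra.
  have mB := mwalk _ (natural_filtration_measurable nB).
  have -> : (\int[P]_(w in walk_path Xs @^-1` B)
      (bg_density b c 1 (walk_path Xs w))%:E =
      \int[P]_(w in walk_path Xs @^-1` B) ((bg_w X (- b - c))^-1)%:E)%E.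
    apply: eq_integral => w; rewrite inE => /hB[s0 bs xs].
    rewrite /bg_density /path_density big_ord_recr big_ord0/= mul1r.
    by rewrite hx1// walk_path0 sub0r mul1r.
  rewrite integral_cst// -[ltLHS]mul1e lte_pmul2r//; last first.
    by rewrite fin_num_measure.
  by rewrite lte_fin invf_gt1 ?bg_w_gt0.
Qed.

Lemma not_direct_proposal_of_subharmonic (b c x0 : R) :
  (forall l u, u <= x0 -> exists2 th : R, 0 <= th < 1 &
    forall x, l <= x <= u -> bg_v X x <= th * bg_w X x) ->
  0 <= b -> forall Q : probability (path_space R) R,
  chain_law (bg_kernel X b c) 0 Q -> ~ direct_proposal b (walk_law Xs) Q.
Proof.
move=> hth b0 Q hQ [dom _].
have law := bg_density_law hQ.
have [A [r [r0 down up]]] := bounded_steps.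
(* For s <= -L the argument s - b - c is at most [x0], so the ratio bound holds during the sojourn
   whatever the value of [c]. *)
pose L := Num.max 0 (- x0 - b - c).
have L0 : 0 <= L by rewrite le_max lexx.
have Lx0 : - x0 - b - c <= L by rewrite le_max lexx orbT.
pose k := Num.bound (L / r).
have Lk : L <= k%:R * r.
  by rewrite -ler_pdivrMr//; apply/ltW/archi_boundP; rewrite divr_ge0// ltW.
pose M := Num.max (k%:R * A) (L + 2 * A).
have kM : k%:R * A <= M by rewrite le_max lexx.
have LM : L + 2 * A <= M by rewrite le_max lexx orbT.
have [|th /andP[th0 th1] hv] := hth (- M - b - c) (- L - b - c); first by lra.
(* During the descent the path stays above -k A; as w is nondecreasing, each factor 1 / w is at most
   [kap]. *)
pose kap := (bg_w X (- (k%:R * A) - b - c))^-1.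
have kap0 : 0 < kap by rewrite invr_gt0 bg_w_gt0.
pose v1 := bg_v X (- M - b - c).
have v10 : 0 < v1 by exact: bg_v_gt0.
(* The descent costs the factor kap^k / v1, independent of the length of the sojourn, which can thus
   be chosen to outweigh it. *)
have [N hN] : exists N, kap ^+ k * th ^+ N.+1 / v1 <= 1 / 2.
  have : kap ^+ k * th ^+ n.+1 / v1 @[n --> \oo] --> kap ^+ k * 0 / v1.
    apply: cvgM; last exact: cvg_cst.
    apply: cvgM; first exact: cvg_cst.
    have : th ^+ n @[n --> \oo] --> (0 : R) by apply: cvg_expr; rewrite ger0_norm.
    by rewrite -cvg_shiftS.
  rewrite mulr0 mul0r => /cvgr_le /(_ (1 / 2)) h.
  have [|n _ /(_ n (leqnn n)) hn] := h; first by lra.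
  by exists n.
have [G rG hG] := reachable_sojourn iid r0 down up N L0 Lk kM LM.
(* From a height of at least -M, a jump larger than M + b ends above [b]. *)
have PU : (0 < P (X @^-1` `](M + b)%R, +oo[%classic))%E.
  have -> : X @^-1` `]M + b, +oo[%classic = [set w | M + b < X w].
    by apply/seteqP; split=> w /=; rewrite in_itv/= andbT.
  exact: X_unbounded.
have [B [nB PB] hB] := reachable_step iid rG (measurable_itv _) PU.
have hBs s : B s -> [/\ s 0%N = 0, forall i, (i <= k)%N -> - (k%:R * A) <= s i <= 0,
    forall i, (i <= N)%N -> - M <= s (k + i)%N <= - L & b < s (k + N).+1].
  move=> /hB[/hG[s0 hs hN']]; rewrite /= in_itv/= andbT => h.
  split=> //; have := hN' N (leqnn N) => /andP[h1 h2]; lra.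
have stopB : stopped_events b B.
  apply: (stopped_events_first_passage nB) => s /hBs[s0 hs hN' bs]; split=> // i.
  rewrite ltnS => iN; have [ik|ki] := leqP i k.
    by have /andP[_ h] := hs i ik; exact: le_trans b0.
  have := hN' (i - k)%N; rewrite leq_subLR => /(_ iN).
  by rewrite subnKC ?(ltnW ki)// => /andP[_ h]; lra.
have finB : B `<=` [set s | hitting_time b s < +oo]%E.
  by move=> s /hBs[_ _ _ bs]; apply/hitting_time_lty; exists (k + N).+1.
have dens s : B s -> bg_density b c (k + N).+1 s <= 1 / 2.
  move=> /hBs[s0 hs hN' bs]; apply: le_trans hN.
  rewrite -addnS; apply: (le_trans (path_density_le_geometric
    (kap := kap) (th := th) _ _ _ (ltW kap0) th0 _ _)) => //=.
  - by move=> x; exact: bg_v_le1.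
  - move=> i ik; rewrite /kap lef_pV2 ?posrE ?bg_w_gt0//.
    apply: bg_w_nondecreasing => //; have /andP[h _] := hs i (ltnW ik); lra.
  - move=> i iN; apply: hv; have := hN' i; rewrite -ltnS => /(_ iN) /andP[h1 h2].
    by apply/andP; split; lra.
  rewrite ler_wpM2l ?mulr_ge0 ?exprn_ge0 ?(ltW kap0)//.
  rewrite lef_pV2 ?posrE ?bg_v_gt0//; apply: bg_v_nondecreasing => //.
  by have := hN' 0%N (leq0n N); rewrite addn0 => /andP[h _]; lra.
have := dom B stopB finB; rewrite (law _ B nB) /walk_law /pushforward; apply/negP.
rewrite -ltNge.
have mB : measurable (walk_path Xs @^-1` B).
  rewrite -[X in measurable X]setTI; apply: measurable_walk_path => //.
  exact: natural_filtration_measurable nB.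
apply: (@le_lt_trans _ _ ((1 / 2)%:E * P (walk_path Xs @^-1` B))%E).
  rewrite -(integral_cst P mB); apply: ge0_le_integral => //.
  - by move=> w _; rewrite lee_fin ltW// path_density_gt0.
  - apply: measurable_funTS; exact: measurable_bg_density.
  - by move=> w Bw; rewrite lee_fin dens.
rewrite -[ltRHS]mul1e lte_pmul2r ?fin_num_measure//.
by rewrite lte_fin; lra.
Qed.

End proposals.

Theorem theorem1 (R : realType) (d : measure_display) (T : measurableType d)
    (P : probability T R) (X : {RV P >-> R}) (Xs : nat -> {RV P >-> R})
    (alpha : R) :
  iid_copies X Xs ->
  P.-integrable setT (EFin \o X) ->
  ('E_P[X] < 0)%E ->
  unbounded_right_support X ->
  1 < alpha ->
  assumption_A1 X alpha ->
  assumption_A2 X ->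
  assumption_A3 X alpha ->
  (1 < alpha < 3 / 2 ->
     exists c : R, forall b : R, 0 <= b ->
     forall Q : probability (path_space R) R,
       chain_law (bg_kernel X b c) 0 Q ->
       direct_proposal b (walk_law Xs) Q) /\
  (3 / 2 < alpha < 2 ->
     forall c b : R, 0 <= b ->
     forall Q : probability (path_space R) R,
       chain_law (bg_kernel X b c) 0 Q ->
       ~ direct_proposal b (walk_law Xs) Q).
Proof.
move=> iid X_int EX_lt0 X_unb a1 A1 A2 A3; split.
- move=> a32.
  have [x0 hx0] := bg_superharmonic X_int EX_lt0 X_unb A1 A2 A3 a32.
  have [y0 hy0] := bg_v_eventually_lt1 X_int EX_lt0 X_unb.
  (* This gives -c <= x0 and, for every b >= 0, -b - c <= y0, so one [c] serves all levels. *)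
  exists (Num.max (- x0) (- y0)) => b b0 Q hQ.
  have cx0 : - x0 <= Num.max (- x0) (- y0) by rewrite le_max lexx.
  have cy0 : - y0 <= Num.max (- x0) (- y0) by rewrite le_max lexx orbT.
  apply: (direct_proposal_of_superharmonic iid X_int EX_lt0 X_unb hx0) hQ => //.
  + by apply: hy0; lra.
  + by lra.
- move=> a32 c b b0 Q hQ.
  have [x0 hx0] := bg_strictly_subharmonic X_int EX_lt0 X_unb A1 A3 a32.
  exact: (not_direct_proposal_of_subharmonic iid X_int EX_lt0 X_unb hx0 b0 hQ).
Qed.
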